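(* Let $\mathcal{C}$ be a class of polytime computable functions from $\mathbb{R}^2$ to $\mathbb{R}$ that approximates the class of polytime computable integer functions. Let $f:\mathbb{R}\to\mathbb{R}$ be locally poly-Lipschitz. Then $f$ is polytime computable if and only if $f$ is $\mathcal{C}$-definable.
   Context: Dyadic numbers: $\mathbb{D}=\{a/2^b : a\in\mathbb{Z}, b\in\mathbb{N}\}$. For $x\in\mathbb{R}$, $CF_x$ is the set of functions $\varphi:\mathbb{N}\to\mathbb{D}$ with $|x-\varphi(n)|\le 2^{-n}$ for all $n\in\mathbb{N}$. A function $f:\mathbb{R}^d\to\mathbb{R}$ is computable if there is an oracle Turing machine $M$ (with $d$ oracles) such that for all $(x_1,\dots,x_d)\in\mathbb{R}^d$, all $\varphi_i\in CF_{x_i}$ and all $n\in\mathbb{N}$, $|M^{\varphi_1,\dots,\varphi_d}(n)-f(x_1,\dots,x_d)|\le 2^{-n}$. It is polytime computable if moreover there is a polynomial $p$ such that the running time of $M^{\varphi_1,\dots,\varphi_d}(n)$ is at most $p(k,n)$, where $k=\min\{j\in\mathbb{N} : x_1,\dots,x_d\in[-2^j,2^j]\}$. An integer function $h:\mathbb{Z}^2\to\mathbb{Z}$ is polytime computable if it is computable by a Turing machine in time polynomial in the lengths of the binary representations of its arguments. $f:\mathbb{R}\to\mathbb{R}$ is locally Lipschitz if it is Lipschitz on every compact subset of $\mathbb{R}$. With $C_i=[-2^i,2^i]$, $f$ is locally poly-Lipschitz if it is locally Lipschitz and there is a sequence $(K_{C_i})_{i\in\mathbb{N}}$ of natural numbers,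 $K_{C_i}$ being a Lipschitz constant of $f$ on $C_i$, and a Turing machine that on input $i$ computes $K_{C_i}$ in time $p(i)$ for some polynomial $p$. A class $\mathcal{C}$ of functions $\mathbb{R}^2\to\mathbb{R}$ approximates a class $\mathcal{D}$ of functions $\mathbb{Z}^2\to\mathbb{Z}$ if for every $g\in\mathcal{D}$ there is $\tilde g\in\mathcal{C}$ with $|\tilde g(x,y)-g(x,y)|\le 1/4$ for all $x,y\in\mathbb{Z}$. Here $\mathcal{D}$ is the class of polytime computable functions $\mathbb{Z}^2\to\mathbb{Z}$. $f:\mathbb{R}\to\mathbb{R}$ is $\mathcal{C}$-definable if there is $\tilde g\in\mathcal{C}$ such that $|\tilde g(x,y)-y f(x/y)|\le 3$ for all $x\in\mathbb{Z}$ and all integers $y\ge 1$. *)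

(* Defs.v *)
From HB Require Import structures.
From mathcomp Require Import all_boot all_order all_algebra.
From mathcomp Require Import all_classical all_reals all_analysis.
Import Order.TTheory GRing.Theory Num.Theory.
Import numFieldNormedType.Exports.

Set Implicit Arguments.
Unset Strict Implicit.
Unset Printing Implicit Defensive.

Local Open Scope classical_set_scope.
Local Open Scope ring_scope.

(** * Oracle Turing machines *)

Inductive digit := Bit of bool | Minus | Point.

Inductive move := MoveLeft | Stay | MoveRight.

(* A deterministic multitape machine with e input tapes and d oracle tapes,
   besides an output tape and finitely many work tapes.  A cell contains
   None (the blank), a digit or an auxiliary symbol. *)
Record machine (e d : nat) := Machine {
  aux : finType;
  work : finType;
  state : finType;
  start : state;
  halted : pred state;
  (* [query s = Some (i, s')]: in state s, call oracle i and go to state s' *)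
  query : state -> option ('I_d * state);
  delta : state -> {ffun 'I_e + 'I_d + option work -> option (digit + aux)} ->
    state * {ffun 'I_e + 'I_d + option work -> option (digit + aux) * move}
}.

Section Semantics.
Variables (e d : nat) (M : machine e d).

Definition symbol : Type := option (digit + aux M).
Definition tape_id : finType := ('I_e + 'I_d + option (work M))%type.

Definition input_tape (i : 'I_e) : tape_id := inl (inl i).
Definition oracle_tape (i : 'I_d) : tape_id := inl (inr i).
Definition output_tape : tape_id := inr None.

(* A two-way infinite tape is (l, r): r lists the cells from the scanned one
   rightwards, l the cells to its left, nearest first; all other cells are
   blank. *)
Definition tape : Type := (seq symbol * seq symbol)%type.

Definition scanned (t : tape) : symbol := head None t.2.

Definition shift (m : move) (t : tape) : tape :=
  match m with
  | MoveLeft => (behead t.1, head None t.1 :: t.2)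
  | Stay => t
  | MoveRight => (scanned t :: t.1, behead t.2)
  end.

Definition act (a : symbol * move) (t : tape) : tape :=
  shift a.2 (t.1, a.1 :: behead t.2).

Definition tape_of (w : seq digit) : tape := ([::], [seq Some (inl c) | c <- w]).

(* The maximal blank-free word starting at the scanned cell. *)
Definition word_at (t : tape) : seq symbol :=
  take (find (fun c => ~~ isSome c) t.2) t.2.

(* The number of consecutive 1s starting at the scanned cell. *)
Definition unary_at (t : tape) : nat :=
  find (fun c => if c is Some (inl (Bit true)) then false else true) t.2.

Definition config : Type := (state M * {ffun tape_id -> tape})%type.

(* Oracle i maps a natural number, written in unary on its tape, to a word
   which replaces the contents of that tape in one step. *)
Definition step (O : 'I_d -> nat -> seq digit) (c : config) : config :=
  let: (s, ts) := c in
  if halted s then c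
  else if query s is Some (i, s') then
    (s', [ffun t => if t == oracle_tape i
                    then tape_of (O i (unary_at (ts t))) else ts t])
  else
    let: (s', a) := delta s [ffun t => scanned (ts t)] in
    (s', [ffun t => act (a t) (ts t)]).

Definition initial (ins : 'I_e -> seq digit) : config :=
  (start M, [ffun t => if t is inl (inl i) then tape_of (ins i)
                       else tape_of [::]]).

(* M halts within T steps and its output is w. *)
Definition outputs (O : 'I_d -> nat -> seq digit) (ins : 'I_e -> seq digit)
    (T : nat) (w : seq digit) : Prop :=
  let: (s, ts) := iter T (step O) (initial ins) in
  halted s /\ word_at (ts output_tape) = [seq Some (inl c) | c <- w].

End Semantics.

Definition no_oracle (i : 'I_0) (n : nat) : seq digit := [::].

(** * Representations of numbers *)

Definition unary (n : nat) : seq digit := nseq n (Bit true).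

(* Most significant bit first, without superfluous leading 0s; 0 is "0". *)
Definition binary (n : nat) : seq digit :=
  [seq Bit (odd (n %/ 2 ^ i)) | i <- rev (iota 0 (trunc_log 2 n).+1)].

Definition binary_int (z : int) : seq digit :=
  (if z < 0 then [:: Minus] else [::]) ++ binary `|z|%N.

Definition dyadic : set rat :=
  [set q | exists (a : int) (b : nat), q = a%:~R / 2 ^+ b].

(* The finite binary expansion of a dyadic number: sign, integer part, point,
   fractional part without trailing 0s.  An oracle answer may be arbitrarily
   long; starting with the most significant digits lets a time-bounded machine
   use it. *)
Definition binary_dyadic (q : rat) : seq digit :=
  let N := `|numq q|%N in
  let b := logn 2 `|denq q|%N in
  (if q < 0 then [:: Minus] else [::]) ++ binary (N %/ 2 ^ b)
    ++ Point :: [seq Bit (odd (N %/ 2 ^ (b - i))) | i <- iota 1 b].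

(** * Polynomial time computability *)

Definition eval2 (p : {poly {poly nat}}) (a b : nat) : nat := p.[a%:P].[b].

Definition polytime_int2 : set (int -> int -> int) :=
  [set h | exists (M : machine 2 0) (p : {poly {poly nat}}), forall x y : int,
    outputs M no_oracle
      (fun i => binary_int (if i == ord0 then x else y))
      (eval2 p (size (binary_int x)) (size (binary_int y)))
      (binary_int (h x y))].

Section Real.
Variable R : realType.

Definition CF (x : R) : set (nat -> rat) :=
  [set phi | forall n, dyadic (phi n) /\ `|x - ratr (phi n)| <= 2 ^- n].

Lemma ex_radius d (x : 'rV[R]_d) : exists j,
  [forall i, `|x 0 i| <= 2 ^+ j].
Proof.
exists (\sum_(i < d) (Num.truncn `|x 0%R i|).+1)%N; apply/forallP => i.
apply: le_trans (ltW (truncnS_gt _)) _.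
rewrite -natrX ler_nat (bigD1 i) //=.
by apply: leq_trans (ltnW (ltn_expl _ (ltnSn 1))); apply: leq_addr.
Qed.

(* The least j such that x is in [-2^j, 2^j]^d. *)
Definition radius d (x : 'rV[R]_d) : nat := ex_minn (ex_radius x).

(* The precision n is given to the machine in unary. *)
Definition polytime_real d (f : 'rV[R]_d -> R) : Prop :=
  exists (M : machine 1 d) (p : {poly {poly nat}}),
  forall (x : 'rV[R]_d) (phi : 'I_d -> nat -> rat),
    (forall i, CF (x 0 i) (phi i)) ->
  forall n : nat, exists q : rat,
    [/\ dyadic q,
        outputs M (fun i m => binary_dyadic (phi i m)) (fun=> unary n)
          (eval2 p (radius x) n) (binary_dyadic q)
      & `|ratr q - f x| <= 2 ^- n].

Definition polytime_real1 (f : R -> R) : Prop :=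
  polytime_real (fun x : 'rV[R]_1 => f (x 0 0)).

Definition polytime_real2 : set (R -> R -> R) :=
  [set g | polytime_real (fun x : 'rV[R]_2 => g (x 0 0) (x 0 1))].

Definition locally_lipschitz (f : R -> R) : Prop :=
  forall A : set R, compact A -> [lipschitz f x | x in A].

Definition locally_poly_lipschitz (f : R -> R) : Prop :=
  locally_lipschitz f /\
  exists K : nat -> nat,
    (forall i, (K i)%:R.-lipschitz_(`[- 2 ^+ i, 2 ^+ i]) f) /\
    exists (M : machine 1 0) (p : {poly nat}), forall i,
      outputs M no_oracle (fun=> unary i) p.[i] (binary (K i)).

Definition approximates (C : set (R -> R -> R)) (D : set (int -> int -> int)) :=
  forall g, D g -> exists2 g', C g' &
    forall x y : int, `|g' x%:~R y%:~R - (g x y)%:~R| <= 1 / 4.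

Definition definable (C : set (R -> R -> R)) (f : R -> R) : Prop :=
  exists2 g, C g & forall x y : int, 1 <= y ->
    `|g x%:~R y%:~R - y%:~R * f (x%:~R / y%:~R)| <= 3.

End Real.

(* Main.v *)
(* If f is polynomial time, y f(x/y) is approximated within 2 by an integer
   function: simulate the machine of f with precision 2^-n < 1/(4y), answer its
   queries by long division of x by y, and multiply the result by y.
   Conversely, if g(x, y) is within 3 of y f(x/y), then for y = 2^(s+1) and an
   integer X close to x y the number g(X, y) / y is within O(K 2^-s) of f(x),
   where K is a Lipschitz constant of f near x; K is computed first and tells
   how large s has to be.
   The quotients, X and the results all get an additional last digit 1.  This
   costs an error of one unit and makes the expansions canonical and the values
   nonzero, so that neither trailing 0s nor the sign of 0 have to be dealt with. *)

From HB Require Import structures.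
Require Import Defs.
From mathcomp Require Import all_boot all_order all_algebra.
From mathcomp Require Import all_classical all_reals all_analysis.
From mathcomp Require Import zify ring lra.
Import Order.TTheory GRing.Theory Num.Theory.

Set Implicit Arguments.
Unset Strict Implicit.
Unset Printing Implicit Defensive.

(** * Machines with exits *)

(** Running time is what shapes both directions. An oracle answer replaces the query on its tape and
    may serve as part of the next query. Answers of length m + D to a query m are harmless, whereas
    a factor in front of m would only give an exponential bound; the expansions of quotients are
    short enough. In the other direction the answers of the given oracle have no length bound at
    all. Only the integer part, whose length is controlled by the size of x, and s fractional digits
    are read, the remainder is never traversed, and the next query is merely separated from it by a
    blank. The function g is evaluated at dyadic points, so constant sequences serve as its oracles
    and precision 0 is enough: an error of 1 is small compared with y. The integer function is not
    given by a formula, because its values depend on what the machine of f answers; it is obtained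
    by choice. Programs are composed by combinators whose rules carry a number of steps, so that
    correctness and running time are proved together, by symbolic execution. *)

Section Streams.
Variable S : Type.
Implicit Types (l u v : seq S) (t : (nat -> option S) * (nat -> option S)).

(** Lists of cells that differ in trailing blanks denote the same tape. As functions such tapes are
    equal, so that contents can be specified by equations. *)
Definition stape : Type := ((nat -> option S) * (nat -> option S))%type.

Definition scons (a : option S) (l : nat -> option S) : nat -> option S :=
  fun i => if i is i'.+1 then l i' else a.

Definition stail (l : nat -> option S) : nat -> option S := fun i => l i.+1.

Definition sact (a : option S * move) (t : stape) : stape :=
  match a.2 with
  | MoveLeft => (stail t.1, scons (t.1 0) (scons a.1 (stail t.2)))
  | Stay => (t.1, scons a.1 (stail t.2))
  | MoveRight => (scons a.1 t.1, stail t.2)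
  end.

Definition str l : nat -> option S := fun i => nth None [seq Some x | x <- l] i.

(* [Tp u v]: head on the first symbol of v, with u to its left, nearest first. *)
Definition Tp u v : stape := (str u, str v).

Lemma str_cons x l : str (x :: l) = scons (Some x) (str l).
Proof. by apply/funext => i; case: i. Qed.

Lemma str_nil0 : str [::] = scons None (str [::]).
Proof. by apply/funext => i; case: i => [|i]; rewrite /str /= ?nth_nil. Qed.

Lemma stail_scons a s : stail (scons a s) = s.
Proof. by []. Qed.

Lemma scons_stail s : scons (s 0) (stail s) = s.
Proof. by apply/funext => i; case: i. Qed.

Lemma stail_str l : stail (str l) = str (behead l).
Proof. by case: l => [|x l]; apply/funext => i //; rewrite /stail /str /= nth_nil. Qed.

Lemma str0 l : str l 0 = ohead l.
Proof. by case: l. Qed.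

Lemma sact_id t : sact (t.2 0, Stay) t = t.
Proof. by rewrite /sact /= scons_stail; case: t. Qed.

Lemma sact_write_cons x y u v : sact (Some y, Stay) (Tp u (x :: v)) = Tp u (y :: v).
Proof. by rewrite /sact /Tp /= str_cons stail_scons -str_cons. Qed.

Lemma sact_write_nil y u : sact (Some y, Stay) (Tp u [::]) = Tp u [:: y].
Proof. by rewrite /sact /Tp /= str_nil0 stail_scons -str_cons. Qed.

End Streams.

Section Progs.
Variables (d : nat) (S : Type) (T : eqType) (ot : 'I_d -> T).
Variable isone : option S -> bool.

Definition conf : Type := T -> stape S.

(* An open machine: [inr a] is the exit with value a.  A state either calls an
   oracle or reads all scanned cells and acts on all tapes. *)
Record prog (A : Type) := Prog {
  pst : finType;
  pinit : pst + A;
  pnext : pst -> ('I_d * (pst + A)) +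
    ((T -> option S) -> (pst + A) * (T -> option S * move))
}.

(** A tape given by a function may carry ones for ever; the default 0 covers this case, which does
    not arise for the finite lists of cells of a machine. *)
Definition sunary (t : stape S) : nat :=
  xget 0 [set n | (forall i, i < n -> isone (t.2 i)) /\ ~~ isone (t.2 n)]%classic.

Lemma sunaryE (t : stape S) n :
  (forall i, i < n -> isone (t.2 i)) -> ~~ isone (t.2 n) -> sunary t = n.
Proof.
move=> h1 h2; rewrite /sunary; case: xgetP => [m -> [g1 g2]|/(_ n)]; last by case.
apply/eqP; rewrite eqn_leq; apply/andP; split; rewrite leqNgt; apply/negP.
  by move=> /g1; apply/negP.
by move=> /h1; apply/negP.
Qed.

Definition upd (ts : conf) v t : conf := fun z => if z == v then t else ts z.

Lemma upd_same ts v t : upd ts v t v = t.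
Proof. by rewrite /upd eqxx. Qed.

Lemma upd_other ts v t z : z <> v -> upd ts v t z = ts z.
Proof. by rewrite /upd; case: eqP. Qed.

Lemma upd_upd ts v t t' : upd (upd ts v t) v t' = upd ts v t'.
Proof. by apply/funext => z; rewrite /upd; case: eqP. Qed.

Lemma upd_id ts v : upd ts v (ts v) = ts.
Proof. by apply/funext => z; rewrite /upd; case: eqP => // ->. Qed.

Lemma upd_idE ts v t : ts v = t -> upd ts v t = ts.
Proof. by move=> <-; exact: upd_id. Qed.

Section Run.
Variable O : 'I_d -> nat -> seq S.
Variable A : Type.

Definition pstep (p : prog A) (c : (pst p + A) * conf) : (pst p + A) * conf :=
  match c.1 with
  | inr a => c
  | inl s => match pnext s with
    | inl (i, s') => (s', upd c.2 (ot i) (Tp [::] (O i (sunary (c.2 (ot i))))))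
    | inr f => let r := f (fun t => (c.2 t).2 0) in
               (r.1, fun t => sact (r.2 t) (c.2 t))
    end
  end.

(* An exit is a fixed point of [pstep], so n is only an upper bound. *)
Definition runs (p : prog A) ts n a ts' :=
  iter n (@pstep p) (pinit p, ts) = (inr a, ts').

Lemma iter_pstep_inr p n a ts : iter n (@pstep p) (inr a, ts) = (inr a, ts).
Proof. by elim: n => //= n ->. Qed.

Lemma runs_le p ts n m a ts' : n <= m -> runs p ts n a ts' -> runs p ts m a ts'.
Proof.
by move=> nm; rewrite /runs -(subnK nm) iterD => ->; rewrite iter_pstep_inr.
Qed.

(** Total correctness within n steps. Since the postcondition speaks of the exit value and the
    tapes, a sequence of programs becomes a nest of [wp], and the bounds add up. *)
Definition wp (p : prog A) (Q : A -> conf -> Prop) n ts :=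
  exists a ts', runs p ts n a ts' /\ Q a ts'.

Lemma wp_le p Q n m ts : wp p Q n ts -> n <= m -> wp p Q m ts.
Proof. by move=> [a [ts' [r q]]] nm; exists a, ts'; split => //; apply: runs_le r. Qed.

End Run.

Section Combinators.
Variable O : 'I_d -> nat -> seq S.

Definition ret A (a : A) : prog A :=
  @Prog A void (inr a) (fun s => match s with end).

Lemma wp_ret A (a : A) (Q : A -> conf -> Prop) n ts : Q a ts -> wp O (ret a) Q n ts.
Proof. by exists a, ts; split => //; apply: (@runs_le _ _ _ _ 0). Qed.

Definition gstep A (f : (T -> option S) -> A * (T -> option S * move)) : prog A :=
  @Prog A unit (inl tt) (fun _ => inr (fun r => (inr (f r).1, (f r).2))).

Lemma wp_gstep A f (Q : A -> conf -> Prop) ts :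
  Q (f (fun t => (ts t).2 0)).1
    (fun t => sact ((f (fun t => (ts t).2 0)).2 t) (ts t)) ->
  wp O (gstep f) Q 1 ts.
Proof. by move=> q; eexists _, _; split; [reflexivity|]. Qed.

Definition call (i : 'I_d) : prog unit :=
  @Prog unit unit (inl tt) (fun _ => inl (i, inr tt)).

Lemma wp_call i (Q : unit -> conf -> Prop) ts :
  Q tt (upd ts (ot i) (Tp [::] (O i (sunary (ts (ot i)))))) -> wp O (call i) Q 1 ts.
Proof. by move=> q; eexists _, _; split; [reflexivity|]. Qed.

(** An exit of p is identified with the start of its successor, so composition costs no step. The
    exit value is remembered in the state, whence the finiteness of B. *)
Definition bind_next A (B : finType) (p : prog B) (k : B -> prog A) (b : B) :
    pst p + {b : B & pst (k b)} + A :=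
  match pinit (k b) with
  | inl s => inl (inr (Tagged (fun b => pst (k b)) s))
  | inr a => inr a
  end.

Definition bind_lift1 A (B : finType) (p : prog B) (k : B -> prog A)
    (x : pst p + B) : pst p + {b : B & pst (k b)} + A :=
  match x with inl s => inl (inl s) | inr b => bind_next p k b end.

Definition bind_lift2 A (B : finType) (p : prog B) (k : B -> prog A) b
    (x : pst (k b) + A) : pst p + {b : B & pst (k b)} + A :=
  match x with
  | inl s => inl (inr (Tagged (fun b => pst (k b)) s))
  | inr a => inr a
  end.

Definition bind A (B : finType) (p : prog B) (k : B -> prog A) : prog A :=
  @Prog A (pst p + {b : B & pst (k b)})%type (bind_lift1 k (pinit p))
    (fun s => match s with
     | inl s => match pnext s with
       | inl (i, x) => inl (i, bind_lift1 k x)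
       | inr f => inr (fun r => (bind_lift1 k (f r).1, (f r).2))
       end
     | inr (existT b s) => match pnext s with
       | inl (i, x) => inl (i, bind_lift2 p x)
       | inr f => inr (fun r => (bind_lift2 p (f r).1, (f r).2))
       end
     end).

Lemma bind_step2 A (B : finType) (p : prog B) (k : B -> prog A) b x ts n :
  iter n (@pstep O _ (bind p k)) (bind_lift2 p x, ts) =
  let c := iter n (@pstep O _ (k b)) (x, ts) in (bind_lift2 p c.1, c.2).
Proof.
elim: n => //= n ->; case: (iter n _ _) => -[s|a] ts' //=.
by rewrite /pstep /=; case: (pnext s) => [[i y]|f].
Qed.

Lemma wp_bind A (B : finType) (p : prog B) (k : B -> prog A) Q n m ts :
  wp O p (fun b ts' => wp O (k b) Q m ts') n ts -> wp O (bind p k) Q (n + m) ts.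
Proof.
move=> [b [ts1 [r1 [a [ts2 [r2 q]]]]]]; exists a, ts2; split => //.
move: r1; rewrite /runs.
have -> : pinit (bind p k) = bind_lift1 k (pinit p) by [].
elim: n (pinit p) ts => [|n IH] x ts.
  move=> [-> ->] /=; have -> : bind_next p k b = bind_lift2 p (pinit (k b)).
    by rewrite /bind_next; case: (pinit _).
  by rewrite add0n bind_step2 r2.
rewrite iterSr addSn iterSr.
case: x => [s|b'] /=; last first.
  rewrite iter_pstep_inr => -[-> ->].
  have -> : bind_next p k b = bind_lift2 p (pinit (k b)).
    by rewrite /bind_next; case: (pinit _).
  by rewrite -iterSr bind_step2 (runs_le _ r2) // -addSn leq_addl.
rewrite /pstep /=; case: (pnext s) => [[i y]|f] /= e; exact: IH.
Qed.

Definition loop_lift (A B : finType) (k : A -> prog (A + B)%type) a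
    (x : pst (k a) + (A + B)) : {a : A & option (pst (k a))} + B :=
  match x with
  | inl s => inl (Tagged (fun a => option (pst (k a))) (Some s))
  | inr (inl a') => inl (existT (fun a => option (pst (k a))) a' None)
  | inr (inr b) => inr b
  end.

(* Each round starts with an idle step, so that a body which exits without a
   step does no harm. *)
Definition loop (A B : finType) (k : A -> prog (A + B)%type) (a : A) : prog B :=
  @Prog B {a : A & option (pst (k a))} (inl (existT (fun a => option (pst (k a))) a None))
    (fun s => match s with
     | existT a None => inr (fun r => (loop_lift (pinit (k a)), fun t => (r t, Stay)))
     | existT a (Some s) => match pnext s with
       | inl (i, x) => inl (i, loop_lift x)
       | inr f => inr (fun r => (loop_lift (f r).1, (f r).2))
       end
     end).

Lemma loop_step (A B : finType) (k : A -> prog (A + B)%type) a n x ts ts' c m Q :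
  iter n (@pstep O _ (k a)) (x, ts) = (inr c, ts') ->
  match c with inl a' => wp O (loop k a') Q m ts' | inr b => Q b ts' end ->
  exists b ts2, iter (n + m) (@pstep O _ (loop k a)) (loop_lift x, ts) = (inr b, ts2)
    /\ Q b ts2.
Proof.
elim: n x ts => [|n IH] x ts.
  move=> /= [-> ->]; case: c => [a' [b [ts2 [r q]]]|b q]; last first.
    by exists b, ts'; split => //; exact: (@iter_pstep_inr O _ (loop k a)).
  by exists b, ts2; rewrite add0n.
rewrite iterSr addSn; case: x => [s|c0] /=.
  rewrite {2}/pstep /=; case E: (pnext s) => [[i y]|f] /= e q;
    have [b [ts2 [r' q']]] := IH _ _ e q; exists b, ts2;
    by rewrite -iterS iterSr {2}/pstep /= E.
(* The body has exited early; the steps left over are available to the next round. *)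
rewrite iter_pstep_inr => -[-> ->] {IH}; case: c => [a' h|b q]; last first.
  exists b, ts'; split => //; exact: (@iter_pstep_inr O _ (loop k a) (n + m).+1).
have [b [ts2 [r q]]] := wp_le (m := (n + m).+1) h ltac:(lia).
by exists b, ts2.
Qed.

(** Induction over the rounds is left to the user: the loop reappears in the postcondition with its
    own budget m. The additional step is the idle one. *)
Lemma wp_loop (A B : finType) (k : A -> prog (A + B)%type) a n m Q ts :
  wp O (k a) (fun c ts' =>
    match c with inl a' => wp O (loop k a') Q m ts' | inr b => Q b ts' end) n ts ->
  wp O (loop k a) Q (n + m).+1 ts.
Proof.
move=> [c [ts' [r q]]].
have [b [ts2 [r' q']]] := loop_step r q.
exists b, ts2; split => //; rewrite /runs iterSr.
rewrite [pstep _ _](_ : _ = (loop_lift (pinit (k a)), ts)) //.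
rewrite /pstep /=; congr (_, _); apply/funext => t.
exact: sact_id.
Qed.

End Combinators.
End Progs.

(** * Machines compiled from programs *)

Definition isone (A : Type) (c : option (digit + A)) : bool :=
  if c is Some (inl (Bit true)) then true else false.

Arguments isone A c : simpl never.

Definition digit_syms (A : Type) (w : seq digit) : seq (digit + A) := [seq inl c | c <- w].

Section Tapes.
Variables (e d : nat) (M : machine e d).
Implicit Types (t : tape M).

Definition abs t : stape (digit + aux M) := (nth None t.1, nth None t.2).

Lemma abs_act (a : symbol M * move) t : abs (act a t) = sact a (abs t).
Proof.
case: a t => b m [l r]; rewrite /abs /act /sact /=.
have hb (s : seq (symbol M)) : nth None (behead s) = stail (nth None s).
  by apply/funext => i; rewrite nth_behead.
have hc c (s : seq (symbol M)) : nth None (c :: s) = scons c (nth None s).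
  by apply/funext => i; case: i.
by case: m => /=; rewrite ?hc ?hb -?nth0 /=.
Qed.

Lemma unary_at_abs t : sunary (@isone _) (abs t) = unary_at t.
Proof.
rewrite /unary_at; set p := fun c => _.
have pE c : p c = ~~ isone c by case: c => // -[[[]| |]|].
apply: sunaryE => [i|] /=.
  by move=> /(before_find None); rewrite pE => /negbFE.
case: (boolP (has p t.2)) => [/(nth_find None)|/hasNfind ->]; first by rewrite pE.
by rewrite nth_default.
Qed.

Lemma abs_tape_of (w : seq digit) : abs (tape_of M w) = Tp [::] (digit_syms _ w).
Proof.
congr (_, _); apply/funext => i; rewrite /str /digit_syms /= -?map_comp ?nth_nil //.
Qed.

Lemma scanned_abs t : scanned t = (abs t).2 0.
Proof. by rewrite /scanned -nth0. Qed.

Lemma abs_word_at t u (w : seq digit) :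
  (abs t).2 = u -> (forall i, i < size w -> u i = Some (inl (nth Minus w i))) ->
  u (size w) = None -> word_at t = [seq Some (inl c) | c <- w].
Proof.
move=> /= tu hw hn; rewrite /word_at.
have sw : find (fun c : symbol M => ~~ isSome c) t.2 = size w.
  set f := find _ _; apply/eqP; rewrite eqn_leq; apply/andP; split; rewrite leqNgt; apply/negP => h.
    by have := before_find None h; rewrite /= tu hn.
  have := hw _ h; rewrite -tu => e1.
  have hf : has (fun c : symbol M => ~~ isSome c) t.2.
    rewrite has_find ltnNge; apply/negP => h2.
    by move: e1; rewrite nth_default.
  by have := nth_find None hf; rewrite -/f e1.
have st : size w <= size t.2 by rewrite -sw find_size.
rewrite sw; apply: (@eq_from_nth _ None); first by rewrite size_take_min size_map (minn_idPl st).
move=> i; rewrite size_take_min (minn_idPl st) => hi.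
by rewrite nth_take // tu hw // (nth_map Minus).
Qed.

End Tapes.

Section Mach.
Variables (e d : nat) (Aux Work : finType).
Let S := (digit + Aux)%type.
Let T : finType := ('I_e + 'I_d + option Work)%type.
Let ot (i : 'I_d) : T := inl (inr i).

Definition mach_query A (p : prog d S T A) (s : pst p + A) :
    option ('I_d * (pst p + A)) :=
  if s is inl s then if pnext s is inl q then Some q else None else None.

(** Exits are halting states and calls are dealt with by [mach_query], so [step] never consults the
    idle defaults. *)
Definition mach_delta A (p : prog d S T A) (s : pst p + A) (r : {ffun T -> option S}) :
    (pst p + A) * {ffun T -> option S * move} :=
  if s is inl s' then
    if pnext s' is inr f then let x := f r in (x.1, [ffun t => x.2 t])
    else (s, [ffun t => (None, Stay)])
  else (s, [ffun t => (None, Stay)]).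

Definition mach (p : prog d S T unit) : machine e d :=
  @Machine e d Aux Work (pst p + unit)%type (pinit p)
    (fun s => if s is inr _ then true else false)
    (@mach_query _ p) (@mach_delta _ p).

Definition start_conf (ins : 'I_e -> seq digit) : conf S T :=
  fun t => if t is inl (inl i) then Tp [::] (digit_syms _ (ins i)) else Tp [::] [::].

Variable O : 'I_d -> nat -> seq digit.
Let O' i m := digit_syms Aux (O i m).

(** Machine and program run in lockstep, so a time bound for the program is one for the machine. *)
Lemma mach_step (p : prog d S T unit) (c : config (mach p)) :
  let c' := step O c in
  (c'.1, fun t => abs (c'.2 t)) =
  pstep ot (@isone Aux) O' (p := p) (c.1, fun t => abs (c.2 t)).
Proof.
case: c => -[s|[]] ts //=; rewrite /pstep /=.
case E: (pnext s) => [[i s']|f] /=.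
  congr (_, _); apply/funext => t; rewrite ffunE /upd /oracle_tape /=.
  by case: eqP => [->|_] //; rewrite abs_tape_of -unary_at_abs.
have -> : ([ffun t => scanned (ts t)] : T -> option S) = fun t => (abs (ts t)).2 0.
  by apply/funext => t; rewrite ffunE scanned_abs.
by congr (_, _); apply/funext => t; rewrite ffunE abs_act ffunE.
Qed.

Lemma mach_outputs (p : prog d S T unit) ins n w :
  wp ot (@isone Aux) O' p (fun _ ts => exists u, ts (inr None) = Tp u (digit_syms _ w)) n
    (start_conf ins) ->
  outputs (mach p) O ins n w.
Proof.
move=> [[] [ts' [r [u hu]]]]; rewrite /outputs.
have : let c' := iter n (step O) (initial (mach p) ins) in
  (c'.1, fun t => abs (c'.2 t)) = (inr tt, ts').
  rewrite /= -r; elim: n {r} => [|n IH] /=.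
    congr (_, _); apply/funext => t; rewrite ffunE /start_conf.
    by case: t => [[i|i]|w']; rewrite abs_tape_of.
  by rewrite mach_step IH.
case: (iter n _ _) => s ts /= h; have /= -> := congr1 fst h; have /= e1 := congr1 snd h;
  split => //.
have : abs (ts (output_tape (mach p))) = Tp u (digit_syms Aux w)
  by rewrite -hu -(congr1 (@^~ (inr None)) e1).
move=> /(congr1 snd) /= e2; apply: abs_word_at; first exact: e2.
  by move=> i hi; rewrite /str /digit_syms -map_comp (nth_map Minus).
by rewrite /str nth_default // !size_map.
Qed.

End Mach.

(** [bind] stores the value of its first program in the finite state; with [digit] finite, the
    symbol just read can be such a value. *)
Definition digit_code (c : digit) : option (option bool) :=
  match c with Bit b => Some (Some b) | Minus => Some None | Point => None end.

Definition digit_decode (c : option (option bool)) : digit :=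
  match c with Some (Some b) => Bit b | Some None => Minus | None => Point end.

Lemma digit_codeK : cancel digit_code digit_decode.
Proof. by case. Qed.

HB.instance Definition _ := Finite.copy digit (can_type digit_codeK).

(** * Primitive programs and their rules *)

Ltac neq_tac := solve [assumption | apply: not_eq_sym; assumption | by apply/eqP].

(** Reads off the contents of a tape from a chain of updates. *)
Ltac lk := rewrite ?upd_same;
  repeat (rewrite upd_other; [rewrite ?upd_same|neq_tac]); try done; try eassumption.

(** Compares two chains of updates tape by tape, whatever their order. *)
Ltac updeq := apply/funext => ?; rewrite /upd;
  repeat (match goal with |- context [?z == ?v] =>
    case: (eqVneq z v) => ?; subst; rewrite //=;
    try contradiction end).

Lemma eq_post (A B : Type) (Q : A -> B -> Prop) a x y : Q a x -> x = y -> Q a y.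
Proof. by move=> ? <-. Qed.

Section Prims.
Variables (d : nat) (Aux : finType) (T : eqType) (ot : 'I_d -> T).
Local Notation S := (digit + Aux)%type.
Variable O : 'I_d -> nat -> seq S.
Local Notation conf := (conf S T).
Local Notation wp := (wp ot (@isone Aux) O).
Local Notation prog := (prog d S T).
Implicit Types (ts : conf) (u w : seq S).

Definition act1 (A : Type) v (g : option S -> A * (option S * move)) : prog A :=
  gstep d (fun r => let x := g (r v) in
    (x.1, fun z => if z == v then x.2 else (r z, Stay))).

Lemma wp_act1 (A : Type) v (g : option S -> A * (option S * move)) Q ts :
  Q (g ((ts v).2 0)).1 (upd ts v (sact (g ((ts v).2 0)).2 (ts v))) ->
  wp (act1 v g) Q 1 ts.
Proof.
move=> q; apply: wp_gstep; apply: (eq_post q); apply/funext => z; rewrite /upd /=.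
by case: eqP => [->|_] //; rewrite sact_id.
Qed.

Lemma wp_loop_le (A B : finType) n m (k : A -> prog (A + B)%type) a Q N ts :
  wp (k a) (fun c ts' =>
    match c with inl a' => wp (loop k a') Q m ts' | inr b => Q b ts' end) n ts ->
  n + m < N -> wp (loop k a) Q N ts.
Proof. by move=> h; apply: wp_le; apply: wp_loop. Qed.

Lemma wp_bind_le (A : Type) (B : finType) n m (p : prog B) (k : B -> prog A) Q N ts :
  wp p (fun b ts' => wp (k b) Q m ts') n ts -> n + m <= N -> wp (bind p k) Q N ts.
Proof. by move=> h; apply: wp_le; apply: wp_bind. Qed.

Definition rd v : prog (option S) := act1 v (fun s => (s, (s, Stay))).
Definition wr v s : prog unit := act1 v (fun _ => (tt, (s, Stay))).
Definition mv v m : prog unit := act1 v (fun s => (tt, (s, m))).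
Definition put v s m : prog unit := act1 v (fun _ => (tt, (s, m))).

(* The tape [Tp u w] after a move to the left. *)
Definition TpL u w : stape S :=
  if u is x :: u' then Tp u' (x :: w) else (str [::], scons None (str w)).

Lemma TpL_nil : TpL [::] [::] = Tp [::] [::].
Proof. by rewrite /TpL -str_nil0. Qed.

Section Bind.
Variables (A : Type) (Q : A -> conf -> Prop) (n : nat) (ts : conf) (v : T).
Variable k : unit -> prog A.

(** Each rule of this section executes a primitive in front of its continuation, so that a proof
    about a program follows its text from left to right. *)
Lemma wp_rd (j : option S -> prog A) u w : ts v = Tp u w ->
  wp (j (ohead w)) Q n ts -> wp (bind (rd v) j) Q n.+1 ts.
Proof.
move=> e h; rewrite -add1n; apply: wp_bind; apply: wp_act1 => /=.
by rewrite sact_id upd_id e /= str0.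
Qed.

Lemma wp_rdL (j : option S -> prog A) u w : ts v = TpL u w ->
  wp (j (ohead u)) Q n ts -> wp (bind (rd v) j) Q n.+1 ts.
Proof.
move=> e h; rewrite -add1n; apply: wp_bind; apply: wp_act1 => /=.
by rewrite sact_id upd_id e /TpL; case: u e h => //= x u _; rewrite str0.
Qed.

Lemma wp_wr x u w : ts v = Tp u w ->
  wp (k tt) Q n (upd ts v (Tp u (x :: behead w))) ->
  wp (bind (wr v (Some x)) k) Q n.+1 ts.
Proof.
move=> e h; rewrite -add1n; apply: wp_bind; apply: wp_act1 => /=.
by move: h; rewrite e /sact /Tp /= stail_str -str_cons.
Qed.

Lemma wp_wrL x u w : ts v = TpL u w ->
  wp (k tt) Q n (upd ts v (Tp (behead u) (x :: w))) ->
  wp (bind (wr v (Some x)) k) Q n.+1 ts.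
Proof.
move=> e h; rewrite -add1n; apply: wp_bind; apply: wp_act1 => /=.
rewrite e /TpL; case: u e h => [|y u] _ /= h.
  by move: h; rewrite /sact /Tp /= stail_scons -str_cons.
by move: h; rewrite /sact /Tp /= stail_str -str_cons.
Qed.

Lemma wp_erase x u : ts v = Tp u [:: x] ->
  wp (k tt) Q n (upd ts v (Tp u [::])) -> wp (bind (wr v None) k) Q n.+1 ts.
Proof.
move=> e h; rewrite -add1n; apply: wp_bind; apply: wp_act1 => /=.
by move: h; rewrite e /sact /Tp /= stail_str /= -str_nil0.
Qed.

Lemma wp_mvR x u w : ts v = Tp u (x :: w) ->
  wp (k tt) Q n (upd ts v (Tp (x :: u) w)) -> wp (bind (mv v MoveRight) k) Q n.+1 ts.
Proof.
move=> e h; rewrite -add1n; apply: wp_bind; apply: wp_act1 => /=.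
by move: h; rewrite e /sact /Tp /= stail_str -[scons _ (str u)]/(scons (Some x) (str u)) -str_cons.
Qed.

Lemma wp_mvRL w : ts v = TpL [::] w ->
  wp (k tt) Q n (upd ts v (Tp [::] w)) -> wp (bind (mv v MoveRight) k) Q n.+1 ts.
Proof.
move=> e h; rewrite -add1n; apply: wp_bind; apply: wp_act1 => /=.
by move: h; rewrite e /sact /Tp /= stail_scons -str_nil0.
Qed.

Lemma wp_mvL u w : ts v = Tp u w ->
  wp (k tt) Q n (upd ts v (TpL u w)) -> wp (bind (mv v MoveLeft) k) Q n.+1 ts.
Proof.
move=> e h; rewrite -add1n; apply: wp_bind; apply: wp_act1 => /=.
move: h; rewrite e /sact /Tp /= -[str w 0]/((str w) 0) scons_stail /TpL.
by rewrite stail_str -[str u 0]/((str u) 0) str0; case: u e => //= y u _; rewrite /Tp (str_cons y).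
Qed.

Lemma wp_mvLL x u w : ts v = TpL (x :: u) w ->
  wp (k tt) Q n (upd ts v (TpL u (x :: w))) -> wp (bind (mv v MoveLeft) k) Q n.+1 ts.
Proof. exact: wp_mvL. Qed.

Lemma wp_put x u w : ts v = Tp u w ->
  wp (k tt) Q n (upd ts v (Tp (x :: u) (behead w))) ->
  wp (bind (put v (Some x) MoveRight) k) Q n.+1 ts.
Proof.
move=> e h; rewrite -add1n; apply: wp_bind; apply: wp_act1 => /=.
by move: h; rewrite e /sact /Tp /= stail_str -[scons _ (str u)]/(scons (Some x) (str u)) -str_cons.
Qed.

Lemma wp_drop w : ts v = Tp [::] w ->
  wp (k tt) Q n (upd ts v (Tp [::] (behead w))) ->
  wp (bind (put v None MoveRight) k) Q n.+1 ts.
Proof.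
move=> e h; rewrite -add1n; apply: wp_bind; apply: wp_act1 => /=.
by move: h; rewrite e /sact /Tp /= stail_str -str_nil0.
Qed.

End Bind.

(** The word to the right of the head serves as a stack whose top is the scanned cell. *)
Definition push v x : prog unit :=
  bind (mv v MoveLeft) (fun _ => bind (wr v (Some x)) (fun _ => ret d S T tt)).

Lemma wp_push A (Q : A -> conf -> Prop) n ts v k x w : ts v = Tp [::] w ->
  wp (k tt) Q n (upd ts v (Tp [::] (x :: w))) ->
  wp (bind (push v x) k) Q n.+2 ts.
Proof.
move=> e h; apply: (@wp_bind_le _ _ 2 n) => //.
apply: (wp_mvL e); apply: (wp_wrL (u := [::])); first by lk.
by apply: wp_ret; rewrite upd_upd.
Qed.

Definition goR v : prog unit := loop (fun _ => bind (rd v) (fun s =>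
  if s is Some _ then bind (mv v MoveRight) (fun _ => ret d S T (inl tt))
  else ret d S T (inr tt))) tt.

Lemma wp_goR Q ts v u w : ts v = Tp u w ->
  Q tt (upd ts v (Tp (catrev w u) [::])) -> wp (goR v) Q (5 * size w + 5) ts.
Proof.
elim: w u ts => [|x w IH] u ts e h.
  apply: (@wp_loop_le _ _ 1 0) => //; apply: (wp_rd e).
  by apply: wp_ret; apply: (eq_post h); rewrite upd_idE.
apply: (@wp_loop_le _ _ 2 (5 * size w + 5)); last by rewrite /=; lia.
apply: (wp_rd e); apply: (wp_mvR e); apply: wp_ret; apply: IH; first by lk.
by rewrite upd_upd.
Qed.

Definition goL_loop v : prog unit := loop (fun _ => bind (rd v) (fun s =>
  if s is Some _ then bind (mv v MoveLeft) (fun _ => ret d S T (inl tt))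
  else ret d S T (inr tt))) tt.

Lemma wp_goL_loop Q ts v u w : ts v = TpL u w ->
  Q tt (upd ts v (TpL [::] (catrev u w))) -> wp (goL_loop v) Q (5 * size u + 5) ts.
Proof.
elim: u w ts => [|x u IH] w ts e h.
  apply: (@wp_loop_le _ _ 1 0) => //; apply: (wp_rdL e).
  by apply: wp_ret; apply: (eq_post h); rewrite upd_idE.
apply: (@wp_loop_le _ _ 2 (5 * size u + 5)); last by rewrite /=; lia.
apply: (wp_rdL e); apply: (wp_mvLL e); apply: wp_ret; apply: IH; first by lk.
by rewrite upd_upd.
Qed.

Definition goL v : prog unit := bind (mv v MoveLeft) (fun _ =>
  bind (goL_loop v) (fun _ => bind (mv v MoveRight) (fun _ => ret d S T tt))).

Lemma wp_goL Q ts v u w : ts v = Tp u w ->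
  Q tt (upd ts v (Tp [::] (catrev u w))) -> wp (goL v) Q (5 * size u + 8) ts.
Proof.
move=> e h; have -> : 5 * size u + 8 = (5 * size u + 7).+1 by lia.
apply: (wp_mvL e); apply: (@wp_bind_le _ _ (5 * size u + 5) 2); last by lia.
apply: wp_goL_loop; first by lk.
by apply: wp_mvRL; [lk|]; apply: wp_ret; rewrite !upd_upd.
Qed.

Definition wipe_loop v : prog unit := loop (fun _ => bind (rd v) (fun s =>
  if s is Some _ then bind (wr v None) (fun _ =>
    bind (mv v MoveLeft) (fun _ => ret d S T (inl tt)))
  else ret d S T (inr tt))) tt.

Lemma wp_wipe_loop Q ts v u : ts v = TpL u [::] ->
  Q tt (upd ts v (Tp [::] [::])) -> wp (wipe_loop v) Q (5 * size u + 5) ts.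
Proof.
elim: u ts => [|x u IH] ts e h.
  apply: (@wp_loop_le _ _ 1 0) => //; apply: (wp_rdL e).
  by apply: wp_ret; apply: (eq_post h); rewrite upd_idE // e TpL_nil.
apply: (@wp_loop_le _ _ 3 (5 * size u + 5)); last by rewrite /=; lia.
apply: (wp_rdL e); apply: (wp_erase e); apply: wp_mvL; first by lk.
apply: wp_ret; apply: IH; first by lk.
by rewrite !upd_upd.
Qed.

(** Erasing leftwards from the right end stops at the first blank. The tape gets entirely clear only
    because its used part contains no blank. *)
Definition wipe v : prog unit := bind (goR v) (fun _ =>
  bind (mv v MoveLeft) (fun _ => wipe_loop v)).

Lemma wp_wipe Q ts v u w N : ts v = Tp u w -> 10 * (size u + size w) + 20 <= N ->
  Q tt (upd ts v (Tp [::] [::])) -> wp (wipe v) Q N ts.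
Proof.
move=> e hN h; apply: (@wp_bind_le _ _ (5 * size w + 5) (5 * (size u + size w) + 5).+1);
  last by lia.
apply: (wp_goR e); apply: wp_mvL; first by lk.
have -> : size u + size w = size (catrev w u) by rewrite catrevE size_cat size_rev addnC.
by apply: wp_wipe_loop; [lk|rewrite !upd_upd].
Qed.

End Prims.

Arguments wp_goR {d Aux T ot O Q ts v u w}.
Arguments wp_goL {d Aux T ot O Q ts v u w}.
Arguments wp_wipe {d Aux T ot O Q ts v u w N}.

(** * Addition and subtraction of binary words *)

(** The majority of three bits. Complementing x turns the carry of x + y + c into the borrow of x -
    y - c, while the digit written is the same in both cases. *)
Definition carry (sub c x y : bool) : bool :=
  let x' := x (+) sub in [|| x' && y, x' && c | y && c].

(* Least significant bit first; the second component is the final carry or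
   borrow. *)
Fixpoint addl n (sub c : bool) (a b : seq bool) : seq bool * bool :=
  if n is n'.+1 then
    let x := head false a in let y := head false b in
    let r := addl n' sub (carry sub c x y) (behead a) (behead b) in
    (x (+) y (+) c :: r.1, r.2)
  else ([::], c).

Definition lval (a : seq bool) : nat := foldr (fun (b : bool) n => b + n.*2) 0 a.

Lemma size_ripple n sub c a b : size (addl n sub c a b).1 = n.
Proof. by elim: n c a b => //= n IH c a b; rewrite IH. Qed.

Lemma lval_lt a : lval a < 2 ^ size a.
Proof. elim: a => //= x a IH; rewrite expnS; case: x; lia. Qed.

Lemma lval_cat a b : lval (a ++ b) = lval a + 2 ^ size a * lval b.
Proof. by elim: a => [|x a IH] /=; rewrite ?expnS ?IH; lia. Qed.

Lemma lval_head a : lval a = head false a + (lval (behead a)).*2.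
Proof. by case: a. Qed.

Lemma lval_addl n c a b : size a <= n -> size b <= n ->
  lval (addl n false c a b).1 + 2 ^ n * (addl n false c a b).2 = lval a + lval b + c.
Proof.
elim: n c a b => [|n IH] c a b; first by case: a => [|? ?]; case: b => [|? ?] // _ _ /=; lia.
move=> ha hb; rewrite (lval_head a) (lval_head b) /= expnS.
have := IH (carry false c (head false a) (head false b)) (behead a) (behead b).
rewrite !size_behead; move: (addl n _ _ _ _) => r /(_ ltac:(lia) ltac:(lia)).
by case: c; case: (head false a); case: (head false b); case: r.2; rewrite /carry /=; lia.
Qed.

(** With the borrow on the right-hand side the identity holds in the natural numbers, where
    subtraction would truncate. *)
Lemma lval_subl n c a b : size a <= n -> size b <= n ->
  lval (addl n true c a b).1 + lval b + c = lval a + 2 ^ n * (addl n true c a b).2.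
Proof.
elim: n c a b => [|n IH] c a b; first by case: a => [|? ?]; case: b => [|? ?] // _ _ /=; lia.
move=> ha hb; rewrite (lval_head a) (lval_head b) /= expnS.
have := IH (carry true c (head false a) (head false b)) (behead a) (behead b).
rewrite !size_behead; move: (addl n _ _ _ _) => r /(_ ltac:(lia) ltac:(lia)).
by case: c; case: (head false a); case: (head false b); case: r.2; rewrite /carry /=; lia.
Qed.

Section Arith.
Variables (d : nat) (Aux : finType) (T : eqType) (ot : 'I_d -> T).
Local Notation S := (digit + Aux)%type.
Variable O : 'I_d -> nat -> seq S.
Local Notation conf := (conf S T).
Local Notation wp := (wp ot (@isone Aux) O).
Local Notation prog := (prog d S T).
Local Notation ret a := (ret d S T a).
Implicit Types (ts : conf) (a b : seq bool).

Definition bit_sym (x : bool) : S := inl (Bit x).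
Definition bit_syms a : seq S := [seq bit_sym x | x <- a].

Lemma isone_bit_sym (x : bool) : isone (Some (bit_sym x)) = x.
Proof. by case: x. Qed.

(* A number a, least significant bit first, is on a tape of the form
   [Tp (bit_syms a) [::]]: the head is on the blank after the last digit. *)
Definition addsub_loop (sub : bool) A Y : bool -> prog bool :=
  loop (fun c : bool => bind (mv d Aux A MoveLeft) (fun _ => bind (mv d Aux Y MoveLeft) (fun _ =>
    bind (rd d Aux A) (fun s1 => bind (rd d Aux Y) (fun s2 =>
      let next := bind (wr d A (Some (bit_sym (isone s1 (+) isone s2 (+) c)))) (fun _ =>
        ret (inl (carry sub c (isone s1) (isone s2)))) in
      if s2 is Some _ then next else bind (mv d Aux Y MoveRight) (fun _ =>
        if s1 is Some _ then next else ret (inr c))))))).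

(** Once the digits on Y are exhausted, its head is put back after each move and meets the same
    blank in every later round. An exhausted A simply grows to the left. *)
Lemma wp_addsub_loop sub A Y n c a b (r s : seq S) Q ts :
  A <> Y -> n = maxn (size a) (size b) ->
  ts A = Tp (bit_syms a) r -> ts Y = Tp (bit_syms b) s ->
  Q (addl n sub c a b).2
    (upd (upd ts A (TpL [::] (catrev (bit_syms (addl n sub c a b).1) r)))
      Y (Tp [::] (catrev (bit_syms b) s))) ->
  wp (addsub_loop sub A Y c) Q (10 * n + 10) ts.
Proof.
move=> AY; elim: n c a b r s ts => [|n IH] c a b r s ts.
  move=> /esym/eqP; rewrite -leqn0 geq_max !leqn0 !size_eq0.
  move=> /andP[/eqP-> /eqP->] eA eY h.
  apply: (@wp_loop_le _ _ _ _ _ _ _ 8 0) => //.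
  apply: (wp_mvL eA); apply: (wp_mvL (v := Y)); first by lk.
  apply: (wp_rdL (v := A)); first by lk.
  apply: (wp_rdL (v := Y)); first by lk.
  apply: (wp_mvRL (v := Y)); first by lk.
  by apply: wp_ret; apply: (eq_post h); updeq.
move=> hn eA eY h; apply: (@wp_loop_le _ _ _ _ _ _ _ 7 (10 * n + 10)); last by lia.
apply: (wp_mvL eA); apply: (wp_mvL (v := Y)); first by lk.
apply: (wp_rdL (v := A)); first by lk.
apply: (wp_rdL (v := Y)); first by lk.
case: b eY h hn => [|y b] eY h hn /=; last first.
  apply: (wp_wrL (v := A)); first by lk.
  apply: wp_ret; rewrite isone_bit_sym.
  have -> : isone (ohead (bit_syms a)) = head false a by case: (a) => //= x _; case: x.
  apply: (IH _ (behead a) b _ (bit_sym y :: s)).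
  - by rewrite size_behead; move: hn => /=; lia.
  - by lk; rewrite /bit_syms behead_map.
  - by lk; rewrite -/(bit_syms b).
  - by apply: (eq_post h); updeq.
apply: (wp_mvRL (v := Y)); first by lk.
case: a eA h hn => [//|x a] eA h hn /=.
apply: (wp_wrL (v := A) (u := bit_sym x :: bit_syms a) (w := r)); first by lk.
apply: wp_ret; rewrite isone_bit_sym.
apply: (IH _ a [::] _ s).
- by move: hn => /=; lia.
- by lk.
- by lk.
- by apply: (eq_post h); updeq.
Qed.

(** With [keep] a final carry becomes a new most significant digit. Long division does without it:
    there the borrow is the result of a comparison, and adding back has to wrap around. *)
Definition addsub (sub keep : bool) A Y : prog bool :=
  bind (addsub_loop sub A Y false) (fun c =>
  let next := bind (goR d Aux A) (fun _ => bind (goR d Aux Y) (fun _ => ret c)) in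
  if keep && c then bind (wr d A (Some (bit_sym true))) (fun _ => next)
  else bind (mv d Aux A MoveRight) (fun _ => next)).

Lemma wp_addsub sub keep A Y n a b Q N ts :
  A <> Y -> n = maxn (size a) (size b) ->
  ts A = Tp (bit_syms a) [::] -> ts Y = Tp (bit_syms b) [::] -> 25 * n + 40 <= N ->
  (let r := addl n sub false a b in
   Q r.2 (upd ts A (Tp (bit_syms (r.1 ++ nseq (keep && r.2) true)) [::]))) ->
  wp (addsub sub keep A Y) Q N ts.
Proof.
move=> AY hn eA eY hN h; set r := addl n sub false a b in h.
apply: (@wp_bind_le _ _ _ _ _ _ _ (10 * n + 10) (10 * n + 21)); last by lia.
apply: (wp_addsub_loop AY hn eA eY); rewrite -/r /=.
have -> : 10 * n + 21 = (10 * n + 20).+1 by lia.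
have sr : size r.1 = n by rewrite size_ripple.
have goRs (w : seq S) ts' : size w <= n.+1 -> ts' A = Tp [::] w ->
    ts' Y = Tp [::] (rev (bit_syms b)) ->
    Q r.2 (upd (upd ts' A (Tp (rev w) [::])) Y (Tp (bit_syms b) [::])) ->
    wp (bind (goR d Aux A) (fun _ => bind (goR d Aux Y) (fun _ => ret r.2))) Q
      (10 * n + 20) ts'.
  move=> hw e1 e2 hq; apply: (@wp_bind_le _ _ _ _ _ _ _ (5 * size w + 5) (5 * n + 10));
    last by lia.
  apply: (wp_goR e1); apply: (@wp_bind_le _ _ _ _ _ _ _ (5 * size b + 5) 0); last by lia.
  have -> : size b = size (rev (bit_syms b)) by rewrite size_rev size_map.
  apply: wp_goR; first by lk.
  by apply: wp_ret; apply: (eq_post hq); rewrite !catrevE !cats0 revK; updeq.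
have bcat x y : bit_syms (x ++ y) = bit_syms x ++ bit_syms y by exact: map_cat.
case: (keep && r.2) (h : Q r.2 (upd ts A (Tp (bit_syms (r.1 ++ nseq (keep && r.2) true)) [::])))
  => {}h /=.
  apply: (wp_wrL (v := A) (u := [::])); first by lk.
  apply: goRs => /=; first 1 last.
  - by lk.
  - by lk; rewrite catrevE cats0.
  - by apply: (eq_post h); rewrite catrevE cats0 rev_cons revK bcat -cats1; updeq.
  - by rewrite /= catrevE cats0 size_rev size_map sr.
apply: (wp_mvRL (v := A)); first by lk.
apply: goRs => /=; first 1 last.
- by lk.
- by lk; rewrite catrevE cats0.
- by apply: (eq_post h); rewrite catrevE !cats0 revK; updeq.
- by rewrite /= catrevE cats0 size_rev size_map sr.
Qed.

End Arith.

Arguments wp_addsub {d Aux T ot O sub keep A Y n a b Q N ts}.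

(** * Simulation of a machine, oracle calls being replaced by programs *)

Definition ones (Aux : Type) (v : seq (digit + Aux)) : nat :=
  find (fun x => ~~ isone (Some x)) v.

Local Arguments sact : simpl never.

Section Simulation.
Variables (d : nat) (Aux : finType) (T : eqType) (ot : 'I_d -> T).
Local Notation S := (digit + Aux)%type.
Variable O : 'I_d -> nat -> seq S.
Local Notation conf := (conf S T).
Local Notation wp := (wp ot (@isone Aux) O).
Local Notation prog := (prog d S T).
Local Notation ret a := (ret d S T a).
Implicit Types (ts : conf).

Variables (e' d' : nat) (M : machine e' d').
Variables (emb : tape_id M -> T) (emb_inj : injective emb).
Variables (ja : option (aux M) -> Aux) (jd : Aux -> option (aux M)).
Hypothesis jaK : cancel ja jd.

(* The blanks written by M become the auxiliary symbol [ja None], so that the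
   visited part of a simulated tape is free of blanks. *)
Definition enc (s : symbol M) : S :=
  match s with
  | Some (inl c) => inl c
  | Some (inr a) => inr (ja (Some a))
  | None => inr (ja None)
  end.

Definition dec (x : S) : symbol M :=
  match x with inl c => Some (inl c) | inr z => omap inr (jd z) end.

Lemma encK s : dec (enc s) = s.
Proof. by case: s => [[c|a]|] //=; rewrite jaK. Qed.

Definition sim_step (q : state M) (r : T -> option S) :
    state M * (T -> option S * move) :=
  let x := delta q [ffun t => obind dec (r (emb t))] in
  (x.1, fun z => if [pick t | emb t == z] is Some t
                 then (Some (enc (x.2 t).1), (x.2 t).2) else (r z, Stay)).

(** A move may reach a cell that is still blank. It is filled at once, so that programs which run up
    to the next blank, such as [wipe], see the whole visited part of a tape. *)
Definition sim_fill (r : T -> option S) : unit * (T -> option S * move) :=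
  (tt, fun z => if [pick t | emb t == z] is Some t
                then (Some (odflt (enc None) (r z)), Stay) else (r z, Stay)).

Variable H : 'I_d' -> prog unit.

Definition sim_loop : state M -> prog unit := loop (fun q =>
  if halted q then ret (inr tt)
  else if query q is Some (i, q') then
    bind (H i) (fun _ => bind (gstep d sim_fill) (fun _ => ret (inl q')))
  else bind (gstep d (sim_step q)) (fun q' =>
    bind (gstep d sim_fill) (fun _ => ret (inl q')))).

Definition sim : prog unit := bind (gstep d sim_fill) (fun _ => sim_loop (start M)).

Lemma pick_emb t : [pick t' | emb t' == emb t] = Some t.
Proof.
by case: pickP => [t' /eqP/emb_inj->|/(_ t)]; rewrite ?eqxx.
Qed.

Lemma pick_notemb z : (forall t, emb t != z) -> [pick t | emb t == z] = None.
Proof. by move=> h; case: pickP => // t; rewrite (negPf (h t)). Qed.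

Definition dtape (p : seq S * seq S) : stape (digit + aux M) :=
  (nth None (map dec p.1), nth None (map dec p.2)).

Definition fill (v : seq S) : seq S := if v is [::] then [:: enc None] else v.

Definition fillt (t : stape S) : stape S := sact (Some (odflt (enc None) (t.2 0)), Stay) t.

Lemma fillt_Tp u v : fillt (Tp u v) = Tp u (fill v).
Proof. by rewrite /fillt; case: v => [|x v] /=; rewrite ?sact_write_nil ?sact_write_cons. Qed.

Lemma nth_None1 i : nth None [:: None : symbol M] i = None.
Proof. by case: i => //= i; rewrite nth_nil. Qed.

Lemma dtape_fill u v : dtape (u, fill v) = dtape (u, v).
Proof.
case: v => //; congr (_, _); apply/funext => i /=.
by rewrite jaK /= nth_None1 nth_nil.
Qed.

Lemma size_fill v : size (fill v) <= (size v).+1.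
Proof. by case: v. Qed.

(** What a step of M and the filling after it make of the visited cells; the default symbols stand
    for cells reached for the first time. *)
Definition pact (a : symbol M * move) (p : seq S * seq S) : seq S * seq S :=
  let b := enc a.1 in
  match a.2 with
  | MoveLeft => (behead p.1, head (enc None) p.1 :: b :: behead p.2)
  | Stay => (p.1, b :: behead p.2)
  | MoveRight => (b :: p.1, fill (behead p.2))
  end.

Lemma pactE a p : p.2 <> [::] ->
  [/\ fillt (sact (Some (enc a.1), a.2) (Tp p.1 p.2)) = Tp (pact a p).1 (pact a p).2,
      (pact a p).2 <> [::],
      dtape (pact a p) = sact a (dtape p) &
      size (pact a p).1 + size (pact a p).2 <= (size p.1 + size p.2).+1].
Proof.
case: p a => [u [|x v]] [b m] //= _.
have sw : sact (Some (enc b), Stay) (Tp u (x :: v)) = Tp u (enc b :: v).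
  exact: sact_write_cons.
have ns (s : seq (symbol M)) : stail (nth None s) = nth None (behead s).
  by apply/funext => i; rewrite nth_behead.
have nc c (s : seq (symbol M)) : nth None (c :: s) = scons c (nth None s).
  by apply/funext => i; case: i.
case: m; split=> //=.
- rewrite /sact /Tp /= stail_str -str_cons; case: u {sw} => [|y u].
    by rewrite /fillt /sact /= stail_scons -str_cons.
  have -> : (str (behead (y :: u)), scons (str (y :: u) 0) (str (enc b :: v)))
    = Tp u (y :: enc b :: v).
    by rewrite /Tp (str_cons y (enc b :: v)).
  by rewrite fillt_Tp.
- congr (_, _) => /=; first by rewrite ns behead_map.
  rewrite !nc stail_scons /= encK; congr scons.
  by case: u {sw} => [|y u] //=; rewrite jaK.
- by case: u {sw} => [|y u] /=; lia.
- by congr (_, _); rewrite /= !nc stail_scons encK.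
- by rewrite -fillt_Tp /sact /Tp /= stail_str -str_cons.
- by case: v {sw}.
- congr (_, _) => /=; first by rewrite nc encK.
  have := congr1 snd (dtape_fill [::] v) => /= ->.
  by rewrite ns.
- by have := size_fill v; lia.
Qed.

Lemma wp_fill A (Q : A -> conf -> Prop) n k ts :
  (forall ts', (forall t, ts' (emb t) = fillt (ts (emb t))) ->
     (forall z, (forall t, emb t != z) -> ts' z = ts z) -> wp (k tt) Q n ts') ->
  wp (bind (gstep d sim_fill) k) Q n.+1 ts.
Proof.
move=> h; rewrite -add1n; apply: wp_bind; apply: wp_gstep => /=; apply: h => [t|z hz].
  by rewrite pick_emb.
by rewrite pick_notemb // sact_id.
Qed.

Variables (OM : 'I_d' -> nat -> seq digit) (D : nat).
Hypothesis size_OM : forall i m, size (OM i m) <= m + D.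

Variable ts0 : conf.
Variables (B cost : nat).

Definition frame ts := forall z, (forall t, emb t != z) -> ts z = ts0 z.

Hypothesis wp_H : forall i u v ts (Q : unit -> conf -> Prop), frame ts ->
  ts (emb (oracle_tape M i)) = Tp u v -> size u + size v <= B ->
  Q tt (upd ts (emb (oracle_tape M i)) (Tp [::] (digit_syms _ (OM i (ones v))))) ->
  wp (H i) Q cost ts.

Definition simulates ts N (mts : {ffun tape_id M -> tape M}) :=
  frame ts /\ exists uv : tape_id M -> seq S * seq S, forall t,
    [/\ ts (emb t) = Tp (uv t).1 (uv t).2, (uv t).2 <> [::],
        abs (mts t) = dtape (uv t) & size (uv t).1 + size (uv t).2 <= N].

Lemma simulates_le ts N N' mts : N <= N' -> simulates ts N mts -> simulates ts N' mts.
Proof.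
move=> NN [fr [uv h]]; split => //; exists uv => t; have [h1 h2 h3 h4] := h t.
by split => //; apply: leq_trans NN.
Qed.

Lemma isone_dec x : isone (dec x) = isone (Some x).
Proof. by case: x => //= z; rewrite /isone; case: (jd z). Qed.

Lemma unary_at_ones (t : tape M) u v : abs t = dtape (u, v) -> unary_at t = ones v.
Proof.
move=> ht; rewrite -unary_at_abs ht; apply: sunaryE => [i|] /=.
  rewrite /ones => hi; have := before_find (inr (ja None)) hi => /negbFE.
  rewrite (nth_map (inr (ja None))) ?isone_dec //.
  by rewrite (leq_trans hi) // find_size.
have [hs|hs] := ltnP (ones v) (size v).
  rewrite (nth_map (inr (ja None))) // isone_dec.
  by apply: (@nth_find _ _ (fun x => ~~ isone (Some x))); rewrite has_find.
by rewrite nth_default ?size_map.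
Qed.

Lemma abs_answer w : abs (tape_of M w) = dtape ([::], digit_syms Aux w).
Proof.
rewrite /abs /dtape /= /digit_syms -map_comp; congr (_, _).
Qed.

(** A query m occupies at least m cells, so its answer lengthens the tape by at most D, and one more
    cell may get filled; an ordinary step adds at most one cell. Hence D + 2 cells per step are
    enough, and the handlers always find tapes of size at most B. *)
Lemma wp_sim_loop n q (mts : {ffun tape_id M -> tape M}) N ts (Q : unit -> conf -> Prop) :
  simulates ts N mts -> N + n * (D + 2) <= B ->
  let c := iter n (step OM) (q, mts) in
  halted c.1 -> (forall ts', simulates ts' B c.2 -> Q tt ts') ->
  wp (sim_loop q) Q (n.+1 * (cost + 4)) ts.
Proof.
elim: n q mts N ts => [|n IH] q mts N ts hs hB c hc hQ.
  apply: (@wp_loop_le _ _ _ _ _ _ _ 0 0); last by lia.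
  rewrite hc; apply: wp_ret; apply: hQ; apply: simulates_le hs; lia.
have [hq|hq] := boolP (halted q).
  have cE : c = (q, mts).
    (* A halted machine does not move, so the configuration reached is the present one. *)
    by rewrite /c; elim: (n.+1) => //= m ->; rewrite /= hq.
  apply: (@wp_loop_le _ _ _ _ _ _ _ 0 0); last by lia.
  rewrite hq; apply: wp_ret; apply: hQ; rewrite cE; apply: simulates_le hs; lia.
move: hc hQ; rewrite /c iterSr => {c} hc hQ.
have [fr [uv huv]] := hs.
apply: (@wp_loop_le _ _ _ _ _ _ _ (cost + 3) (n.+1 * (cost + 4))); last by lia.
rewrite (negPf hq) /=.
move: hc hQ; rewrite /= (negPf hq).
case: (query q) => [[i q']|] hc hQ.
  apply: (@wp_bind_le _ _ _ _ _ _ _ cost 2); last by lia.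
  have [e1 e2 e3 e4] := huv (oracle_tape M i).
  apply: (wp_H fr e1); first by lia.
  apply: wp_fill => ts' h1 h2; apply: wp_ret.
  (* The answer has at most N + D symbols; an empty one is filled with a single cell. *)
  apply: (IH q' _ (N + D).+1 _ _ _ hc hQ); last by lia.
  split; first by move=> z hz; rewrite h2 // upd_other ?fr //; apply/eqP; rewrite eq_sym.
  exists (fun t => if t == oracle_tape M i
    then ([::], fill (digit_syms Aux (OM i (ones (uv t).2)))) else uv t) => t.
  rewrite h1 ffunE; case: eqP => [->|/eqP ne].
    rewrite upd_same fillt_Tp; split => //=.
    - by case: digit_syms.
    - rewrite dtape_fill (unary_at_ones (u := (uv (oracle_tape M i)).1)
      (v := (uv (oracle_tape M i)).2)).
        exact: abs_answer.
      by rewrite e3; case: (uv _).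
    - apply: leq_trans (size_fill _) _; rewrite size_map.
      have := size_OM i (ones (uv (oracle_tape M i)).2).
      have := find_size (fun x => ~~ isone (Some x)) (uv (oracle_tape M i)).2.
      by rewrite -/(ones _); lia.
  have [f1 f2 f3 f4] := huv t.
  rewrite upd_other ?f1; last by move=> /emb_inj/eqP; apply/negP.
  by split => //; [rewrite fillt_Tp; case: (uv t).2 f2|lia].
rewrite /sim_step.
apply: (@wp_bind_le _ _ _ _ _ _ _ 1 2); last by lia.
apply: wp_gstep => /=.
set r1 := [ffun t => obind _ _].
have r1E : r1 = [ffun t => scanned (mts t)].
  apply/ffunP => t; rewrite !ffunE scanned_abs; have [-> f2 -> _] := huv t.
  by case: (uv t) f2 => u [|x v] //=; rewrite str0.
move: hc hQ; rewrite -r1E; case: (delta q r1) => q' a hc hQ /=.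
apply: wp_fill => ts' h1 h2; apply: wp_ret.
apply: (IH q' _ N.+1 _ _ _ hc hQ); last by lia.
split.
  by move=> z hz; rewrite h2 // pick_notemb // sact_id fr.
exists (fun t => pact (a t) (uv t)) => t; have [f1 f2 f3 f4] := huv t.
have [g1 g2 g3 g4] := pactE (a t) f2.
by rewrite h1 pick_emb f1 g1 ffunE abs_act f3 g3; split => //; lia.
Qed.

(** The blank that ends the word on the tape of M may be present as an auxiliary symbol, with other
    symbols behind it. Of this remainder v it is only kept that no digit comes first. *)
Lemma simulates_word ts N mts (t : tape_id M) w :
  simulates ts N mts -> word_at (mts t) = [seq Some (inl c) | c <- w] ->
  exists u v, [/\ ts (emb t) = Tp u (digit_syms _ w ++ v), (forall c, ohead v <> Some (inl c))
    & size u + size w + size v <= N].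
Proof.
move=> [_ [uv /(_ t)]]; case: (uv t) => u v /= [e1 _ e3 e4] hw.
have nv i : nth None (mts t).2 i = nth None (map dec v) i.
  by have /= -> := congr1 snd e3.
set p := fun c : symbol M => ~~ isSome c.
have fw : find p (mts t).2 = size w.
  by have := congr1 size hw; rewrite /word_at size_map size_takel // find_size.
have vi i : i < size w -> nth None (map dec v) i = Some (inl (nth Minus w i)).
  move=> hi; rewrite -nv -(nth_map Minus None (fun c => Some (inl c))) // -hw /word_at fw.
  by rewrite nth_take.
have vn : nth None (map dec v) (size w) = None.
  rewrite -nv -fw; case: (boolP (has p (mts t).2)) => [/(nth_find None)|/hasNfind->].
    by case: nth.
  by rewrite nth_default.
have sv : size w <= size v.
  rewrite leqNgt; apply/negP => /vi; by rewrite nth_default // size_map.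
exists u, (drop (size w) v).
have tw : take (size w) v = digit_syms _ w.
  apply: (@eq_from_nth _ (inl Minus)); first by rewrite size_takel // size_map.
  move=> i; rewrite size_takel // => hi; rewrite nth_take // (nth_map Minus) //.
  move: (vi _ hi); rewrite (nth_map (inl Minus)) ?(leq_trans hi) //.
  by case: nth => [c|z] //=; [case=> ->|case: (jd z)].
split; first by rewrite -tw cat_take_drop.
  move=> c hc; move: vn; have [hs|hs] := ltnP (size w) (size v); last first.
    by move: hc; rewrite drop_oversize.
  rewrite (nth_map (inl Minus)) //.
  by move: hc; rewrite (drop_nth (inl Minus) hs) /= => -[->].
by rewrite size_drop; lia.
Qed.

Lemma wp_sim ins n w N (Q : unit -> conf -> Prop) :
  outputs M OM ins n w ->
  (forall t, ts0 (emb t) = if t is inl (inl i) then Tp [::] (digit_syms _ (ins i))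
    else Tp [::] [::]) ->
  (forall i, size (ins i) <= N) -> N.+1 + n * (D + 2) <= B ->
  (forall ts u v, frame ts -> ts (emb (output_tape M)) = Tp u (digit_syms _ w ++ v) ->
    (forall c, ohead v <> Some (inl c)) -> size u + size w + size v <= B -> Q tt ts) ->
  wp sim Q (n.+1 * (cost + 4)).+1 ts0.
Proof.
move=> ho h0 hN hB hQ.
apply: wp_fill => ts h1 h2.
move: ho; rewrite /outputs; case E: (iter _ _ _) => [s mts] [hs hw].
have E' : iter n (step OM) (start M, (initial M ins).2) = (s, mts) := E.
(* The additional cell is the one that filling creates on an empty tape. *)
apply: (@wp_sim_loop n (start M) (initial M ins).2 N.+1 ts); rewrite ?E' //; last first.
- move=> ts' hsim.
  by have [u [v [g1 g2 g3]]] := simulates_word hsim hw; apply: (hQ _ u v) => //; case: hsim.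
split; first by move=> z hz; rewrite h2.
exists (fun t => ([::], fill (if t is inl (inl i) then digit_syms _ (ins i) else [::]))) => t.
rewrite h1 h0 ffunE.
have [w' [-> -> hw']] : exists w', [/\ (if t is inl (inl i) then Tp [::] (digit_syms Aux (ins i))
  else Tp [::] [::])
    = Tp [::] (digit_syms _ w'), (if t is inl (inl i) then tape_of M (ins i) else tape_of M [::])
      = tape_of M w'
    & ((if t is inl (inl i) then digit_syms Aux (ins i) else [::]) = digit_syms _ w')
      /\ size w' <= N].
  by case: t => [[i|i]|i]; [exists (ins i)|exists [::]|exists [::]].
case: hw' => -> hw'; rewrite fillt_Tp; split => //=.
- by case: digit_syms.
- by rewrite abs_answer -dtape_fill.
- by rewrite (leq_trans (size_fill _)) // size_map.
Qed.

End Simulation.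

(** * Binary words *)

Definition bits (n : nat) : seq bool :=
  [seq odd (n %/ 2 ^ i) | i <- rev (iota 0 (trunc_log 2 n).+1)].

(* Most significant bit first, whereas [lval] reads the least significant first. *)
Definition mval (a : seq bool) : nat := lval (rev a).

Definition bit_digits (a : seq bool) : seq digit := [seq Bit b | b <- a].

(** These are exactly the values of [bits]: no leading 0 except in the word of the number 0. *)
Definition canonb (a : seq bool) : bool := (a == [:: false]) || head false a.

Fixpoint strip (a : seq bool) : seq bool := if a is false :: a' then strip a' else a.

Lemma binaryE n : binary n = bit_digits (bits n).
Proof. by rewrite /bit_digits /bits -map_comp. Qed.

Lemma mval_rcons a b : mval (rcons a b) = b + (mval a).*2.
Proof. by rewrite /mval rev_rcons. Qed.

Lemma mval_cat a b : mval (a ++ b) = mval a * 2 ^ size b + mval b.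
Proof. by rewrite /mval rev_cat lval_cat size_rev; lia. Qed.

Lemma mval_cons a b : mval (a :: b) = a * 2 ^ size b + mval b.
Proof. by rewrite -cat1s mval_cat; congr (_ * _ + _); case: a. Qed.

Lemma mval_lt a : mval a < 2 ^ size a.
Proof. by rewrite /mval -(size_rev a) lval_lt. Qed.

Lemma mval_inj a b : size a = size b -> mval a = mval b -> a = b.
Proof.
elim/last_ind: a b => [|a x IH] b; first by case: b.
elim/last_ind: b => [|b y _]; first by rewrite size_rcons.
rewrite !size_rcons !mval_rcons => -[sab] h.
have e : x = y by move: h; case: (x); case: (y) => //=; lia.
by rewrite e (IH b) //; move: h; rewrite e; lia.
Qed.

Lemma bits_rec n : 1 < n -> bits n = rcons (bits n./2) (odd n).
Proof.
move=> n1; rewrite /bits trunc_log2S // -[(trunc_log _ _).+2]add1n iotaD -[0 + 1]/(1 + 0) iotaDl.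
rewrite rev_cons map_rcons divn1; congr rcons.
rewrite -map_rev -map_comp; apply: eq_map => i /=.
by rewrite expnS divnMA divn2.
Qed.

Lemma bits_small (b : bool) : bits b = [:: b].
Proof. by case: b. Qed.

Lemma bits_mval a : canonb a -> bits (mval a) = a.
Proof.
elim/last_ind: a => [//|a x IH] h; rewrite mval_rcons.
case: a IH h => [|y a] IH h; first by rewrite addn0 bits_small.
have ht : y by move: h; rewrite /canonb rcons_cons eqseq_cons; case: (a) => [|? ?];
  rewrite /= andbF.
have ca : canonb (y :: a) by rewrite /canonb /= ht orbT.
have pa : 0 < mval (y :: a) by rewrite mval_cons ht addn_gt0 mul1n expn_gt0.
rewrite bits_rec; last by lia.
have -> : (x + (mval (y :: a)).*2)./2 = mval (y :: a) by case: (x); lia.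
by rewrite IH // oddD odd_double addbF; case: (x).
Qed.

Lemma bits_canon_mval n : canonb (bits n) /\ mval (bits n) = n.
Proof.
elim: n {-2}n (leqnn n) => [|m IH] n hn.
  by move: hn; rewrite leqn0 => /eqP->.
have [n1|n1] := leqP n 1.
  by case: n n1 hn => [|[|n]].
have [c v] := IH n./2 ltac:(lia); rewrite bits_rec //; split.
  move: c v; rewrite /canonb; case: (bits n./2) => [|x a] //= c v.
  case: a c v => [|y a]; last by move=> /orP[/eqP//|->]; rewrite orbT.
  by case: x => //= _; rewrite /mval /=; lia.
by rewrite mval_rcons v addnC; lia.
Qed.

Lemma bits_canonb n : canonb (bits n). Proof. by case: (bits_canon_mval n). Qed.

Lemma mval_bits n : mval (bits n) = n. Proof. by case: (bits_canon_mval n). Qed.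

Lemma mval_strip a : mval (strip a) = mval a.
Proof. by elim: a => // -[//|] a IH; rewrite mval_cons /= IH. Qed.

Lemma canon_strip a : 0 < mval a -> canonb (strip a).
Proof. by elim: a => // -[//|] a IH; rewrite mval_cons /= => /IH. Qed.

Lemma bits_strip a : 0 < mval a -> bits (mval a) = strip a.
Proof. by move=> /canon_strip/bits_mval; rewrite mval_strip. Qed.

Lemma size_bits_lt n k : n < 2 ^ k -> 0 < k -> size (bits n) <= k.
Proof.
rewrite size_map size_rev size_iota => h k0.
case: n h => [|n] h; first by rewrite trunc_log0.
have := @trunc_logP 2 n.+1 isT isT => h2.
by rewrite -(ltn_exp2l _ _ (isT : 1 < 2)); apply: leq_ltn_trans h.
Qed.

Lemma size_binary n : size (binary n) = size (bits n).
Proof. by rewrite binaryE size_map. Qed.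

Lemma size_bits_gt0 n : 0 < size (bits n).
Proof. by rewrite size_map size_rev. Qed.

Lemma lt_size_bits n : n < 2 ^ size (bits n).
Proof. by rewrite -{1}(mval_bits n) mval_lt. Qed.

Definition frac_bits N b := [seq odd (N %/ 2 ^ (b - i)) | i <- iota 1 b].

Lemma mval_frac_bits N b : mval (frac_bits N b) = N %% 2 ^ b.
Proof.
elim: b N => [|b IH] N; first by rewrite modn1.
rewrite /frac_bits -[X in iota 1 X]addn1 iotaD map_cat cats1 mval_rcons.
have -> : [seq odd (N %/ 2 ^ (b.+1 - i)) | i <- iota 1 b] = frac_bits (N %/ 2) b.
  apply/eq_in_map => i; rewrite mem_iota => hi.
  by rewrite subSn ?expnS ?divnMA //; lia.
rewrite IH addnC add1n subnn divn1 -muln2 expnS.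
have := divn_eq (N %/ 2) (2 ^ b); have := divn_eq N 2; rewrite modn2.
set x := N %/ 2 => e1 e2.
have e3 : N = x %/ 2 ^ b * (2 * 2 ^ b) + (x %% 2 ^ b * 2 + odd N).
  by rewrite {1}e1 {1}e2; lia.
have : x %% 2 ^ b < 2 ^ b by rewrite ltn_mod expn_gt0.
by rewrite [in RHS]e3 modnMDl => h; rewrite [RHS]modn_small //; case: (odd N); lia.
Qed.

Lemma size_frac_bits N b : size (frac_bits N b) = b.
Proof. by rewrite size_map size_iota. Qed.

(** * Words of dyadic numbers and of integers *)

Section DyadicWords.

Local Open Scope ring_scope.

Definition dyadic_word (neg : bool) (I F : seq bool) : seq digit :=
  (if neg then [:: Minus] else [::]) ++ bit_digits I ++ Point :: bit_digits F.

Definition dyadic_value (neg : bool) (I F : seq bool) : rat :=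
  (-1) ^+ neg * (mval (I ++ F))%:R / 2 ^+ size F.

Lemma binary_dyadicE q : binary_dyadic q =
  let b := logn 2 `|denq q| in
  dyadic_word (q < 0) (bits (`|numq q| %/ 2 ^ b)) (frac_bits `|numq q| b).
Proof.
rewrite /binary_dyadic /dyadic_word /= binaryE; congr (_ ++ (_ ++ (_ :: _))).
by rewrite /bit_digits /frac_bits -map_comp.
Qed.

(** As q * 2 ^ b is an integer, the denominator divides [numq q] times 2 ^ b; being coprime to
    [numq q], it divides 2 ^ b. *)
Lemma dyadic_denq q : dyadic q -> (`|denq q| = 2 ^ logn 2 `|denq q|)%N.
Proof.
move=> [a [b qE]].
have h : numq q * 2 ^+ b = a * denq q.
  apply: (@intr_inj rat); rewrite !rmorphM /= rmorphXn /= -[in RHS](mulr1 a%:~R).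
  have d0 : (denq q)%:~R != 0 :> rat by rewrite intr_eq0 denq_neq0.
  have -> : a%:~R = q * 2 ^+ b by rewrite qE divfK // expf_neq0.
  by rewrite -{2}(divq_num_den q) mulr1; field.
have : (`|denq q| %| 2 ^ b)%N.
  have : (`|denq q| %| `|numq q| * 2 ^ b)%N.
    have := congr1 absz h; rewrite !abszM abszX => -> /=.
    by apply: dvdn_mull.
  by rewrite Gauss_dvdr // coprime_sym coprime_num_den.
case/(dvdn_pfactor _ _ (isT : prime 2)) => m _ ->.
by rewrite pfactorK.
Qed.

Lemma dyadic_valueP q : dyadic q -> exists neg I F,
  [/\ canonb I, binary_dyadic q = dyadic_word neg I F & q = dyadic_value neg I F].
Proof.
move=> hq; rewrite binary_dyadicE /=; set b := logn 2 _; set N := `|numq q|%N.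
exists (q < 0), (bits (N %/ 2 ^ b)), (frac_bits N b); split => //; first exact: bits_canonb.
rewrite /dyadic_value mval_cat mval_bits size_frac_bits mval_frac_bits -divn_eq.
rewrite -{1}(divq_num_den q) -[denq q]gez0_abs ?denq_ge0 //.
rewrite (dyadic_denq hq) -/b -natrX; congr (_ / _).
have -> : (q < 0) = (numq q < 0) by rewrite numq_lt0.
by rewrite {1}[numq q]intEsign rmorphM /= rmorph_sign.
Qed.

(** A last digit 1 makes the numerator odd, so the fraction is in lowest terms and no digit is lost;
    [last true] also admits an empty fractional part. The third hypothesis excludes a negative zero,
    whose sign the rational number would forget. *)
Lemma binary_dyadic_value neg I F : canonb I -> last true F ->
  (mval (I ++ F) > 0)%N \/ ~~ neg ->
  binary_dyadic (dyadic_value neg I F) = dyadic_word neg I F.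
Proof.
move=> cI lF h0; set q := dyadic_value _ _ _; set N := mval (I ++ F).
set b := size F.
have cop : coprime N (2 ^ b).
  case: (posnP b) => [->|b0]; first by rewrite expn0 coprimen1.
  rewrite coprimeXr // coprimen2 /N.
  move: lF b0 {h0}; rewrite /N /b; case: (lastP F) => // F' x; rewrite last_rcons => -> _.
  by rewrite -rcons_cat mval_rcons oddD odd_double.
have qE : q = ((-1) ^+ neg * N%:Z)%:~R / (Posz (2 ^ b))%:~R.
  by rewrite /q /dyadic_value -natrX rmorphM /= rmorph_sign.
have cop' : coprime (absz ((-1) ^+ neg * N%:Z)) (absz (Posz (2 ^ b))) by rewrite abszMsign.
have d0 : Posz (2 ^ b) != 0 by rewrite -lt0n expn_gt0.
have dE : (`|denq q| = 2 ^ b)%N.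
  by rewrite qE coprimeq_den // (negPf d0).
have nE : (`|numq q| = N)%N.
  by rewrite qE coprimeq_num // gtr0_sg ?mul1r ?abszMsign // ltz_nat expn_gt0.
have neE : (q < 0) = neg.
  rewrite qE pmulr_llt0; last by rewrite invr_gt0 ltr0z ltz_nat expn_gt0.
  rewrite ltrz0; case: (neg) h0 => /= [[N0|//]|_].
    by rewrite mulN1r oppr_lt0 ltz_nat.
  by rewrite mul1r ltz_nat ltn0.
rewrite binary_dyadicE dE nE neE /= pfactorK // /dyadic_word /N mval_cat -/b.
have mF := mval_lt F; rewrite -/b in mF.
rewrite divnMDl ?expn_gt0 // divn_small // addn0 bits_mval //.
congr (_ ++ (_ ++ (_ :: bit_digits _))).
apply: mval_inj; first by rewrite size_frac_bits.
by rewrite mval_frac_bits modnMDl modn_small.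
Qed.

Lemma dyadic_dyadic_value neg I F : dyadic (dyadic_value neg I F).
Proof.
exists ((-1) ^+ neg * (mval (I ++ F))%:Z), (size F).
by rewrite rmorphM /= rmorph_sign.
Qed.

Lemma binary_intE (neg : bool) (a : seq bool) : canonb a -> (mval a > 0)%N \/ ~~ neg ->
  binary_int ((-1) ^+ neg * (mval a)%:Z) = (if neg then [:: Minus] else [::]) ++ bit_digits a.
Proof.
move=> ca h; rewrite /binary_int abszMsign absz_nat binaryE bits_mval //.
congr (_ ++ _); case: neg h => /= [[h|//]|_].
  by rewrite mulN1r oppr_lt0 ltz_nat h.
by [].
Qed.

End DyadicWords.

(** * Polynomial bounds *)

Lemma horner_natE (p : {poly nat}) (x : nat) : p.[x]%R = \sum_(i < size p) (p`_i)%R * x ^ i.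
Proof.
rewrite horner_coef; 
by apply: eq_bigr => i _; congr (_ * _).
Qed.

Lemma eval2E p a b : eval2 p a b = \sum_(i < size p) ((p`_i).[b])%R * a ^ i.
Proof.
rewrite /eval2 (horner_coef p) horner_sum.
by apply: eq_bigr => i _; rewrite -rmorphXn hornerM hornerC; congr (_ * _).
Qed.

Lemma horner_nat_mono (p : {poly nat}) x y : x <= y -> p.[x]%R <= p.[y]%R.
Proof.
by move=> xy; rewrite !horner_natE leq_sum // => -[[|i] hi] _; rewrite leq_mul // leq_exp2r.
Qed.

Lemma eval2_mono p a b a' b' : a <= a' -> b <= b' -> eval2 p a b <= eval2 p a' b'.
Proof.
move=> aa bb; rewrite !eval2E leq_sum // => i _.
by rewrite leq_mul ?horner_nat_mono //; case: (nat_of_ord i) => // n; rewrite leq_exp2r.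
Qed.

(** Closure under the operations that occur in the time bounds makes it unnecessary to write down
    any polynomial. *)
Definition poly_bounded (F : nat -> nat -> nat) :=
  exists p, forall a b, F a b <= eval2 p a b.

Lemma pb_le F G : poly_bounded G -> (forall a b, F a b <= G a b) -> poly_bounded F.
Proof. by move=> [p hp] h; exists p => a b; apply: leq_trans (hp a b). Qed.

Lemma pb_const c : poly_bounded (fun _ _ => c).
Proof. by exists c%:P%:P%R => a b; rewrite /eval2 !hornerC. Qed.

Lemma pb_fst : poly_bounded (fun a _ => a).
Proof. by exists 'X%R => a b; rewrite /eval2 hornerX hornerC. Qed.

Lemma pb_snd : poly_bounded (fun _ b => b).
Proof. by exists 'X%:P%R => a b; rewrite /eval2 hornerC hornerX. Qed.

Lemma pb_add F G : poly_bounded F -> poly_bounded G ->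
  poly_bounded (fun a b => F a b + G a b).
Proof.
move=> [p hp] [q hq]; exists (p + q)%R => a b; rewrite /eval2 !hornerD.
exact: leq_add.
Qed.

Lemma pb_mul F G : poly_bounded F -> poly_bounded G ->
  poly_bounded (fun a b => F a b * G a b).
Proof.
move=> [p hp] [q hq]; exists (p * q)%R => a b; rewrite /eval2 !hornerM.
exact: leq_mul.
Qed.

Lemma pb_exp F n : poly_bounded F -> poly_bounded (fun a b => F a b ^ n).
Proof.
move=> hF; elim: n => [|n IH]; first exact: pb_const.
by apply: pb_le (pb_mul hF IH) _ => a b; rewrite expnS.
Qed.

Lemma pb_sum n (F : 'I_n -> nat -> nat -> nat) : (forall i, poly_bounded (F i)) ->
  poly_bounded (fun a b => \sum_(i < n) F i a b).
Proof.
elim: n F => [|n IH] F hF.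
  by apply: pb_le (pb_const 0) _ => a b; rewrite big_ord0.
apply: pb_le (pb_add (hF ord0) (IH _ (fun i => hF (lift ord0 i)))) _ => a b.
by rewrite big_ord_recl.
Qed.

Lemma pb_horner (q : {poly nat}) F : poly_bounded F -> poly_bounded (fun a b => q.[F a b]%R).
Proof.
move=> hF; apply: pb_le (pb_sum (fun i : 'I_(size q) => pb_mul (pb_const (q`_i)%R)
  (pb_exp i hF))) _.
by move=> a b; rewrite horner_natE.
Qed.

Lemma pb_eval2 q F G : poly_bounded F -> poly_bounded G ->
  poly_bounded (fun a b => eval2 q (F a b) (G a b)).
Proof.
move=> hF hG.
apply: pb_le (pb_sum (fun i : 'I_(size q) => pb_mul (pb_horner (q`_i)%R hG) (pb_exp i hF))) _.
by move=> a b; rewrite eval2E.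
Qed.

(** * Long division *)

Lemma digit_syms_bits (Aux : finType) a : digit_syms Aux (bit_digits a) = bit_syms Aux a.
Proof. by rewrite /digit_syms /bit_digits /bit_syms -map_comp. Qed.

Lemma bit_syms_cat (Aux : finType) a b : bit_syms Aux (a ++ b) = bit_syms Aux a ++ bit_syms Aux b.
Proof. exact: map_cat. Qed.

Lemma bit_syms_rev (Aux : finType) a : bit_syms Aux (rev a) = rev (bit_syms Aux a).
Proof. exact: map_rev. Qed.

Lemma size_bit_syms (Aux : finType) a : size (bit_syms Aux a) = size a.
Proof. exact: size_map. Qed.

(* [x %/ y] to m binary places, followed by a last digit 1, which makes the
   expansion canonical and its value nonzero. *)
Definition quot_digits (x y m : nat) : seq bool * seq bool :=
  let q := x * 2 ^ m %/ y in (bits (q %/ 2 ^ m), rcons (frac_bits q m) true).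

Definition quot_word neg x y m :=
  dyadic_word neg (quot_digits x y m).1 (quot_digits x y m).2.

Lemma has_mval a : has id a = (0 < mval a).
Proof. by elim: a => //= -[] a IH; rewrite mval_cons ?mul1n ?addn_gt0 ?expn_gt0. Qed.

Lemma strip_nil a : ~~ has id a -> strip a = [::].
Proof. by elim: a => // -[]. Qed.

Section Division.
Variables (d : nat) (Aux : finType) (T : eqType) (ot : 'I_d -> T).
Local Notation S := (digit + Aux)%type.
Variable O : 'I_d -> nat -> seq S.
Local Notation conf := (conf S T).
Local Notation wp := (wp ot (@isone Aux) O).
Local Notation prog := (prog d S T).
Local Notation ret a := (ret d S T a).
Local Notation bit_syms := (bit_syms Aux).
Local Notation bit_sym := (bit_sym Aux).
Local Notation rd v := (rd d Aux v).
Local Notation mv v m := (mv d Aux v m).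
Local Notation put v s m := (put d v s m).
Implicit Types (ts : conf).

Variables (X Y A R C : T).
Hypotheses (XY : X <> Y) (XA : X <> A) (XR : X <> R) (XC : X <> C) (YA : Y <> A)
  (YR : Y <> R) (YC : Y <> C) (AR : A <> R) (AC : A <> C) (RC : R <> C).

(** Restoring division. The least significant digit is nearest to the head, so writing x there
    doubles the remainder and adds x. A borrow shows that the divisor was too large, and it is added
    back. *)
Definition divstep (x : bool) : prog bool :=
  bind (put R (Some (bit_sym x)) MoveRight) (fun _ =>
  bind (addsub d Aux true false R Y) (fun c =>
  if c then bind (addsub d Aux false false R Y) (fun _ => ret false) else ret true)).

Lemma wp_divstep (x : bool) r y w Q ts :
  ts R = Tp (bit_syms r) [::] -> ts Y = Tp (bit_syms y) [::] ->
  maxn (size r).+1 (size y) <= w ->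
  (let q := lval y <= x + (lval r).*2 in
   forall r', size r' = maxn (size r).+1 (size y) -> lval r' + q * lval y = x + (lval r).*2 ->
     Q q (upd ts R (Tp (bit_syms r') [::]))) ->
  wp (divstep x) Q (50 * w + 90) ts.
Proof.
move=> eR eY hw h; have {hw} : exists w', maxn (size r).+1 (size y) = w' /\ w' <= w by eauto.
move=> [w' [hw' ww]]; rewrite hw' in h.
have -> : 50 * w + 90 = (50 * w + 89).+1 by lia.
apply: (wp_put eR).
apply: (@wp_bind_le _ _ _ _ _ _ _ (25 * w + 40) (25 * w + 49)); last by lia.
have RY : R <> Y by exact: not_eq_sym.
apply: (wp_addsub (n := w') (a := x :: r) (b := y)) => //; [lk|lk|lia|].
rewrite /= cats0.
have := @lval_subl w' false (x :: r) y ltac:(move: hw' => /=; lia) ltac:(lia).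
have := size_ripple w' true false (x :: r) y.
case: (addl w' true false (x :: r) y) => r1 c /= s1.
have l1 := lval_lt r1; have lxr := lval_lt (x :: r); have ly := lval_lt y.
have p1 : 2 ^ size (x :: r) <= 2 ^ w' by rewrite leq_exp2l //=; lia.
have p2 : 2 ^ size y <= 2 ^ w' by rewrite leq_exp2l //=; lia.
rewrite s1 in l1; rewrite /= in lxr.
case: c => /= e1; last first.
  apply: wp_ret; rewrite upd_upd.
  have qE : lval y <= x + (lval r).*2 by lia.
  by rewrite qE in h; apply: h; lia.
have qE : (lval y <= x + (lval r).*2) = false by lia.
rewrite qE in h.
apply: (@wp_bind_le _ _ _ _ _ _ _ (25 * w + 40) 0); last by lia.
apply: (wp_addsub (n := w') (a := r1) (b := y)) => //; [lia|lk|lk|lia|].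
rewrite /= cats0.
have := @lval_addl w' false r1 y ltac:(lia) ltac:(lia).
have := size_ripple w' false false r1 y.
case: (addl w' false false r1 y) => r2 c2 /= s2 e2.
apply: wp_ret; rewrite !upd_upd; apply: h => //.
(* The carry of this addition cancels the borrow before it, as both have weight 2 ^ w'. *)
have l2 := lval_lt r2; rewrite s2 in l2.
by move: e2; case: c2; lia.
Qed.

(** The flag z tells whether a digit 1 has been written already; until then the digits 0 are
    suppressed, as they would be leading zeros. *)
Definition intloop : bool -> prog bool := loop (fun z : bool =>
  bind (rd X) (fun s => if s is Some (inl (Bit x)) then
    bind (mv X MoveRight) (fun _ => bind (divstep x) (fun q : bool =>
      if q || z then bind (put A (Some (bit_sym q)) MoveRight) (fun _ => ret (inl true))
      else ret (inl false)))
  else ret (inr z))).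

(** Each round lengthens the remainder by at most one digit beyond the longer of remainder and
    divisor, hence the sum bounded by K, which limits the cost of every subtraction. *)
Lemma wp_intloop K z u xs r y a Q ts :
  ts X = Tp u (bit_syms xs) -> ts R = Tp (bit_syms r) [::] -> ts Y = Tp (bit_syms y) [::] ->
  ts A = Tp a [::] -> maxn (size r) (size y) + size xs <= K -> lval r < lval y ->
  (forall qs r', size qs = size xs -> size r' <= K -> lval r' < lval y ->
     mval qs * lval y + lval r' = lval r * 2 ^ size xs + mval xs ->
     Q (z || has id qs)
       (upd (upd (upd ts X (Tp (catrev (bit_syms xs) u) [::])) R (Tp (bit_syms r') [::]))
          A (Tp (catrev (bit_syms (if z then qs else strip qs)) a) [::]))) ->
  wp (intloop z) Q ((50 * K + 100) * (size xs).+1) ts.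
Proof.
elim: xs z u r a ts => [|x xs IH] z u r a ts eX eR eY eA hK hr h.
  apply: (@wp_loop_le _ _ _ _ _ _ _ 1 0); last by lia.
  apply: (wp_rd eX); apply: wp_ret.
  have -> : z = z || has id [::] by rewrite orbF.
  apply: eq_post; first by apply: (h [::] r) => //; [move: hK => /=; lia | rewrite muln1 addnC].
  by case: z {h}; updeq.
apply: (@wp_loop_le _ _ _ _ _ _ _ (50 * K + 95) ((50 * K + 100) * (size xs).+1));
  last by rewrite /= !mulnS; lia.
have -> : 50 * K + 95 = (50 * K + 93).+2 by lia.
apply: (wp_rd eX); apply: (wp_mvR eX).
apply: (@wp_bind_le _ _ _ _ _ _ _ (50 * K + 90) 1); last by lia.
apply: (wp_divstep (r := r) (y := y)); [lk|lk|by move: hK => /=; lia|].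
move=> q r1 s1 e1.
have hr1 : lval r1 < lval y by move: e1; rewrite /q; case: (leqP (lval y) (_ + _)) => /=; lia.
have step (z' : bool) ts' a' : ts' X = Tp (bit_sym x :: u) (bit_syms xs) ->
  ts' R = Tp (bit_syms r1) [::] -> ts' Y = Tp (bit_syms y) [::] -> ts' A = Tp a' [::] ->
  z' = q || z -> (a' = if z' then bit_sym q :: a else a) ->
  (forall z, z <> X -> z <> R -> z <> A -> ts' z = ts z) ->
  wp (intloop z') Q ((50 * K + 100) * (size xs).+1) ts'.
  move=> fX fR fY fA zE aE fr; apply: (IH _ _ _ _ _ fX fR fY fA _ hr1).
    by rewrite s1; move: hK => /=; lia.
  move=> qs r2 s2 hr2 lr2 e2.
  apply: eq_post.
    have -> : z' || has id qs = z || has id (q :: qs) by rewrite zE /= orbCA orbA.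
    apply: (h (q :: qs) r2) => //=; first by rewrite s2.
    rewrite mval_cons mulnDl -addnA e2 s2 mval_cons expnS; move: e1; lia.
  apply/funext => v; rewrite /upd.
  case: (eqVneq v A) => vA; last first.
    case: (eqVneq v R) => vR //; case: (eqVneq v X) => vX //.
    by rewrite fr //; apply/eqP.
  by rewrite aE zE; case: (q) => //=; case: (z) => //=.
case: ifP => hq; last first.
  apply: wp_ret; apply: step; try by lk.
  by move=> v vX vR vA; lk.
apply: wp_put; first by lk.
apply: wp_ret; apply: step; try by lk.
by move=> v vX vR vA; lk.
Qed.

(** Every 1 erased from C brings down a digit 0 of the dividend and yields one more binary place. *)
Definition fracloop : prog unit := loop (fun _ : unit =>
  bind (rd C) (fun s => if s is Some _ then
    bind (put C None MoveRight) (fun _ => bind (divstep false) (fun q : bool =>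
      bind (put A (Some (bit_sym q)) MoveRight) (fun _ => ret (inl tt))))
  else ret (inr tt))) tt.

Lemma wp_fracloop K m r y a Q ts :
  ts C = Tp [::] (nseq m (bit_sym true)) -> ts R = Tp (bit_syms r) [::] ->
  ts Y = Tp (bit_syms y) [::] ->
  ts A = Tp a [::] -> maxn (size r) (size y) + m <= K -> lval r < lval y ->
  (forall qs r', size qs = m -> size r' <= K -> lval r' < lval y ->
     mval qs * lval y + lval r' = lval r * 2 ^ m ->
     Q tt (upd (upd (upd ts C (Tp [::] [::])) R (Tp (bit_syms r') [::]))
          A (Tp (catrev (bit_syms qs) a) [::]))) ->
  wp fracloop Q ((50 * K + 100) * m.+1) ts.
Proof.
elim: m r a ts => [|m IH] r a ts eC eR eY eA hK hr h.
  apply: (@wp_loop_le _ _ _ _ _ _ _ 1 0); last by lia.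
  apply: (wp_rd eC); apply: wp_ret.
  by apply: eq_post; [apply: (h [::] r) => //; [lia | rewrite muln1]|updeq].
apply: (@wp_loop_le _ _ _ _ _ _ _ (50 * K + 95) ((50 * K + 100) * m.+1));
  last by rewrite !mulnS; lia.
have -> : 50 * K + 95 = (50 * K + 93).+2 by lia.
apply: (wp_rd eC); apply: (wp_drop eC).
apply: (@wp_bind_le _ _ _ _ _ _ _ (50 * K + 90) 1); last by lia.
apply: (wp_divstep (r := r) (y := y)); [lk|lk|lia|].
move=> q r1 s1 e1.
have hr1 : lval r1 < lval y by move: e1; rewrite /q; case: (leqP (lval y) (_ + _)) => /=; lia.
apply: wp_put; first by lk.
apply: wp_ret; apply: (IH r1 (bit_sym q :: a)) => //; try by lk.
  by rewrite s1; lia.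
move=> qs r2 s2 hr2 lr2 e2.
apply: eq_post.
  apply: (h (q :: qs) r2) => //=; first by rewrite s2.
  rewrite mval_cons mulnDl -addnA e2 s2 expnS; move: e1; lia.
by updeq.
Qed.

Definition countloop : prog unit := loop (fun _ : unit =>
  bind (rd A) (fun s => if isone s then
    bind (mv A MoveRight) (fun _ => bind (push d C (bit_sym true)) (fun _ => ret (inl tt)))
  else ret (inr tt))) tt.

Lemma wp_countloop u v m Q ts :
  ts A = Tp u v -> ts C = Tp [::] (nseq m (bit_sym true)) ->
  (forall u' v', size u' + size v' = size u + size v ->
     Q tt (upd (upd ts A (Tp u' v')) C (Tp [::] (nseq (ones v + m) (bit_sym true))))) ->
  wp countloop Q (10 * size v + 10) ts.
Proof.
elim: v u m ts => [|x v IH] u m ts eA eC h.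
  apply: (@wp_loop_le _ _ _ _ _ _ _ 1 0) => //.
  apply: (wp_rd eA); apply: wp_ret.
  by apply: eq_post; [apply: (h u [::])|updeq].
apply: (@wp_loop_le _ _ _ _ _ _ _ 5 (10 * size v + 10)); last by rewrite /=; lia.
apply: (wp_rd eA); rewrite [ohead _]/=; case: ifP => hx.
  apply: (wp_mvR eA); apply: wp_push; first by lk.
  apply: wp_ret; apply: (IH (x :: u) m.+1); [by lk|by lk|].
  move=> u' v' suv; apply: eq_post; first by apply: (h u' v'); rewrite suv /=; lia.
  by rewrite /ones /= hx /= addnS; updeq.
apply: wp_ret; apply: eq_post; first by apply: (h u (x :: v)).
by rewrite /ones /= hx /= add0n; updeq.
Qed.

(** Apart from completing the expansion, it leaves R and C blank and X rewound, so that the next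
    query finds these tapes as the first one did. *)
Definition div_tail : prog unit :=
  bind (put A (Some (inl Point)) MoveRight) (fun _ =>
  bind fracloop (fun _ =>
  bind (put A (Some (bit_sym true)) MoveRight) (fun _ =>
  bind (goL d Aux A) (fun _ => bind (wipe d Aux R) (fun _ =>
  bind (goL d Aux X) (fun _ => ret tt)))))).

Definition div_body : prog unit :=
  bind (intloop false) (fun z =>
  if z then div_tail else bind (put A (Some (bit_sym false)) MoveRight) (fun _ => div_tail)).

Definition div_handler : prog unit :=
  bind countloop (fun _ => bind (wipe d Aux A) (fun _ =>
  bind (rd X) (fun s => if s is Some (inl Minus)
    then bind (mv X MoveRight) (fun _ =>
      bind (put A (Some (inl Minus)) MoveRight) (fun _ => div_body))
    else div_body))).

Lemma wp_div_tail K m r y a u Q ts :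
  ts C = Tp [::] (nseq m (bit_sym true)) -> ts R = Tp (bit_syms r) [::] ->
  ts Y = Tp (bit_syms y) [::] -> ts A = Tp a [::] -> ts X = Tp u [::] ->
  maxn (size r) (size y) + m <= K -> lval r < lval y -> size u <= K.+1 -> size a <= K.+2 ->
  (forall qs r', size qs = m -> lval r' < lval y ->
     mval qs * lval y + lval r' = lval r * 2 ^ m ->
     Q tt (upd (upd (upd (upd ts C (Tp [::] [::])) R (Tp [::] [::]))
          A (Tp [::] (catrev a (inl Point :: bit_syms (rcons qs true))))) X (Tp [::] (rev u)))) ->
  wp div_tail Q ((50 * K + 100) * (m + 3)) ts.
Proof.
move=> eC eR eY eA eX hK hr su sa h.
have hm : m <= K by lia.
apply: (@wp_le _ _ _ _ _ _ _ _ _ ((50 * K + 100) * m.+1 + (50 * K + 100)).+1); last first.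
  by rewrite !mulnDr mulnS; lia.
apply: (wp_put eA).
apply: (@wp_bind_le _ _ _ _ _ _ _ ((50 * K + 100) * m.+1) (50 * K + 100)) => //.
apply: (@wp_fracloop K m r y (inl Point :: a)) => //; try by lk.
move=> qs r1 sqs sr1 hr1 e1.
have -> : 50 * K + 100 = (50 * K + 99).+1 by lia.
apply: wp_put; first by lk.
apply: (@wp_bind_le _ _ _ _ _ _ _ (10 * K + 40) (40 * K + 59)); last by lia.
set t := Tp (_ :: _) _.
apply: (wp_le (n := 5 * (size (bit_sym true :: catrev (bit_syms qs) (inl Point :: a))) + 8));
  last first.
  by rewrite /= catrevE size_cat size_rev size_bit_syms /=; lia.
apply: (wp_goL (v := A)); first by lk.
apply: (@wp_bind_le _ _ _ _ _ _ _ (10 * K + 40) (30 * K + 19)); last by lia.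
apply: (wp_wipe (v := R)); [by lk|by rewrite size_bit_syms /=; lia|].
apply: (@wp_bind_le _ _ _ _ _ _ _ (5 * size u + 8) 0); last by lia.
apply: (wp_goL (v := X)); first by lk.
apply: wp_ret; apply: eq_post; first exact: (h qs r1).
have -> : catrev a (inl Point :: bit_syms (rcons qs true)) =
    catrev (bit_sym true :: catrev (bit_syms qs) (inl Point :: a)) [::].
  rewrite !catrevE cats0 rev_cons rev_cat revK rev_cons -!cats1 bit_syms_cat.
  by rewrite -!catA.
by updeq.
Qed.

Lemma wp_div_handler neg x y u v N B Q ts : 0 < lval y ->
  ts X = Tp [::] ((if neg then [:: inl Minus] else [::]) ++ bit_syms (bits x)) ->
  ts Y = Tp (bit_syms y) [::] -> ts R = Tp [::] [::] -> ts C = Tp [::] [::] ->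
  ts A = Tp u v -> size u + size v <= B ->
  (let K := size (bits x) + size y + B in (50 * K + 100) * (K + 10) <= N) ->
  Q tt (upd ts A (Tp [::] (digit_syms Aux (quot_word neg x (lval y) (ones v))))) ->
  wp div_handler Q N ts.
Proof.
move=> y0 eX eY eR eC eA hB /=; set sx := size (bits x); set K := sx + size y + B => hN h.
have ov : ones v <= B by have := find_size (fun x => ~~ isone (Some x)) v; rewrite -/(ones v); lia.
pose P := 50 * K + 100.
apply: (@wp_bind_le _ _ _ _ _ _ _ P (P * (sx + ones v + 6))); last first.
  apply: leq_trans hN; rewrite -/P -mulnS leq_mul2l; apply/orP; right; lia.
apply: (wp_le (n := 10 * size v + 10)); last by lia.
apply: (wp_countloop (m := 0) eA) => // u' v' suv; rewrite addn0.
apply: (@wp_bind_le _ _ _ _ _ _ _ P (P * (sx + ones v + 5))); last first.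
  by rewrite -mulnS leq_mul2l; lia.
apply: (wp_wipe (v := A)); [by lk|lia|].
set ts1 := upd _ A _.
pose u0 : seq S := if neg then [:: inl Minus] else [::].
have body ts2 : ts2 X = Tp u0 (bit_syms (bits x)) -> ts2 Y = Tp (bit_syms y) [::] ->
    ts2 R = Tp [::] [::] -> ts2 C = Tp [::] (nseq (ones v) (bit_sym true)) ->
    ts2 A = Tp u0 [::] -> (forall z, z <> X -> z <> A -> z <> C -> ts2 z = ts z) ->
    wp div_body Q (P * (sx + ones v + 4) + 1) ts2.
  move=> fX fY fR fC fA fr.
  apply: (@wp_bind_le _ _ _ _ _ _ _ (P * sx.+1) (P * (ones v + 3)).+1); last first.
    have -> : sx + ones v + 4 = sx.+1 + (ones v + 3) by lia.
    by rewrite mulnDr; lia.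
  apply: (wp_le (n := (50 * (sx + size y) + 100) * sx.+1)); last first.
    by rewrite leq_mul2r; apply/orP; right; rewrite /P /K; lia.
  apply: (wp_intloop (K := sx + size y) (r := [::]) (y := y) fX _ _ fA) => //;
    first by rewrite /= max0n addnC.
  move=> qs r1 sqs sr1 hr1 e1; rewrite mul0n add0n mval_bits in e1.
  have tail ts3 a b : ts3 A = Tp (catrev (bit_syms b) u0) [::] -> b = bits (mval qs) ->
    (forall z, z <> A -> ts3 z = upd (upd ts2 X (Tp (catrev (bit_syms (bits x)) u0) [::]))
      R (Tp (bit_syms r1) [::]) z) ->
    a = catrev (bit_syms b) u0 ->
    wp div_tail Q (P * (ones v + 3)) ts3.
    move=> gA bE gr aE.
    have sb : size b <= maxn 1 sx.
      have := mval_lt qs; rewrite sqs bE => hlt.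
      have := @size_bits_lt (mval qs) (maxn 1 sx); apply; last by lia.
      by apply: leq_trans hlt _; rewrite leq_exp2l //; lia.
    have sx0 : 0 < sx by exact: size_bits_gt0.
    apply: (wp_div_tail (K := K) (r := r1) (y := y) _ _ _ gA) => //.
    - by rewrite gr; [lk|neq_tac].
    - by rewrite gr; [lk|neq_tac].
    - by rewrite gr; [lk|neq_tac].
    - by rewrite gr; [lk|neq_tac].
    - by rewrite /K; lia.
    - by rewrite catrevE size_cat size_rev size_bit_syms /u0 -/sx; case: (neg) => /=; lia.
    - by rewrite catrevE size_cat size_rev size_bit_syms /u0; case: (neg) => /=; lia.
    move=> qs2 r2 sqs2 hr2 e2.
    apply: (eq_post h).
    (* The fractional loop starts from the remainder of the integral one, so both together divide x
       * 2 ^ m by y. *)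
    have QE : x * 2 ^ ones v %/ lval y = mval (qs ++ qs2).
      have -> : x * 2 ^ ones v = mval (qs ++ qs2) * lval y + lval r2.
        by rewrite -e1 mval_cat sqs2 !mulnDl -e2 mulnAC addnA.
      by rewrite divnMDl // divn_small // addn0.
    have wE : digit_syms Aux (quot_word neg x (lval y) (ones v)) =
      catrev (catrev (bit_syms b) u0) (inl Point :: bit_syms (rcons qs2 true)).
      have lt2 := mval_lt qs2; rewrite sqs2 in lt2.
      have fE : frac_bits (mval (qs ++ qs2)) (ones v) = qs2.
        apply: mval_inj; first by rewrite size_frac_bits.
        by rewrite mval_frac_bits mval_cat sqs2 modnMDl modn_small.
      have iE : mval (qs ++ qs2) %/ 2 ^ ones v = mval qs.
        by rewrite mval_cat sqs2 divnMDl ?expn_gt0 // divn_small // addn0.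
      rewrite /quot_word /quot_digits QE /= fE iE -bE /dyadic_word /digit_syms !map_cat /=.
      rewrite -!/(digit_syms Aux _) !digit_syms_bits !catrevE rev_cat revK -catA.
      by rewrite /u0; case: (neg).
    rewrite wE; apply/funext => z; rewrite /upd.
    case: (eqVneq z X) => [->|/eqP zX].
      by rewrite (negPf (introN eqP XA)) catrevE rev_cat revK eX /u0; case: (neg).
    case: (eqVneq z A) => [_|/eqP zA] //.
    case: (eqVneq z R) => [->//|/eqP zR]; case: (eqVneq z C) => [->//|/eqP zC].
    by rewrite gr //; lk; rewrite fr.
  have mq := has_mval qs; rewrite /=.
  case: ifP => hq.
    apply: (wp_le (n := P * (ones v + 3))) => //.
    apply: (tail _ _ (strip qs)) => //.
    - by lk.
    - by rewrite bits_strip // -mq.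
    - by move=> z zA; rewrite upd_other.
  apply: wp_put; first by lk.
  apply: (tail _ _ [:: false]) => //.
  - by lk; rewrite strip_nil ?hq.
  - by have -> : mval qs = 0 by lia.
  - by move=> z zA; rewrite !(upd_other _ _ zA).
apply: (wp_le (n := (P * (sx + ones v + 4) + 1).+3)); last first.
  have -> : sx + ones v + 5 = (sx + ones v + 4).+1 by lia.
  have : 100 <= P by rewrite /P; lia.
  by rewrite mulnS; lia.
move: eX body {h}; rewrite /u0 /ts1 {u0}; case: (neg) => eX body.
  apply: (wp_rd (u := [::]) (w := inl Minus :: bit_syms (bits x))); first by lk.
  apply: (wp_mvR (u := [::]) (w := bit_syms (bits x))); first by lk.
  apply: wp_put; first by lk.
  apply: body; try by lk.
  by move=> z zX zA zC; lk.
apply: (wp_rd (u := [::]) (w := bit_syms (bits x))); first by lk.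
have : 0 < size (bits x) by exact: size_bits_gt0.
case E: (bits x) => [//|b bs] _ /=.
apply: (wp_le (n := P * (sx + ones v + 4) + 1)); last by lia.
apply: body; try by lk.
by move=> z zX zA zC; lk.
Qed.

End Division.

Arguments wp_div_handler {d Aux T ot O X Y A R C} _ _ _ _ _ _ _ _ _ _ {neg x y u v N B Q ts}.

(** * Product of an integer and a dyadic number *)

Definition isbit (Aux : Type) (s : option (digit + Aux)) : bool :=
  if s is Some (inl (Bit _)) then true else false.

Section Loops.
Variables (d : nat) (Aux : finType) (T : eqType) (ot : 'I_d -> T).
Local Notation S := (digit + Aux)%type.
Variable O : 'I_d -> nat -> seq S.
Local Notation conf := (conf S T).
Local Notation wp := (wp ot (@isone Aux) O).
Local Notation prog := (prog d S T).
Local Notation ret a := (ret d S T a).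
Local Notation bit_syms := (bit_syms Aux).
Local Notation bit_sym := (bit_sym Aux).
Local Notation rd v := (rd d Aux v).
Local Notation mv v m := (mv d Aux v m).
Local Notation put v s m := (put d v s m).
Implicit Types (ts : conf).

Lemma ohead_bit_syms_cat a r : ohead (bit_syms a ++ r) = if a is x :: _ then Some (bit_sym x)
  else ohead r.
Proof. by case: a. Qed.

Definition countbits V W : prog unit := loop (fun _ : unit =>
  bind (rd V) (fun s => if isbit s then
    bind (mv V MoveRight) (fun _ => bind (push d W (bit_sym true)) (fun _ => ret (inl tt)))
  else ret (inr tt))) tt.

Lemma wp_countbits V W u a r m Q ts : V <> W ->
  ts V = Tp u (bit_syms a ++ r) -> ~~ isbit (ohead r) -> ts W = Tp [::] (nseq m (bit_sym true)) ->
  Q tt (upd (upd ts V (Tp (catrev (bit_syms a) u) r)) W (Tp [::] (nseq (size a + m)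
    (bit_sym true)))) ->
  wp (countbits V W) Q (10 * size a + 10) ts.
Proof.
move=> VW; elim: a u m ts => [|x a IH] u m ts eV hr eW h.
  apply: (@wp_loop_le _ _ _ _ _ _ _ 1 0) => //.
  apply: (wp_rd eV); rewrite ohead_bit_syms_cat (negPf hr).
  by apply: wp_ret; apply: (eq_post h); updeq.
apply: (@wp_loop_le _ _ _ _ _ _ _ 5 (10 * size a + 10)); last by rewrite /=; lia.
apply: (wp_rd eV); apply: (wp_mvR (u := u) (w := bit_syms a ++ r) eV).
apply: wp_push; first by lk.
apply: wp_ret; apply: (IH (bit_sym x :: u) m.+1) => //; [by lk|by lk|].
by apply: (eq_post h); rewrite addnS; updeq.
Qed.

Definition striploop A : prog unit := loop (fun _ : unit =>
  bind (rd A) (fun s => if isbit s && ~~ isone s then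
    bind (put A None MoveRight) (fun _ => ret (inl tt))
  else ret (inr tt))) tt.

Lemma wp_striploop A a r Q ts : ts A = Tp [::] (bit_syms a ++ r) -> ~~ isbit (ohead r) ->
  Q tt (upd ts A (Tp [::] (bit_syms (strip a) ++ r))) ->
  wp (striploop A) Q (10 * size a + 10) ts.
Proof.
elim: a ts => [|x a IH] ts eA hr h.
  apply: (@wp_loop_le _ _ _ _ _ _ _ 1 0) => //.
  apply: (wp_rd eA); rewrite ohead_bit_syms_cat (negPf hr).
  by apply: wp_ret; apply: (eq_post h); updeq.
apply: (@wp_loop_le _ _ _ _ _ _ _ 2 (10 * size a + 10)); last by rewrite /=; lia.
apply: (wp_rd eA); rewrite ohead_bit_syms_cat isone_bit_sym.
case: x eA h => /= eA h.
  by apply: wp_ret; apply: (eq_post h); updeq.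
apply: (wp_drop eA); apply: wp_ret; apply: IH => //; first by lk.
by apply: (eq_post h); updeq.
Qed.

(** Horner's rule: a new least significant digit 0 doubles A, and a digit 1 adds Y. The point is
    passed over, so the digits on both sides of it are treated as those of one integer. *)
Definition horner_loop V A Y : prog unit := loop (fun _ : unit =>
  bind (rd V) (fun s => match s with
    | Some (inl (Bit b)) => bind (mv V MoveRight) (fun _ =>
        bind (put A (Some (bit_sym false)) MoveRight) (fun _ =>
        if b then bind (addsub d Aux false true A Y) (fun _ => ret (inl tt))
        else ret (inl tt)))
    | Some (inl Point) => bind (mv V MoveRight) (fun _ => ret (inl tt))
    | _ => ret (inr tt)
    end)) tt.

(** Stated with a continuation, since it is applied to the digits before the point and again to
    those after it. A round adds at most two digits, by the shift and by a carry; the lower bound on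
    the size of a' ensures that there are enough digits for [droploop]. *)
Lemma wp_horner_bits K V A Y cs rest u a y n Q ts :
  V <> A -> V <> Y -> A <> Y ->
  ts V = Tp u (bit_syms cs ++ rest) -> ts A = Tp (bit_syms a) [::] -> ts Y = Tp (bit_syms y) [::] ->
  maxn (size a) (size y) + 2 * size cs <= K ->
  (forall a', lval a' = lval a * 2 ^ size cs + mval cs * lval y ->
     size a + size cs <= size a' ->
     maxn (size a') (size y) <= maxn (size a) (size y) + 2 * size cs ->
     wp (horner_loop V A Y) Q n
       (upd (upd ts V (Tp (catrev (bit_syms cs) u) rest)) A (Tp (bit_syms a') [::]))) ->
  wp (horner_loop V A Y) Q ((25 * K + 60) * size cs + n) ts.
Proof.
move=> VA VY AY; elim: cs u a ts => [|c cs IH] u a ts eV eA eY hK h.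
  rewrite muln0 add0n; apply: (wp_le (n := n)) => //.
  have := h a; rewrite muln1 /= mul0n !addn0 => /(_ erefl (leqnn _) (leqnn _)).
  by congr (wp _ _ _ _); updeq.
apply: (@wp_loop_le _ _ _ _ _ _ _ (25 * K + 50) ((25 * K + 60) * size cs + n));
  last by rewrite /= mulnS; lia.
have hK1 : maxn (size a) (size y) + 2 <= K by move: hK => /=; lia.
have -> : 25 * K + 50 = (25 * K + 47).+3 by lia.
apply: (wp_rd eV) => /=; apply: (wp_mvR (x := bit_sym c) (w := bit_syms cs ++ rest) eV).
apply: wp_put; first by lk.
have step (a1 : seq bool) ts' : ts' A = Tp (bit_syms a1) [::] ->
    lval a1 = (lval a).*2 + c * lval y -> size a < size a1 ->
    maxn (size a1) (size y) <= maxn (size a) (size y) + 2 ->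
    ts' V = Tp (bit_sym c :: u) (bit_syms cs ++ rest) ->
    (forall z, z <> V -> z <> A -> ts' z = ts z) ->
    wp (horner_loop V A Y) Q ((25 * K + 60) * size cs + n) ts'.
  move=> fA l1 s1 s2 fV fr; apply: (IH _ a1 _ fV fA) => //.
  - by rewrite fr //; apply: not_eq_sym.
  - by move: hK => /=; lia.
  move=> a2 l2 s3 s4.
  have := h a2; rewrite l2 l1 /= => hh.
  have {hh} := hh ltac:(by rewrite mval_cons expnS; nia) ltac:(lia) ltac:(lia).
  congr (wp _ _ _ _); apply/funext => z; rewrite /upd.
  by case: (eqVneq z A) => // /eqP zA; case: (eqVneq z V) => // /eqP zV; rewrite fr.
case: c step {hK h IH eV} => step; last first.
  apply: wp_ret; apply: (step (false :: a)); try by lk.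
  - by rewrite /=; lia.
  - by rewrite /=; lia.
  - by move=> z zV zA; lk.
set w := maxn (size a).+1 (size y).
apply: (@wp_bind_le _ _ _ _ _ _ _ (25 * w + 40) 0); last by rewrite /w; lia.
apply: (wp_addsub (n := w) (a := false :: a) (b := y)) => //; [by lk|by lk|].
have := @lval_addl w false (false :: a) y ltac:(rewrite /w /=; lia) ltac:(rewrite /w; lia).
have := size_ripple w false false (false :: a) y.
case: (addl w false false (false :: a) y) => r c /= sr er.
apply: wp_ret; apply: step; try by lk.
- by rewrite lval_cat sr; move: er; case: c => /=; lia.
- by rewrite size_cat sr size_nseq /w; lia.
- by rewrite size_cat sr size_nseq /w; case: c {er}; lia.
- by move=> z zV zA; lk.
Qed.

(** One digit of A is erased for every fractional digit and one for the point. The additional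
    halving makes room for the last digit 1. *)
Definition droploop V A : prog unit := loop (fun _ : unit =>
  bind (mv V MoveLeft) (fun _ => bind (mv A MoveLeft) (fun _ =>
  bind (wr d A None) (fun _ => bind (rd V) (fun s =>
  ret (if s is Some (inl Point) then inr tt else inl tt)))))) tt.

Lemma wp_droploop V A f u r a Q ts : V <> A ->
  ts V = Tp (bit_syms f ++ inl Point :: u) r -> ts A = Tp (bit_syms a) [::] ->
  size f < size a ->
  (forall t, Q tt (upd (upd ts V t) A (Tp (bit_syms (drop (size f).+1 a)) [::]))) ->
  wp (droploop V A) Q (10 * size f + 10) ts.
Proof.
move=> VA; elim: f r a ts => [|x f IH] r [//|y a] ts eV eA hs h.
  apply: (@wp_loop_le _ _ _ _ _ _ _ 4 0) => //.
  apply: (wp_mvL eV); apply: (wp_mvL (v := A)); first by lk.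
  apply: wp_erase; first by lk.
  apply: (wp_rd (v := V) (u := u) (w := inl Point :: r)); first by lk.
  by apply: wp_ret; apply: eq_post; [apply: (h (Tp u (inl Point :: r)))|rewrite /= drop0; updeq].
apply: (@wp_loop_le _ _ _ _ _ _ _ 4 (10 * size f + 10)); last by rewrite /=; lia.
apply: (wp_mvL eV); apply: (wp_mvL (v := A)); first by lk.
apply: wp_erase; first by lk.
apply: (wp_rd (v := V) (u := bit_syms f ++ inl Point :: u) (w := bit_sym x :: r)); first by lk.
apply: wp_ret; apply: (IH (bit_sym x :: r) a) => //; [by lk|by lk|].
by move=> t; apply: eq_post; [apply: (h t)|updeq].
Qed.

End Loops.

Arguments wp_countbits {d Aux T ot O V W u a r m Q ts}.
Arguments wp_striploop {d Aux T ot O A a r Q ts}.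
Arguments wp_horner_bits {d Aux T ot O K V A Y cs rest u a y n Q ts}.
Arguments wp_droploop {d Aux T ot O V A f u r a Q ts}.

Section Product.
Variables (d : nat) (Aux : finType) (T : eqType) (ot : 'I_d -> T).
Local Notation S := (digit + Aux)%type.
Variable O : 'I_d -> nat -> seq S.
Local Notation conf := (conf S T).
Local Notation wp := (wp ot (@isone Aux) O).
Local Notation prog := (prog d S T).
Local Notation ret a := (ret d S T a).
Local Notation bit_syms := (bit_syms Aux).
Local Notation bit_sym := (bit_sym Aux).
Local Notation rd v := (rd d Aux v).
Local Notation mv v m := (mv d Aux v m).
Local Notation put v s m := (put d v s m).
Implicit Types (ts : conf).
Variables (V A Y : T).
Hypotheses (VA : V <> A) (VY : V <> Y) (AY : A <> Y).

Definition product_tail (neg : bool) : prog unit :=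
  bind (horner_loop d Aux V A Y) (fun _ => bind (droploop d Aux V A) (fun _ =>
  bind (put A (Some (bit_sym true)) MoveRight) (fun _ => bind (goL d Aux A) (fun _ =>
  bind (striploop d Aux A) (fun _ =>
  if neg then bind (push d A (inl Minus)) (fun _ => ret tt) else ret tt))))).

Definition product : prog unit :=
  bind (rd V) (fun s => if s is Some (inl Minus)
    then bind (mv V MoveRight) (fun _ => product_tail true) else product_tail false).

(* Writes [2 (v %/ 2) + 1], where v is the integer part of the product of y and
   the number read. *)
Lemma wp_product K neg I F y u r Q ts : canonb I ->
  ts V = Tp u (digit_syms Aux (dyadic_word neg I F) ++ r) ->
  (forall c, ohead r <> Some (inl c)) ->
  ts A = Tp [::] [::] -> ts Y = Tp (bit_syms y) [::] ->
  size y + 2 * (size I + size F) <= K ->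
  (forall ts' a, ts' A = Tp [::] (digit_syms Aux ((if neg then [:: Minus] else [::]) ++
    bit_digits a)) ->
    canonb a -> mval a = (mval (I ++ F) * lval y %/ 2 ^ (size F).+1).*2.+1 -> Q tt ts') ->
  wp product Q ((25 * K + 60) * (K + 10)) ts.
Proof.
move=> cI eV hr eA eY hK h.
have sI : 0 < size I by case: (I) cI.
pose P := 25 * K + 60.
have tail v ts1 : ts1 V = Tp v (bit_syms I ++ inl Point :: bit_syms F ++ r) ->
    ts1 A = Tp [::] [::] -> ts1 Y = Tp (bit_syms y) [::] ->
    wp (product_tail neg) Q (P * (K + 9)) ts1.
  move=> fV fA fY.
  apply: (@wp_bind_le _ _ _ _ _ _ _ (P * (size I + size F + 1)) (P * 4)); last first.
    by rewrite -mulnDr leq_mul2l; apply/orP; right; lia.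
  apply: (wp_le (n := P * size I + (P * size F + P))); last by lia.
  apply: (wp_horner_bits (K := K) (a := [::]) VA VY AY fV fA fY); first by rewrite max0n; lia.
  move=> a1 l1 s1 m1; rewrite max0n in m1.
  apply: (@wp_loop_le _ _ _ _ _ _ _ 2 (P * size F + 10)); last by rewrite /P; lia.
  apply: wp_rd; first by lk.
  apply: wp_mvR; first by lk.
  apply: wp_ret.
  apply: (wp_horner_bits (K := K) (cs := F) (rest := r) (a := a1) (y := y) VA VY AY); try by lk.
    lia.
  move=> a2 l2 s2 m2.
  apply: (@wp_loop_le _ _ _ _ _ _ _ 1 0) => //.
  apply: wp_rd; first by lk.
  (* What follows the word may be left over from a simulation; since it does not begin with a digit,
     the loop ends there. *)
  have ex Q' n ts' : Q' (inr tt) ts' ->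
     wp (match ohead r with
      | Some (inl (Bit b)) => bind (mv V MoveRight) (fun _ =>
        bind (put A (Some (bit_sym false)) MoveRight) (fun _ =>
        if b then bind (addsub d Aux false true A Y) (fun _ => ret (inl tt))
        else ret (inl tt)))
      | Some (inl Point) => bind (mv V MoveRight) (fun _ => ret (inl tt))
      | _ => ret (inr tt)
      end) Q' n ts'.
    by move=> q'; case: (ohead r) hr => [[c|z]|] hr; try exact: wp_ret; have := hr c.
  apply: ex.
  apply: (@wp_bind_le _ _ _ _ _ _ _ (10 * size F + 10) (P * 3)); last by rewrite /P; lia.
  apply: (wp_le (n := 10 * size (rev F) + 10)); last by rewrite size_rev.
  apply: (wp_droploop (f := rev F) (u := catrev (bit_syms I) v) (r := r) (a := a2) VA).
  - by lk; rewrite catrevE bit_syms_rev.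
  - by lk.
  - by rewrite size_rev; lia.
  rewrite size_rev => t.
  set a3 := drop _ a2.
  have s3 : size a3 <= K by rewrite size_drop; lia.
  have l3 : lval a3 = mval (I ++ F) * lval y %/ 2 ^ (size F).+1.
    have lt := lval_lt (take (size F).+1 a2).
    have st : size (take (size F).+1 a2) = (size F).+1 by rewrite size_takel //; lia.
    rewrite st in lt.
    have -> : mval (I ++ F) * lval y = lval a2.
      by rewrite l2 l1 /= mval_cat; lia.
    by rewrite -{1}(cat_take_drop (size F).+1 a2) lval_cat st addnC mulnC divnMDl ?expn_gt0 //
      divn_small // addn0.
  apply: (wp_le (n := ((5 * (size a3).+1 + 8) + (P * 2)).+1)); last by rewrite /P; lia.
  apply: wp_put; first by lk.
  apply: (@wp_bind_le _ _ _ _ _ _ _ (5 * (size a3).+1 + 8) (P * 2)) => //.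
  rewrite -[(size a3).+1]/(size (true :: a3)) -(size_bit_syms Aux).
  apply: (wp_goL (v := A)); first by lk.
  set a4 := rev (true :: a3).
  have s4 : size a4 <= K.+1 by rewrite size_rev.
  apply: (@wp_bind_le _ _ _ _ _ _ _ (10 * size a4 + 10) P); last by rewrite /P; lia.
  apply: (wp_striploop (a := a4) (r := [::])) => //.
    by lk; rewrite catrevE !cats0 -bit_syms_rev.
  have m4 : mval a4 = (lval a3).*2.+1 by rewrite /mval revK /=; lia.
  have h4 : 0 < mval a4 by rewrite m4.
  case: (neg) h => h.
    apply: (wp_le (n := 2)); last by rewrite /P; lia.
    apply: wp_push; first by lk.
    apply: wp_ret; apply: (h _ (strip a4)).
    - by lk; rewrite cats0 /= -digit_syms_bits.
    - exact: canon_strip.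
    - by rewrite mval_strip m4 l3.
  apply: wp_ret; apply: (h _ (strip a4)).
  - by lk; rewrite cats0 /= -digit_syms_bits.
  - exact: canon_strip.
  - by rewrite mval_strip m4 l3.
have eV' : ts V = Tp u ((if neg then [:: inl Minus] else [::]) ++ bit_syms I ++
  inl Point :: bit_syms F ++ r).
  rewrite eV /dyadic_word /digit_syms !map_cat /= -!/(digit_syms _ _) !digit_syms_bits -!catA /=.
  by case: (neg).
apply: (wp_le (n := (P * (K + 9)).+2)); last by rewrite -/P (_ : K + 10 = (K + 9).+1) ?mulnS ?/P;
  lia.
case: (neg) eV' tail => eV' tail.
  apply: (wp_rd eV'); apply: (wp_mvR eV'); apply: tail; by lk.
apply: (wp_rd eV').
case: I sI {cI hK h eV} tail eV' => // i I _ tail eV' /=.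
by apply: (wp_le (n := P * (K + 9))); [apply: tail; lk|lia].
Qed.

End Product.

Arguments wp_product {d Aux T ot O V A Y} _ _ _ {K neg I F y u r Q ts}.

(** * A machine for integer approximations of y f(x/y) *)

Lemma unary_nseq (Aux : finType) n : digit_syms Aux (unary n) = nseq n (bit_sym Aux true).
Proof. by rewrite /digit_syms /unary map_nseq. Qed.

(** The integer part is no longer than the dividend, and the sign, the point and the last digit fit
    into the constant. The bound has the form m + D that the simulation requires. *)
Lemma size_quot_word neg x y m : size (quot_word neg x y m) <= m + (size (bits x) + 4).
Proof.
rewrite /quot_word /dyadic_word /bit_digits !size_cat /= !size_map size_rcons size_frac_bits.
have : size (bits (x * 2 ^ m %/ y %/ 2 ^ m)) <= size (bits x).
  apply: size_bits_lt; last exact: size_bits_gt0.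
  apply: leq_ltn_trans (lt_size_bits x).
  by rewrite divnAC mulnK ?expn_gt0 // leq_div.
rewrite !size_map; case: neg => /=; lia.
Qed.

Lemma digit_syms_cat (Aux : finType) a b : digit_syms Aux (a ++ b) = digit_syms Aux a ++
  digit_syms Aux b.
Proof. exact: map_cat. Qed.

Section ScaledValue.
Variable M : machine 1 1.
Let Aux : finType := option (aux M).
Let Work : finType := (tape_id M + bool)%type.
Let T : finType := ('I_2 + 'I_0 + option Work)%type.
Let S := (digit + Aux)%type.
Local Notation prog := (prog 0 S T).
Local Notation ret a := (ret 0 S T a).

Let ot (i : 'I_0) : T := inl (inr i).
Let O (i : 'I_0) (m : nat) : seq S := digit_syms Aux (no_oracle i m).
Local Notation wp := (wp ot (@isone Aux) O).
Let emb (t : tape_id M) : T := inr (Some (inl t)).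
Let X : T := inl (inl ord0).
Let Y : T := inl (inl (lift ord0 ord0)).
Let A : T := inr None.
Let R : T := inr (Some (inr true)).
Let C : T := inr (Some (inr false)).
Let I0 : T := emb (input_tape M ord0).
Let V : T := emb (output_tape M).
Let W : T := emb (oracle_tape M ord0).
Let H (i : 'I_1) : prog unit := div_handler 0 Aux X Y W R C.

(** Counting the digits of y has a second effect: it takes the head of Y to the right end, which
    turns the input into the form that the arithmetic programs expect. The two further ones make the
    precision small compared with 1 / y. *)
Definition scaled_body : prog unit :=
  bind (countbits 0 Aux Y I0) (fun _ =>
  bind (push 0 I0 (bit_sym Aux true)) (fun _ => bind (push 0 I0 (bit_sym Aux true)) (fun _ =>
  bind (sim emb id id H) (fun _ => product 0 Aux V A Y)))).

(** A binary word starts with 1 exactly if the number is positive. The integer function must be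
    defined for the remaining y as well, where the value 0 will do. *)
Definition scaled_prog : prog unit :=
  bind (rd 0 Aux Y) (fun s => if isone s then scaled_body
    else bind (wr 0 A (Some (bit_sym Aux false))) (fun _ => ret tt)).

(** The unary precision has length sy + 2, and one cell may be filled at the start; sx + 6 is D + 2
    for the answers of length at most m + (sx + 4). *)
Definition scaled_space sx sy n := sy + 3 + n * (sx + 6).

Definition scaled_time sx sy n :=
  let B := scaled_space sx sy n in
  let K := sx + sy + B in let K' := sy + 2 * B in
  n.+1 * ((50 * K + 100) * (K + 10) + 4) + (25 * K' + 60) * (K' + 10) + 10 * sy + 30.

Lemma wp_scaled_zero n s (Q : unit -> conf S T -> Prop) ts : ~~ isone (ohead s) ->
  ts Y = Tp [::] s -> ts A = Tp [::] [::] -> Q tt (upd ts A (Tp [::] [:: bit_sym Aux false])) ->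
  wp scaled_prog Q n.+2 ts.
Proof.
move=> hs eY eA h; apply: (wp_rd eY); rewrite (negPf hs).
by apply: (wp_wr eA); apply: wp_ret.
Qed.

Lemma wp_scaled neg x y n ng I F (ins : 'I_2 -> seq digit) (Q : unit -> conf S T -> Prop) : 0 < y ->
  ins ord0 = (if neg then [:: Minus] else [::]) ++ bit_digits (bits x) ->
  ins (lift ord0 ord0) = bit_digits (bits y) -> canonb I ->
  outputs M (fun _ m => quot_word neg x y m) (fun=> unary (size (bits y) + 2)) n
    (dyadic_word ng I F) ->
  (forall ts a, ts A = Tp [::] (digit_syms Aux ((if ng then [:: Minus] else [::]) ++
    bit_digits a)) ->
    canonb a -> mval a = (mval (I ++ F) * y %/ 2 ^ (size F).+1).*2.+1 -> Q tt ts) ->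
  wp scaled_prog Q (scaled_time (size (bits x)) (size (bits y)) n) (@start_conf 2 0 Aux Work ins).
Proof.
move=> y0 iX iY cI ho hQ; set sx := size (bits x); set sy := size (bits y).
set B := scaled_space sx sy n; rewrite /scaled_time -/B.
set K := sx + sy + B; set K' := sy + 2 * B.
set cost := (50 * K + 100) * (K + 10); set fin := (25 * K' + 60) * (K' + 10).
have byE : exists b, bits y = true :: b.
  have := bits_canonb y; have := mval_bits y.
  case: (bits y) => [|[] b]; [by []|by exists b|].
  by rewrite /canonb orbF => h /eqP bE; move: h; rewrite bE; move: y0; case: (y).
set ts0 := @start_conf 2 0 Aux Work ins.
have eX : ts0 X = Tp [::] ((if neg then [:: inl Minus] else [::]) ++ bit_syms Aux (bits x)).
  by rewrite /ts0 /= iX digit_syms_cat digit_syms_bits; case: (neg).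
have eY : ts0 Y = Tp [::] (bit_syms Aux (bits y)).
  by rewrite /ts0 /= iY digit_syms_bits.
have eE z : z <> X -> z <> Y -> ts0 z = Tp [::] [::].
  case: z => [[i|i]|z] //= zX zY.
  by case: (unliftP ord0 i) => [j ij|ij]; [case: zY; rewrite ij ord1|case: zX; rewrite ij].
apply: (wp_le (n := (10 * sy + 10 + (((n.+1 * (cost + 4)).+1 + fin).+2).+2).+1)); last by lia.
apply: (wp_rd eY).
have -> : isone (ohead (bit_syms Aux (bits y))) by case: byE => b ->.
apply: (@wp_bind_le _ _ _ _ _ _ _ (10 * sy + 10) (((n.+1 * (cost + 4)).+1 + fin).+2).+2) => //.
have YI : Y <> I0 by [].
apply: (wp_countbits (u := [::]) (a := bits y) (r := [::]) (m := 0)) => //.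
  by rewrite cats0.
rewrite addn0 catrevE cats0 -bit_syms_rev.
apply: wp_push; first by lk.
apply: wp_push; first by lk.
set ts1 := upd _ I0 _.
have sy0 : 0 < sy by exact: size_bits_gt0.
have ly : lval (rev (bits y)) = y by exact: mval_bits.
have fX : ts1 X = ts0 X by rewrite /ts1; lk.
have fY : ts1 Y = Tp (bit_syms Aux (rev (bits y))) [::] by rewrite /ts1; lk.
have fI : ts1 I0 = Tp [::] (nseq (size (bits y) + 2) (bit_sym Aux true)).
  by rewrite /ts1 upd_same !addnS addn0.
have fE z : z <> X -> z <> Y -> z <> I0 -> ts1 z = Tp [::] [::].
  by move=> zX zY zI; rewrite /ts1 !upd_other // eE.
apply: (@wp_bind_le _ _ _ _ _ _ _ (n.+1 * (cost + 4)).+1 fin) => //.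
have einj : injective emb by move=> t t' [].
apply: (@wp_sim _ _ _ _ _ _ _ _ _ einj id id _ H _ (sx + 4) _ ts1 B cost _ _ _ _ (sy + 2) _ ho)
  => //.
- by move=> i m; exact: size_quot_word.
- move=> i u v ts Q' fr; rewrite [i]ord1 => e1 hB hQ'.
  apply: (@wp_div_handler _ _ _ _ _ _ _ _ _ _ _ _ _ _ _ _ _ _ _ _ neg x (rev (bits y)) u v _ B)
    => //.
  + by rewrite ly.
  + by rewrite fr // fX eX.
  + by rewrite fr // fY.
  + by rewrite fr // fE.
  + by rewrite fr // fE.
  + by rewrite /= size_rev.
  + by rewrite ly.
- move=> t; case: t => [[i|i]|t]; last by rewrite fE.
    by rewrite [i]ord1 unary_nseq.
  by rewrite fE.
- by move=> i; rewrite size_nseq.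
- by rewrite /B /scaled_space; lia.
move=> ts u v fr fV hv sB.
have sw : size I + size F <= B.
  move: sB; rewrite /dyadic_word !size_cat /= !size_map; lia.
apply: (@wp_product _ _ _ _ _ _ _ _ _ _ _ K' ng I F (rev (bits y)) u v) => //.
- by rewrite fr // fE.
- by rewrite fr // fY.
- by rewrite size_rev /K'; lia.
by rewrite ly.
Qed.

Lemma outputs_scaled_zero (ins : 'I_2 -> seq digit) :
  ~~ isone (ohead (digit_syms Aux (ins (lift ord0 ord0)))) ->
  outputs (mach scaled_prog) no_oracle ins 2 (bit_digits [:: false]).
Proof.
move=> h; refine (mach_outputs _).
apply: (@wp_scaled_zero 0 _ _ _ h).
- by [].
- by [].
exists [::]; exact: upd_same.
Qed.

Lemma outputs_scaled neg x y n ng I F (ins : 'I_2 -> seq digit) : 0 < y ->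
  ins ord0 = (if neg then [:: Minus] else [::]) ++ bit_digits (bits x) ->
  ins (lift ord0 ord0) = bit_digits (bits y) -> canonb I ->
  outputs M (fun _ m => quot_word neg x y m) (fun=> unary (size (bits y) + 2)) n
    (dyadic_word ng I F) ->
  outputs (mach scaled_prog) no_oracle ins (scaled_time (size (bits x)) (size (bits y)) n)
    ((if ng then [:: Minus] else [::]) ++
      bit_digits (bits (mval (I ++ F) * y %/ 2 ^ (size F).+1).*2.+1)).
Proof.
move=> y0 iX iY cI ho; refine (mach_outputs _).
apply: (wp_scaled y0 iX iY cI ho) => ts a eA ca ma; exists [::].
by rewrite eA -ma bits_mval.
Qed.

End ScaledValue.

(** * A machine for f *)

Section Loops.
Variables (d : nat) (Aux : finType) (T : eqType) (ot : 'I_d -> T).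
Local Notation S := (digit + Aux)%type.
Variable O : 'I_d -> nat -> seq S.
Local Notation conf := (conf S T).
Local Notation wp := (wp ot (@isone Aux) O).
Local Notation prog := (prog d S T).
Local Notation ret a := (ret d S T a).
Local Notation bit_syms := (bit_syms Aux).
Local Notation bit_sym := (bit_sym Aux).
Local Notation rd v := (rd d Aux v).
Local Notation mv v m := (mv d Aux v m).
Local Notation put v s m := (put d v s m).
Implicit Types (ts : conf).

(** An oracle tape still holds the previous answer, which may be too long to be erased in time. Only
    the ones in front of the first other symbol are specified, as nothing else affects the query. *)
Definition is_unary k (t : stape S) : Prop :=
  (forall i, i < k -> isone (t.2 i)) /\ ~~ isone (t.2 k).

Lemma sunary_is_unary k t : is_unary k t -> sunary (@isone Aux) t = k.
Proof. by case; exact: sunaryE. Qed.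

Lemma wp_push_one A (Q : A -> conf -> Prop) n m ts v k : is_unary m (ts v) ->
  (forall t, is_unary m.+1 t -> wp (k tt) Q n (upd ts v t)) ->
  wp (bind (push d v (bit_sym true)) k) Q n.+2 ts.
Proof.
move=> [u1 u2] h; apply: (@wp_bind_le _ _ _ _ _ _ _ 2 n) => //.
apply: (@wp_bind_le _ _ _ _ _ _ _ 1 1) => //; apply: wp_act1.
apply: (@wp_bind_le _ _ _ _ _ _ _ 1 0) => //; apply: wp_act1.
apply: wp_ret; rewrite upd_upd upd_same; apply: h; split => [[|i]|] //=.
  by move=> hi; rewrite /sact /= scons_stail; exact: u1.
by rewrite /sact /= scons_stail.
Qed.

(** A single blank under the head shields the next query from the old contents, whatever these
    are. *)
Lemma wp_blank A (Q : A -> conf -> Prop) n ts v k :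
  (forall t, is_unary 0 t -> wp (k tt) Q n (upd ts v t)) ->
  wp (bind (wr d v None) k) Q n.+1 ts.
Proof.
move=> h; apply: (@wp_bind_le _ _ _ _ _ _ _ 1 n) => //; apply: wp_act1.
exact: h.
Qed.

(** A single pass over the counter produces both the unary query and the zeros of a power of two. *)
Definition zerosloop (V W Z : T) : prog unit := loop (fun _ : unit =>
  bind (rd V) (fun s => if isbit s then
    bind (mv V MoveRight) (fun _ => bind (push d W (bit_sym true)) (fun _ =>
      bind (push d Z (bit_sym false)) (fun _ => ret (inl tt))))
  else ret (inr tt))) tt.

Lemma wp_zerosloop V W Z k u m z Q ts : V <> W -> V <> Z -> W <> Z ->
  ts V = Tp u (nseq k (bit_sym true)) -> is_unary m (ts W) -> ts Z = Tp [::] z ->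
  (forall t, is_unary (k + m) t ->
    Q tt (upd (upd (upd ts V (Tp (nseq k (bit_sym true) ++ u) [::])) W t)
      Z (Tp [::] (nseq k (bit_sym false) ++ z)))) ->
  wp (zerosloop V W Z) Q (10 * k + 10) ts.
Proof.
move=> VW VZ WZ; elim: k u m z ts => [|k IH] u m z ts eV hW eZ h.
  apply: (@wp_loop_le _ _ _ _ _ _ _ 1 0) => //.
  apply: (wp_rd eV); apply: wp_ret.
  by apply: eq_post; [apply: (h _ hW)|updeq].
apply: (@wp_loop_le _ _ _ _ _ _ _ 7 (10 * k + 10)); last by lia.
apply: (wp_rd eV); apply: (wp_mvR eV).
apply: wp_push_one; first by lk.
move=> t ht; apply: wp_push; first by lk.
apply: wp_ret; apply: (IH (bit_sym true :: u) m.+1 (bit_sym false :: z)); try by lk.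
move=> t' ht'; apply: eq_post; first by apply: (h t'); rewrite addSnnS.
have nE (x : S) l : nseq k x ++ x :: l = nseq k.+1 x ++ l.
  by rewrite -cat_rcons; congr (_ ++ _); elim: (k) => //= j ->.
by rewrite !nE; updeq.
Qed.

Definition copybits V W : prog unit := loop (fun _ : unit =>
  bind (rd V) (fun s => if isbit s then
    bind (mv V MoveRight) (fun _ =>
      bind (put W (Some (bit_sym (isone s))) MoveRight) (fun _ => ret (inl tt)))
  else ret (inr tt))) tt.

Lemma wp_copybits V W u a r b Q ts : V <> W ->
  ts V = Tp u (bit_syms a ++ r) -> ~~ isbit (ohead r) -> ts W = Tp b [::] ->
  Q tt (upd (upd ts V (Tp (catrev (bit_syms a) u) r)) W (Tp (catrev (bit_syms a) b) [::])) ->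
  wp (copybits V W) Q (10 * size a + 10) ts.
Proof.
move=> VW; elim: a u b ts => [|x a IH] u b ts eV hr eW h.
  apply: (@wp_loop_le _ _ _ _ _ _ _ 1 0) => //.
  apply: (wp_rd eV); rewrite ohead_bit_syms_cat (negPf hr).
  by apply: wp_ret; apply: (eq_post h); updeq.
apply: (@wp_loop_le _ _ _ _ _ _ _ 3 (10 * size a + 10)); last by rewrite /=; lia.
apply: (wp_rd eV); apply: (wp_mvR (u := u) (w := bit_syms a ++ r) eV).
rewrite ohead_bit_syms_cat isone_bit_sym.
apply: wp_put; first by lk.
apply: wp_ret; apply: (IH (bit_sym x :: u) (bit_sym x :: b)) => //; [by lk|by lk|].
by apply: (eq_post h); updeq.
Qed.

(** The counter V is read leftwards, as it was left with its head at the right end. An answer with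
    too few fractional digits is continued by zeros, and one with more is not read any further. *)
Definition takeloop V W Z : prog unit := loop (fun _ : unit =>
  bind (mv V MoveLeft) (fun _ => bind (rd V) (fun s =>
  if s is Some _ then bind (rd W) (fun s' =>
    if isbit s' then bind (mv W MoveRight) (fun _ =>
      bind (put Z (Some (bit_sym (isone s'))) MoveRight) (fun _ => ret (inl tt)))
    else bind (put Z (Some (bit_sym false)) MoveRight) (fun _ => ret (inl tt)))
  else bind (mv V MoveRight) (fun _ => ret (inr tt))))) tt.

Lemma wp_takeloop V W Z k v u f z Q ts : V <> W -> V <> Z -> W <> Z ->
  ts V = Tp (nseq k (bit_sym true)) v -> ts W = Tp u (bit_syms f) -> ts Z = Tp z [::] ->
  (forall t, Q tt (upd (upd (upd ts V (Tp [::] (nseq k (bit_sym true) ++ v))) W t)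
      Z (Tp (catrev (bit_syms (mkseq (nth false f) k)) z) [::]))) ->
  wp (takeloop V W Z) Q (10 * k + 10) ts.
Proof.
move=> VW VZ WZ; elim: k v u f z ts => [|k IH] v u f z ts eV eW eZ h.
  apply: (@wp_loop_le _ _ _ _ _ _ _ 3 0) => //.
  apply: (wp_mvL eV); apply: (wp_rdL (v := V) (u := [::]) (w := v)); first by lk.
  apply: (wp_mvRL (v := V) (w := v)); first by lk.
  by apply: wp_ret; apply: eq_post; [apply: (h (ts W))|updeq].
apply: (@wp_loop_le _ _ _ _ _ _ _ 5 (10 * k + 10)); last by lia.
apply: (wp_mvL eV); apply: (wp_rd (v := V) (u := nseq k (bit_sym true))
  (w := bit_sym true :: v)); first by lk.
apply: (wp_rd (v := W)); first by lk.
have nE : nseq k.+1 (bit_sym true) ++ v = nseq k (bit_sym true) ++ bit_sym true :: v.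
  by rewrite -cat_rcons; congr (_ ++ _); elim: (k) => //= j ->.
case: f eW h => [|x f] eW h /=.
  apply: wp_put; first by lk.
  apply: wp_ret; apply: (IH (bit_sym true :: v) u [::] (bit_sym false :: z)); try by lk.
  move=> t; apply: eq_post; first exact: (h t).
  rewrite nE /mkseq /= (iotaDl 1 0) -map_comp.
  by rewrite (eq_map (g := nth false [::])) => [|i]; [updeq|rewrite /= nth_nil].
rewrite isone_bit_sym; apply: wp_mvR; first by lk.
apply: wp_put; first by lk.
apply: wp_ret; apply: (IH (bit_sym true :: v) (bit_sym x :: u) f (bit_sym x :: z)); try by lk.
move=> t; apply: eq_post; first exact: (h t).
rewrite nE /mkseq /= (iotaDl 1 0) -map_comp.
by updeq.
Qed.

Definition copyloop V W : prog unit := loop (fun _ : unit =>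
  bind (rd V) (fun s => if s is Some x then
    bind (mv V MoveRight) (fun _ =>
      bind (put W (Some x) MoveRight) (fun _ => ret (inl tt)))
  else ret (inr tt))) tt.

Lemma wp_copyloop V W u a b Q ts : V <> W ->
  ts V = Tp u a -> ts W = Tp b [::] ->
  Q tt (upd (upd ts V (Tp (catrev a u) [::])) W (Tp (catrev a b) [::])) ->
  wp (copyloop V W) Q (10 * size a + 10) ts.
Proof.
move=> VW; elim: a u b ts => [|x a IH] u b ts eV eW h.
  apply: (@wp_loop_le _ _ _ _ _ _ _ 1 0) => //.
  apply: (wp_rd eV); apply: wp_ret; apply: (eq_post h); updeq.
apply: (@wp_loop_le _ _ _ _ _ _ _ 3 (10 * size a + 10)); last by rewrite /=; lia.
apply: (wp_rd eV); apply: (wp_mvR eV); apply: wp_put; first by lk.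
apply: wp_ret; apply: (IH (x :: u) (x :: b)) => //; [by lk|by lk|].
by apply: (eq_post h); updeq.
Qed.

Definition copy V W : prog unit :=
  bind (wipe d Aux W) (fun _ => bind (copyloop V W) (fun _ =>
  bind (goL d Aux W) (fun _ => goL d Aux V))).

Lemma wp_copy V W a u v N Q ts : V <> W ->
  ts V = Tp [::] a -> ts W = Tp u v -> 10 * (size u + size v) + 20 * size a + 50 <= N ->
  Q tt (upd ts W (Tp [::] a)) -> wp (copy V W) Q N ts.
Proof.
move=> VW eV eW hN h.
apply: (@wp_bind_le _ _ _ _ _ _ _ (10 * (size u + size v) + 20) (20 * size a + 26)); last by lia.
apply: (wp_wipe eW) => //.
apply: (@wp_bind_le _ _ _ _ _ _ _ (10 * size a + 10) (10 * size a + 16)); last by lia.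
apply: (wp_copyloop (u := [::]) (a := a) (b := [::])) => //; [by lk|by lk|].
apply: (@wp_bind_le _ _ _ _ _ _ _ (5 * size (catrev a [::]) + 8) (5 * size (catrev a [::]) + 8));
  last by rewrite catrevE cats0 size_rev; lia.
apply: (wp_goL (w := [::])); first by lk.
apply: (wp_goL (w := [::])); first by lk.
by apply: (eq_post h); rewrite !catrevE !cats0 revK; updeq.
Qed.

Definition popbit V W : prog unit :=
  bind (mv V MoveLeft) (fun _ => bind (rd V) (fun s =>
  if s is Some _ then bind (wr d V None) (fun _ =>
    bind (push d W (bit_sym (isone s))) (fun _ => ret tt))
  else bind (push d W (bit_sym false)) (fun _ => ret tt))).

Lemma wp_popbit A (Q : A -> conf -> Prop) V W a b n N ts k : V <> W ->
  ts V = Tp (bit_syms a) [::] -> ts W = Tp [::] b -> n + 5 <= N ->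
  wp (k tt) Q n (upd (upd ts V (Tp (bit_syms (behead a)) [::]))
    W (Tp [::] (bit_sym (head false a) :: b))) ->
  wp (bind (popbit V W) k) Q N ts.
Proof.
move=> VW eV eW hN h; apply: (@wp_bind_le _ _ _ _ _ _ _ 5 n); last by lia.
apply: (wp_mvL eV); case: a eV h => [|x a] eV h.
  rewrite [TpL _ _]TpL_nil; apply: (wp_rd (v := V) (u := [::]) (w := [::])); first by lk.
  apply: (wp_le (n := 2)) => //; apply: wp_push; first by lk.
  by apply: wp_ret; move: h; congr (wp _ _ _ _); updeq.
apply: (wp_rd (v := V) (u := bit_syms a) (w := [:: bit_sym x])); first by lk.
rewrite [ohead _]/= isone_bit_sym; apply: wp_erase; first by lk.
apply: wp_push; first by lk.
by apply: wp_ret; move: h; congr (wp _ _ _ _); updeq.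
Qed.

Definition shiftloop V Z W : prog unit := loop (fun _ : unit =>
  bind (rd V) (fun s => if isbit s then
    bind (mv V MoveRight) (fun _ => bind (popbit Z W) (fun _ => ret (inl tt)))
  else ret (inr tt))) tt.

Lemma wp_shiftloop V Z W k v a b Q ts : V <> W -> V <> Z -> Z <> W ->
  ts V = Tp v (nseq k (bit_sym true)) -> ts Z = Tp (bit_syms a) [::] -> ts W = Tp [::] b ->
  (forall t, Q tt (upd (upd (upd ts V t) Z (Tp (bit_syms (drop k a)) [::]))
      W (Tp [::] (catrev (bit_syms (mkseq (nth false a) k)) b)))) ->
  wp (shiftloop V Z W) Q (10 * k + 10) ts.
Proof.
move=> VW VZ WZ; elim: k v a b ts => [|k IH] v a b ts eV eZ eW h.
  apply: (@wp_loop_le _ _ _ _ _ _ _ 1 0) => //.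
  apply: (wp_rd eV); apply: wp_ret.
  by apply: eq_post; [apply: (h (ts V))|rewrite drop0; updeq].
apply: (@wp_loop_le _ _ _ _ _ _ _ 7 (10 * k + 10)); last by lia.
apply: (wp_rd eV); apply: (wp_mvR eV).
apply: (wp_popbit (n := 0) (a := a) (b := b)) => //; [by lk|by lk|].
apply: wp_ret; apply: (IH (bit_sym true :: v) (behead a) (bit_sym (head false a) :: b)); try by lk.
move=> t; apply: eq_post; first exact: (h t).
rewrite /mkseq /= (iotaDl 1 0) -map_comp -nth0.
have -> : drop k.+1 a = drop k (behead a) by case: (a).
rewrite (eq_map (f := nth false (behead a)) (g := nth false a \o addn 1)); first by updeq.
by move=> i; rewrite nth_behead.
Qed.

Definition restloop V W : prog unit := loop (fun _ : unit =>
  bind (mv V MoveLeft) (fun _ => bind (rd V) (fun s =>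
  if isbit s then bind (wr d V None) (fun _ =>
    bind (push d W (bit_sym (isone s))) (fun _ => ret (inl tt)))
  else ret (inr tt)))) tt.

Lemma wp_restloop V W a b Q ts : V <> W ->
  ts V = Tp (bit_syms a) [::] -> ts W = Tp [::] b ->
  Q tt (upd (upd ts V (Tp [::] [::])) W (Tp [::] (catrev (bit_syms a) b))) ->
  wp (restloop V W) Q (10 * size a + 10) ts.
Proof.
move=> VW; elim: a b ts => [|x a IH] b ts eV eW h.
  apply: (@wp_loop_le _ _ _ _ _ _ _ 2 0) => //.
  apply: (wp_mvL eV); rewrite [TpL _ _]TpL_nil.
  apply: (wp_rd (v := V) (u := [::]) (w := [::])); first by lk.
  by apply: wp_ret; apply: (eq_post h); updeq.
apply: (@wp_loop_le _ _ _ _ _ _ _ 5 (10 * size a + 10)); last by rewrite /=; lia.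
apply: (wp_mvL eV); apply: (wp_rd (v := V) (u := bit_syms a) (w := [:: bit_sym x])); first by lk.
rewrite [ohead _]/= isone_bit_sym; apply: wp_erase; first by lk.
apply: wp_push; first by lk.
apply: wp_ret; apply: (IH (bit_sym x :: b)); [by lk|by lk|].
by apply: (eq_post h); updeq.
Qed.

End Loops.

Arguments wp_push_one {d Aux T ot O A Q n m ts v k}.
Arguments wp_zerosloop {d Aux T ot O V W Z k u m z Q ts}.
Arguments wp_copybits {d Aux T ot O V W u a r b Q ts}.
Arguments wp_takeloop {d Aux T ot O V W Z k v u f z Q ts}.
Arguments wp_copy {d Aux T ot O V W a u v N Q ts}.
Arguments wp_popbit {d Aux T ot O A Q V W a b n N ts k}.
Arguments wp_shiftloop {d Aux T ot O V Z W k v a b Q ts}.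
Arguments wp_restloop {d Aux T ot O V W a b Q ts}.

Lemma digit_syms_dyadic_word (Aux : finType) g I F : digit_syms Aux (dyadic_word g I F) =
  (if g then [:: inl Minus] else [::]) ++ bit_syms Aux I ++ inl Point :: bit_syms Aux F.
Proof. by rewrite /dyadic_word !digit_syms_cat /= !digit_syms_bits; case: g. Qed.

Lemma canonb_size I : canonb I -> 0 < size I.
Proof. by case: I. Qed.

Section SkipSign.
Variables (d : nat) (Aux : finType) (T : eqType) (ot : 'I_d -> T).
Variable O : 'I_d -> nat -> seq (digit + Aux).

Definition skipsign (V : T) : prog d (digit + Aux)%type T bool :=
  bind (rd d Aux V) (fun s => if s is Some (inl Minus)
    then bind (mv d Aux V MoveRight) (fun _ => ret d _ T true) else ret d _ T false).

Lemma wp_skipsign V u g I r Q (ts : conf (digit + Aux) T) : 0 < size I ->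
  ts V = Tp u ((if g then [:: inl Minus] else [::]) ++ bit_syms Aux I ++ r) ->
  (forall u', Q g (upd ts V (Tp u' (bit_syms Aux I ++ r)))) ->
  wp ot (@isone Aux) O (skipsign V) Q 2 ts.
Proof.
move=> sI; case: g => eV h; apply: (wp_rd eV).
  by apply: (wp_mvR eV); apply: wp_ret; exact: h.
case: I sI eV h => // i I _ eV h /=.
by apply: wp_ret; apply: eq_post; [apply: (h u)|updeq].
Qed.

End SkipSign.

Arguments wp_skipsign {d Aux T ot O V u g I r Q ts}.

Lemma lval_mkseq_drop k a : lval (mkseq (nth false a) k ++ drop k a) = lval a.
Proof.
elim: k a => [|k IH] a; first by rewrite drop0.
have -> : mkseq (nth false a) k.+1 = head false a :: mkseq (nth false (behead a)) k.
  rewrite /mkseq /= (iotaDl 1 0) -map_comp nth0; congr (_ :: _).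
  by apply: eq_map => i /=; rewrite nth_behead.
have -> : drop k.+1 a = drop k (behead a) by case: (a).
by rewrite /= IH -lval_head.
Qed.

(* The number with digits I divided by [2 ^ s.+1], with a last digit 1 added;
   the digits of I are consumed from the right. *)
Definition shift_int s (I : seq bool) : seq bool :=
  let b := drop s.+1 (rev I) in rcons (rev (behead b)) (head false b).

Definition shift_frac s (I : seq bool) : seq bool :=
  let a := rev I in
  head false (drop s a) :: rcons (rev (mkseq (nth false a) s)) true.

Lemma size_shift_frac s I : size (shift_frac s I) = s.+2.
Proof. by rewrite /= size_rcons size_rev size_mkseq. Qed.

(** Cutting the digits at position s + 1, with zeros where I is too short, preserves their value;
    the last digit 1 then doubles it and adds 1. *)
Lemma mval_shift s I : mval (shift_int s I ++ shift_frac s I) = (mval I).*2.+1.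
Proof.
rewrite /shift_int /shift_frac -rcons_cons -rcons_cat mval_rcons add1n; congr _.*2.+1.
set a := rev I; rewrite /mval rev_cat rev_cons rev_rcons !revK.
have -> : drop s.+1 a = behead (drop s a) by rewrite -addn1 addnC -drop_drop drop1.
have lh b : lval (head false b :: behead b) = lval b by rewrite [RHS]lval_head.
rewrite -cats1 -catA lval_cat /= -[_ + (lval _).*2]/(lval (_ :: behead _)) lh -lval_head.
by rewrite -lval_cat lval_mkseq_drop.
Qed.

(** If no digit remains, the integer part is the single digit 0. Otherwise it is a nonempty prefix
    of I, which has more than one digit and so starts with 1. *)
Lemma canonb_shift_int s I : canonb I -> canonb (shift_int s I).
Proof.
rewrite /shift_int => cI; set b := drop _ _.
have rE : b <> [::] -> rcons (rev (behead b)) (head false b) = rev b.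
  by case: (b) => // x l _; rewrite rev_cons.
case: (eqVneq b [::]) => [->//|/eqP b0]; rewrite rE //.
have sI : s.+1 < size I.
  by rewrite ltnNge -(size_rev I); apply/negP => h; apply: b0; rewrite /b drop_oversize.
have -> : rev b = take (size I - s.+1) I.
  by rewrite /b -[X in take _ X]revK take_rev size_rev subKn // ltnW.
move: cI; rewrite /canonb; case: I sI {b b0 rE} => [//|x [|y I]] //= sI.
rewrite eqseq_cons andbF /= => ->.
by case E: (_ - _) => [|k]; [move: E sI; rewrite /=; lia|rewrite /= ?orbT].
Qed.

(** * Reading the argument, evaluating g and writing the result *)

Section RealFunction.
Variables (K : machine 1 0) (G : machine 1 2).
Let Aux : finType := (option (aux K) + option (aux G))%type.
Let Work : finType := (tape_id K + tape_id G + bool * bool)%type.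
Let T : finType := ('I_1 + 'I_1 + option Work)%type.
Let S := (digit + Aux)%type.
Local Notation prog := (prog 1 S T).
Local Notation ret a := (ret 1 S T a).
Local Notation bit_sym := (bit_sym Aux).

Let ot (i : 'I_1) : T := inl (inr i).
Variable Ow : 'I_1 -> nat -> seq digit.
Let O (i : 'I_1) (m : nat) : seq S := digit_syms Aux (Ow i m).
Local Notation wp := (wp ot (@isone Aux) O).

Let ek (t : tape_id K) : T := inr (Some (inl (inl t))).
Let eg (t : tape_id G) : T := inr (Some (inl (inr t))).
Let tX : T := inr (Some (inr (true, true))).
Let tZ : T := inr (Some (inr (true, false))).
Let tS : T := inr (Some (inr (false, true))).
Let tY : T := inr (Some (inr (false, false))).
Let In : T := inl (inl ord0).
Let Or : T := inl (inr ord0).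
Let Out : T := inr None.
Let KI : T := ek (input_tape K ord0).
Let KO : T := ek (output_tape K).
Let GO : T := eg (output_tape G).

Let jK (x : option (aux K)) : Aux := inl x.
Let jK' (x : Aux) : option (aux K) := if x is inl y then y else None.
Let jG (x : option (aux G)) : Aux := inr x.
Let jG' (x : Aux) : option (aux G) := if x is inr y then y else None.

Let HK (i : 'I_0) : prog unit := ret tt.
(** The arguments of g are dyadic and known exactly, so the answer is the same word for every
    query. *)
Let HG (i : 'I_2) : prog unit :=
  copy 1 Aux (if i == ord0 then tX else tY) (eg (oracle_tape G i)).

(** The initially blank oracle tape is the query 0, and the length of the integer part of its answer
    tells how large x can be. The counter tS collects the digits of the Lipschitz constant, n and 2,
    which makes s; the zero written before [zerosloop] accounts for the exponent s + 1 of y. *)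
Definition realfun_read : prog unit :=
  bind (call S T (ord0 : 'I_1)) (fun _ => bind (skipsign 1 Aux Or) (fun _ =>
  bind (countbits 1 Aux Or KI) (fun _ =>
  bind (push 1 KI (bit_sym true)) (fun _ => bind (push 1 KI (bit_sym true)) (fun _ =>
  bind (sim ek jK jK' HK) (fun _ =>
  bind (countbits 1 Aux KO tS) (fun _ => bind (countbits 1 Aux In tS) (fun _ =>
  bind (push 1 tS (bit_sym true)) (fun _ => bind (push 1 tS (bit_sym true)) (fun _ =>
  bind (wr 1 Or (@None S)) (fun _ =>
  bind (push 1 tY (inl Point : S)) (fun _ => bind (push 1 tY (bit_sym false)) (fun _ =>
  bind (zerosloop 1 Aux tS Or tY) (fun _ =>
  bind (push 1 tY (bit_sym true)) (fun _ =>
  bind (call S T (ord0 : 'I_1)) (fun _ => ret tt)))))))))))))))).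

(** The answer is traversed only up to its s-th fractional digit. The final point presents the
    integer as a dyadic number without fractional digits. *)
Definition realfun_arg : prog unit :=
  bind (skipsign 1 Aux Or) (fun g =>
  bind (copybits 1 Aux Or tX) (fun _ => bind (mv 1 Aux Or MoveRight) (fun _ =>
  bind (takeloop 1 Aux tS Or tX) (fun _ =>
  bind (put 1 tX (Some (bit_sym true)) MoveRight) (fun _ =>
  bind (put 1 tX (Some (inl Point : S)) MoveRight) (fun _ =>
  bind (goL 1 Aux tX) (fun _ => bind (striploop 1 Aux tX) (fun _ =>
  if g then bind (push 1 tX (inl Minus : S)) (fun _ => ret tt) else ret tt)))))))).

(** The fractional part of the value of g is ignored, at the cost of an error below 1. After
    copying, the head is behind the last digit, so the digits come off with the least significant
    one first, as suits an output that grows to the left. *)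
Definition realfun_write : prog unit :=
  bind (skipsign 1 Aux GO) (fun g =>
  bind (copybits 1 Aux GO tZ) (fun _ => bind (push 1 Out (bit_sym true)) (fun _ =>
  bind (shiftloop 1 Aux tS tZ Out) (fun _ => bind (popbit 1 Aux tZ Out) (fun _ =>
  bind (push 1 Out (inl Point : S)) (fun _ => bind (popbit 1 Aux tZ Out) (fun _ =>
  bind (restloop 1 Aux tZ Out) (fun _ =>
  if g then bind (push 1 Out (inl Minus : S)) (fun _ => ret tt) else ret tt)))))))).

Definition realfun_prog : prog unit :=
  bind realfun_read (fun _ => bind realfun_arg (fun _ => bind (sim eg jG jG' HG)
    (fun _ => realfun_write))).

(** The tapes that are still blank after [realfun_read]. *)
Definition fresh (z : T) : bool :=
  match z with
  | inr None | inr (Some (inl (inr _))) | inr (Some (inr (true, _))) => true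
  | _ => false
  end.

Lemma wp_realfun_write g I F u v s w (Q : unit -> conf S T -> Prop) ts :
  0 < size I -> ts GO = Tp u (digit_syms Aux (dyadic_word g I F) ++ v) ->
  ts tS = Tp w (nseq s (bit_sym true)) -> ts tZ = Tp [::] [::] -> ts Out = Tp [::] [::] ->
  (forall ts', ts' Out = Tp [::] (digit_syms Aux (dyadic_word g (shift_int s I)
    (shift_frac s I))) ->
     Q tt ts') ->
  wp realfun_write Q (30 * size I + 10 * s + 60) ts.
Proof.
(* The number of steps is left open, collected by the rules, and compared with the bound at the very
   end. *)
move=> sI eG eS eZ eO h; refine (wp_le _ _).
  apply: wp_bind; apply: (wp_skipsign (V := GO) (g := g) (I := I) sI).
    by rewrite eG digit_syms_dyadic_word -!catA; reflexivity.
  move=> u'; apply: wp_bind; apply: (wp_copybits (a := I) (b := [::])) => //; try by lk.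
  have -> : catrev (bit_syms Aux I) [::] = bit_syms Aux (rev I)
    by rewrite catrevE cats0 bit_syms_rev.
  apply: wp_push; first by lk.
  apply: wp_bind; apply: (wp_shiftloop (k := s) (a := rev I) (b := [:: bit_sym true])) => //;
    try by lk.
  move=> t.
  apply: (wp_popbit (a := drop s (rev I))) => //; try by lk.
  apply: wp_push; first by lk.
  apply: (wp_popbit (a := behead (drop s (rev I)))) => //; try by lk.
  apply: (@wp_bind_le _ _ _ _ _ _ _ (10 * size I + 10) 2); last by [].
  apply: (wp_le (n := 10 * size (behead (behead (drop s (rev I)))) + 10)); last first.
    by rewrite !size_behead size_drop size_rev; lia.
  apply: wp_restloop => //; try by lk.
  have outE : catrev (bit_syms Aux (behead (behead (drop s (rev I)))))
     (bit_sym (head false (behead (drop s (rev I)))) :: inl Point ::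
      bit_sym (head false (drop s (rev I))) ::
      catrev (bit_syms Aux (mkseq (nth false (rev I)) s)) [:: bit_sym true]) =
     bit_syms Aux (shift_int s I) ++ inl Point :: bit_syms Aux (shift_frac s I).
    rewrite /shift_int /shift_frac.
    have -> : drop s.+1 (rev I) = behead (drop s (rev I)) by rewrite -addn1 addnC -drop_drop drop1.
    by rewrite !catrevE -!bit_syms_rev -!cats1 !bit_syms_cat /= bit_syms_cat -!catA.
  case: (g) h => h.
    apply: wp_push; first by lk.
    apply: wp_ret; apply: h; lk; by rewrite digit_syms_dyadic_word -outE.
  apply: wp_ret; apply: h; lk; by rewrite digit_syms_dyadic_word -outE.
lia.
Qed.

Definition arg_bits s (I F : seq bool) := strip (I ++ rcons (mkseq (nth false F) s) true).

Definition arg_word g s I F : seq digit :=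
  (if g then [:: Minus] else [::]) ++ bit_digits (arg_bits s I F) ++ [:: Point].

Definition den_word s : seq digit := bit_digits (true :: nseq s.+1 false) ++ [:: Point].

Lemma wp_realfun_arg g I F s (Q : unit -> conf S T -> Prop) ts :
  0 < size I -> ts Or = Tp [::] (digit_syms Aux (dyadic_word g I F)) ->
  ts tS = Tp (nseq s (bit_sym true)) [::] -> ts tX = Tp [::] [::] ->
  (forall t, Q tt (upd (upd (upd ts Or t) tS (Tp [::] (nseq s (bit_sym true))))
     tX (Tp [::] (digit_syms Aux (arg_word g s I F))))) ->
  wp realfun_arg Q (30 * size I + 30 * s + 100) ts.
Proof.
move=> sI eO eS eX h; refine (wp_le _ _).
  apply: wp_bind; apply: (wp_skipsign (V := Or) (g := g) (I := I) sI).
    by rewrite eO digit_syms_dyadic_word; reflexivity.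
  move=> u'; apply: wp_bind; apply: (wp_copybits (a := I) (b := [::])) => //; try by lk.
  apply: wp_mvR; first by lk.
  apply: wp_bind; apply: (wp_takeloop (k := s) (f := F) (v := [::])) => //; try by lk.
  move=> t; rewrite cats0.
  apply: wp_put; first by lk.
  apply: wp_put; first by lk.
  apply: (@wp_bind_le _ _ _ _ _ _ _ (5 * (size I + s + 2) + 8) (10 * (size I + s + 1) + 12));
    last by [].
  set a := I ++ rcons (mkseq (nth false F) s) true.
  have sa : size a = size I + s + 1 by rewrite size_cat size_rcons size_mkseq; lia.
  set l := inl Point :: bit_sym true :: _.
  have lE : l = rev (bit_syms Aux a ++ [:: inl Point]).
    rewrite /l /a rev_cat -bit_syms_rev rev_cat rev_rcons bit_syms_cat /= !catrevE cats0.
    by rewrite -!bit_syms_rev.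
  have -> : size I + s + 2 = size l.
    by rewrite lE size_rev size_cat size_map sa /= ; lia.
  apply: (wp_goL (w := [::])); first by lk.
  have -> : catrev l [::] = bit_syms Aux a ++ [:: inl Point] by rewrite catrevE cats0 lE revK.
  apply: (@wp_bind_le _ _ _ _ _ _ _ (10 * (size I + s + 1) + 10) 2); last by lia.
  rewrite -sa; apply: (wp_striploop (a := a) (r := [:: inl Point])); try by lk.
  have awE : digit_syms Aux (arg_word g s I F) = (if g then [:: inl Minus] else [::]) ++
      bit_syms Aux (strip a) ++ [:: inl Point].
    by rewrite /arg_word !digit_syms_cat digit_syms_bits; case: (g).
  case: (g) h awE => h awE.
    apply: wp_push; first by lk.
    by apply: wp_ret; apply: eq_post; [apply: (h t)|rewrite awE; updeq].
  by apply: wp_ret; apply: eq_post; [apply: (h t)|rewrite awE; updeq].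
lia.
Qed.

Lemma wp_realfun_read g0 I0 F0 k TK n s (ins : 'I_1 -> seq digit) (Q : unit -> conf S T -> Prop) :
  ins ord0 = unary n -> canonb I0 -> Ow ord0 0 = dyadic_word g0 I0 F0 ->
  outputs K no_oracle (fun=> unary (size I0 + 2)) TK (binary k) ->
  s = size (bits k) + n + 2 ->
  (forall ts, ts Or = Tp [::] (digit_syms Aux (Ow ord0 s)) -> ts tS = Tp (nseq s (bit_sym true))
    [::] ->
     ts tY = Tp [::] (digit_syms Aux (den_word s)) -> (forall z, fresh z -> ts z = Tp [::] [::]) ->
     Q tt ts) ->
  wp realfun_read Q (10 * size I0 + 4 * TK + 30 * s + 80) (@start_conf 1 1 Aux Work ins).
Proof.
move=> iE cI wE hK sE h; set ts0 := @start_conf 1 1 Aux Work ins.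
have e0 z : z <> In -> ts0 z = Tp [::] [::].
  by case: z => [[i|i]|z] // zI; case: zI; rewrite [i]ord1.
have eI : ts0 In = Tp [::] (nseq n (bit_sym true)) by rewrite /ts0 /= iE unary_nseq.
refine (wp_le _ _).
  apply: wp_bind; apply: wp_call.
  have -> : sunary (@isone Aux) (ts0 (ot ord0)) = 0.
    by rewrite e0 //; apply: sunaryE.
  rewrite /O wE digit_syms_dyadic_word.
  apply: wp_bind; apply: (wp_skipsign (g := g0) (I := I0) (V := Or) (canonb_size cI)).
    by rewrite upd_same; reflexivity.
  move=> u'.
  apply: wp_bind; apply: (wp_countbits (V := Or) (W := KI) (a := I0) (m := 0)) => //;
    try by (lk; rewrite ?e0).
  rewrite addn0.
  apply: wp_push; first by lk.
  apply: wp_push; first by lk.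
  set ts1 := upd _ KI _.
  have f1 z : z <> In -> z <> Or -> z <> KI -> ts1 z = Tp [::] [::].
    by move=> zI zO zK; rewrite /ts1 !upd_other // e0.
  have fK : ts1 KI = Tp [::] (nseq (size I0 + 2) (bit_sym true))
    by rewrite /ts1 upd_same !addnS addn0.
  have fI : ts1 In = Tp [::] (nseq n (bit_sym true)) by rewrite /ts1; lk.
  have einj : injective ek by move=> t t' [].
  apply: wp_bind.
  apply: (@wp_sim _ _ _ _ _ _ _ _ _ einj jK jK' _ HK _ 0 _ ts1 ((size I0 + 3) + TK * 2)
    0 _ _ _ _ (size I0 + 2) _ hK) => //.
  - by case.
  - move=> t; case: t => [[i|[]//]|t]; last by rewrite f1.
    by rewrite [i]ord1 unary_nseq.
  - by move=> i; rewrite size_nseq.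
  - lia.
  move=> ts2 u2 v2 fr eKO hv sB; rewrite binaryE digit_syms_bits in eKO.
  have g1 z : (forall t, ek t <> z) -> ts2 z = ts1 z.
    by move=> hz; apply: fr => t; apply/eqP.
  apply: wp_bind; apply: (wp_countbits (V := KO) (W := tS) (a := bits k) (m := 0) _ eKO) => //.
  - by case: (ohead v2) hv => [[[b| |]|z]|] // /(_ (Bit b)).
  - by rewrite g1 // f1.
  apply: wp_bind; apply: (wp_countbits (V := In) (W := tS) (a := nseq n true) (r := [::])
    (u := [::])
    (m := size (bits k))) => //.
  - by lk; rewrite g1 // fI /bit_syms map_nseq cats0.
  - by lk; rewrite addn0.
  rewrite size_nseq.
  apply: wp_push; first by lk.
  apply: wp_push; first by lk.
  apply: wp_blank => t0 ht0.
  apply: wp_push; first by lk; rewrite g1 // f1.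
  apply: wp_push; first by lk.
  apply: wp_bind; apply: (wp_zerosloop (V := tS) (W := Or) (Z := tY) (k := s) (u := [::])
    (m := 0)) => //.
    by lk; rewrite sE addn2 (addnC n).
  rewrite addn0 => t1 ht1.
  apply: wp_push; first by lk.
  apply: wp_bind; apply: wp_call.
  have uE ts' : ts' Or = t1 -> sunary (@isone Aux) (ts' (ot ord0)) = s.
    by move=> e; rewrite [ts' _]e; exact: sunary_is_unary.
  rewrite uE; last by lk.
  apply: (@wp_ret _ _ _ _ _ _ _ _ _ 0); apply: h.
  - by lk.
  - by lk; rewrite cats0.
  - lk; rewrite /den_word digit_syms_cat digit_syms_bits /= /bit_syms map_nseq.
    by congr (Tp _ (_ :: _)); elim: (s) => //= j ->.
  move=> z fz.
  have nz v : fresh v = false -> z <> v by move=> fv zv; move: fz; rewrite zv fv.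
  rewrite !upd_other; try exact: nz.
  rewrite g1; last by move=> t te; move: fz; rewrite -te.
  by apply: f1; exact: nz.
rewrite size_nseq sE; lia.
Qed.

(** L0 and L1 bound the integer parts of the two answers, TK and TG the running times of the
    simulated machines, D the words given to g, and B the tapes in its simulation. *)
Definition realfun_time L0 L1 TK s TG :=
  let D := L1 + s + 10 in let B := 1 + TG * (D + 2) in
  (10 * L0 + 4 * TK + 30 * s + 80) + ((30 * L1 + 30 * s + 100) +
  ((TG.+1 * ((10 * B + 20 * D + 50) + 4)).+1 + (30 * B + 10 * s + 60))).

Lemma size_strip a : size (strip a) <= size a.
Proof. by elim: a => // -[] a IH //=; apply: leq_trans IH _. Qed.

Lemma wp_realfun g0 I0 F0 k TK n s g1 I1 F1 TG g2 I2 F2 (ins : 'I_1 -> seq digit)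
    (Q : unit -> conf S T -> Prop) :
  ins ord0 = unary n -> canonb I0 -> Ow ord0 0 = dyadic_word g0 I0 F0 ->
  outputs K no_oracle (fun=> unary (size I0 + 2)) TK (binary k) ->
  s = size (bits k) + n + 2 ->
  canonb I1 -> Ow ord0 s = dyadic_word g1 I1 F1 ->
  outputs G (fun i _ => if i == ord0 then arg_word g1 s I1 F1 else den_word s)
    (fun=> unary 0) TG (dyadic_word g2 I2 F2) -> canonb I2 ->
  (forall ts, ts Out =
     Tp [::] (digit_syms Aux (dyadic_word g2 (shift_int s I2) (shift_frac s I2))) -> Q tt ts) ->
  wp realfun_prog Q (realfun_time (size I0) (size I1) TK s TG) (@start_conf 1 1 Aux Work ins).
Proof.
move=> iE c0 w0 hK sE c1 w1 hG c2 h; rewrite /realfun_time.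
set D := size I1 + s + 10; set B := 1 + TG * (D + 2).
apply: wp_bind; apply: (wp_realfun_read iE c0 w0 hK sE) => ts1 eO eS eY ef.
apply: wp_bind; apply: (@wp_realfun_arg g1 I1 F1 s) => //.
- exact: canonb_size.
- by rewrite eO w1.
- exact: ef.
move=> t; set ts2 := upd _ tX _.
have eX2 : ts2 tX = Tp [::] (digit_syms Aux (arg_word g1 s I1 F1)) by rewrite /ts2; lk.
have eY2 : ts2 tY = Tp [::] (digit_syms Aux (den_word s)) by rewrite /ts2; lk.
have eS2 : ts2 tS = Tp [::] (nseq s (bit_sym true)) by rewrite /ts2; lk.
have ef2 z : fresh z -> z <> tX -> ts2 z = Tp [::] [::].
  move=> fz zX; have nz v : fresh v = false -> z <> v by move=> fv zv; move: fz; rewrite zv fv.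
  by rewrite /ts2 !upd_other ?ef //; exact: nz.
have sX : size (arg_word g1 s I1 F1) <= D.
  rewrite /arg_word !size_cat /bit_digits size_map /= /D /arg_bits.
  have := size_strip (I1 ++ rcons (mkseq (nth false F1) s) true).
  by rewrite size_cat size_rcons size_mkseq; case: (g1) => /=; lia.
have sY : size (den_word s) <= D.
  by rewrite /den_word size_cat /bit_digits size_map /= size_nseq /D; lia.
have einj : injective eg by move=> a b [].
apply: wp_bind.
apply: (@wp_sim _ _ _ _ _ _ _ _ _ einj jG jG' _ HG _ D _ ts2 B (10 * B + 20 * D + 50)
  _ _ _ _ 0 _ hG) => //.
- by move=> i m; apply: leq_trans (leq_addl _ _); case: ifP.
- move=> i u v ts Q' fr eW sB hQ.
  have eV : ts (if i == ord0 then tX else tY) =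
      Tp [::] (digit_syms Aux (if i == ord0 then arg_word g1 s I1 F1 else den_word s)).
    by rewrite fr; [case: ifP|case: ifP].
  apply: (wp_copy _ eV eW _ hQ); first by case: ifP.
  have sa : size (digit_syms Aux (if i == ord0 then arg_word g1 s I1 F1 else den_word s)) <= D.
    by rewrite size_map; case: ifP.
  by rewrite leq_add2r; apply: leq_add; rewrite leq_mul2l.
- by move=> [[i|i]|i]; rewrite ef2.
move=> ts3 u v fr eG hv sB.
have sI2 : size I2 <= B.
  by move: sB; rewrite /dyadic_word !size_cat /= !size_map; lia.
apply: (wp_le (n := 30 * size I2 + 10 * s + 60)); last by lia.
apply: (@wp_realfun_write g2 I2 F2 u v s [::]) => //.
- exact: canonb_size.
- by rewrite fr.
- by rewrite fr // ef2.
- by rewrite fr // ef2.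
Qed.

Lemma outputs_realfun g0 I0 F0 k TK n s g1 I1 F1 TG g2 I2 F2 (ins : 'I_1 -> seq digit) :
  ins ord0 = unary n -> canonb I0 -> Ow ord0 0 = dyadic_word g0 I0 F0 ->
  outputs K no_oracle (fun=> unary (size I0 + 2)) TK (binary k) ->
  s = size (bits k) + n + 2 ->
  canonb I1 -> Ow ord0 s = dyadic_word g1 I1 F1 ->
  outputs G (fun i _ => if i == ord0 then arg_word g1 s I1 F1 else den_word s)
    (fun=> unary 0) TG (dyadic_word g2 I2 F2) -> canonb I2 ->
  outputs (mach realfun_prog) Ow ins (realfun_time (size I0) (size I1) TK s TG)
    (dyadic_word g2 (shift_int s I2) (shift_frac s I2)).
Proof.
move=> iE c0 w0 hK sE c1 w1 hG c2; refine (mach_outputs _).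
apply: (wp_realfun iE c0 w0 hK sE c1 w1 hG c2) => ts eO; exists [::]; exact: eO.
Qed.

End RealFunction.

(** * Error bounds *)

Section RealBounds.

Local Open Scope ring_scope.

Variable R : realType.
Implicit Types (I F : seq bool).

Lemma divn_bounds (m d : nat) : (0 < d)%N ->
  (m %/ d)%:R <= m%:R / d%:R :> R /\ m%:R / d%:R < (m %/ d)%:R + 1 :> R.
Proof.
move=> d0; have d0' : 0 < d%:R :> R by rewrite ltr0n.
rewrite ler_pdivlMr // ltr_pdivrMr // natr1 -!natrM ler_nat ltr_nat.
by rewrite leq_trunc_div ltn_ceil.
Qed.

Lemma ratr_dyadic_value g I F : ratr (dyadic_value g I F) =
  (-1) ^+ g * ((mval (I ++ F))%:R / 2 ^+ size F) :> R.
Proof.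
rewrite /dyadic_value mulrA fmorph_div !rmorphM /= rmorph_sign ratr_nat.
by rewrite rmorphXn /= ratr_nat.
Qed.

Lemma pow2_gt0 n : 0 < 2 ^+ n :> R.
Proof. by rewrite exprn_gt0. Qed.

(** The last digit 1 denotes the midpoint of the dyadic interval of length 2 ^- m that contains x /
    y. *)
Lemma quot_digits_error (x y m : nat) : (0 < y)%N ->
  `|x%:R / y%:R - (mval ((quot_digits x y m).1 ++ (quot_digits x y m).2))%:R / 2 ^+ m.+1|
    <= 2 ^- m :> R.
Proof.
move=> y0; rewrite /quot_digits /=; set q := (x * 2 ^ m %/ y)%N.
have -> : mval (bits (q %/ 2 ^ m) ++ rcons (frac_bits q m) true) = (q.*2.+1)%N.
  rewrite -rcons_cat mval_rcons add1n mval_cat mval_bits size_frac_bits mval_frac_bits.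
  by rewrite -divn_eq.
have [q1 q2] := @divn_bounds (x * 2 ^ m) y y0; rewrite -/q natrM natrX in q1 q2.
have P0 := pow2_gt0 m; have y0' : 0 < y%:R :> R by rewrite ltr0n.
rewrite exprS -natr1 -mul2n natrM.
set t := x%:R / y%:R; set P := 2 ^+ m in P0 q1 q2 *.
have tE : x%:R * P / y%:R = t * P by rewrite /t mulrAC.
rewrite tE in q1 q2.
have u0 : 0 < P^-1 by rewrite invr_gt0.
have Pu : P * P^-1 = 1 by rewrite mulfV // gt_eqF.
have h1 : q%:R * P^-1 <= t by rewrite ler_pdivrMr.
have h2 : t <= (q%:R + 1) * P^-1 by rewrite ler_pdivlMr // ltW.
have -> : (2%:R * q%:R + 1) / (2 * P) = q%:R * P^-1 + P^-1 / 2.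
  by field; rewrite gt_eqF.
by rewrite ler_norml; apply/andP; split; lra.
Qed.

(** The odd number is the midpoint of an interval of length 2, between even integers, that contains
    N / d. *)
Lemma odd_trunc_error (N d : nat) : (0 < d)%N ->
  `|((N %/ (2 * d)).*2.+1)%:R - N%:R / d%:R| <= 1 :> R.
Proof.
move=> d0; have [] := @divn_bounds N (2 * d) ltac:(lia).
set k := (N %/ _)%N; rewrite -natr1 -mul2n !natrM.
have d0' : 0 < d%:R :> R by rewrite ltr0n.
have -> : N%:R / (2%:R * d%:R) = N%:R / d%:R / 2 :> R by field; rewrite gt_eqF.
by move=> h1 h2; rewrite ler_norml; apply/andP; split; lra.
Qed.

(** Truncation to s places in integral form: m comes from the digits cut off, and is 0 if zeros had
    to be appended instead. *)
Lemma mkseq_nth_trunc I F s : exists2 m, (m < 2 ^ size F)%N &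
  (mval (I ++ F) * 2 ^ s = mval (I ++ mkseq (nth false F) s) * 2 ^ size F + m)%N.
Proof.
have [h|h] := leqP (size F) s.
  exists 0; first by rewrite expn_gt0.
  have -> : mkseq (nth false F) s = F ++ nseq (s - size F) false.
    apply: (@eq_from_nth _ false); first by rewrite size_mkseq size_cat size_nseq subnKC.
    move=> i; rewrite size_mkseq => hi; rewrite nth_mkseq // nth_cat nth_nseq if_same.
    by case: ltnP => // hF; rewrite nth_default.
  have m0 k : mval (nseq k false) = 0 by elim: k => //= k IH; rewrite mval_cons IH.
  rewrite catA [in RHS]mval_cat m0 size_nseq !addn0 -mulnA -expnD.
  by rewrite subnK.
have -> : mkseq (nth false F) s = take s F.
  apply: (@eq_from_nth _ false); first by rewrite size_mkseq size_takel // ltnW.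
  by move=> i; rewrite size_mkseq => hi; rewrite nth_mkseq // nth_take.
exists (mval (drop s F) * 2 ^ s)%N.
  have -> : (2 ^ size F = 2 ^ size (drop s F) * 2 ^ s)%N.
    by rewrite size_drop -expnD subnK // ltnW.
  by rewrite ltn_pmul2r ?expn_gt0 // mval_lt.
rewrite -{1}(cat_take_drop s F) catA mval_cat mulnDl -mulnA -expnD size_drop.
by rewrite subnK // ltnW.
Qed.

Lemma trunc_bounds I F s :
  let v := (mval (I ++ F))%:R / 2 ^+ size F * 2 ^+ s : R in
  (mval (I ++ mkseq (nth false F) s))%:R <= v /\
  v < (mval (I ++ mkseq (nth false F) s))%:R + 1.
Proof.
have [m mF e] := mkseq_nth_trunc I F s.
have P0 := pow2_gt0 (size F).
rewrite /= mulrAC ler_pdivlMr // ltr_pdivrMr // natr1 -!natrX -!natrM ler_nat ltr_nat e.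
by split; lia.
Qed.

Lemma int_part_bounds I F :
  (mval I)%:R <= (mval (I ++ F))%:R / 2 ^+ size F :> R /\
  (mval (I ++ F))%:R / 2 ^+ size F < (mval I)%:R + 1 :> R.
Proof. by have := trunc_bounds I F 0; rewrite /mkseq /= cats0 expr0 mulr1. Qed.

Lemma normr_signM (g : bool) (x : R) : `|(-1) ^+ g * x| = `|x| :> R.
Proof. by rewrite normrM normr_sign mul1r. Qed.

End RealBounds.

(** * Estimates for radius, running time and output length *)

Lemma radius_le (R : realType) d (x : 'rV[R]_d) j :
  (forall i, `|x 0 i| <= 2 ^+ j)%R -> Defs.radius x <= j.
Proof.
by move=> h; rewrite /Defs.radius; case: ex_minnP => k _; apply; apply/forallP.
Qed.

Lemma le_radius (R : realType) d (x : 'rV[R]_d) i : (`|x 0 i| <= 2 ^+ Defs.radius x)%R.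
Proof. by rewrite /Defs.radius; case: ex_minnP => k /forallP. Qed.

Lemma scaled_time_mono a b n a' b' n' : a <= a' -> b <= b' -> n <= n' ->
  scaled_time a b n <= scaled_time a' b' n'.
Proof.
move=> ha hb hn; rewrite /scaled_time /scaled_space.
by repeat first [assumption | exact: leqnn | apply: leq_add | apply: leq_mul | rewrite ltnS].
Qed.

Lemma realfun_time_mono a b k s n a' b' k' s' n' :
  a <= a' -> b <= b' -> k <= k' -> s <= s' -> n <= n' ->
  realfun_time a b k s n <= realfun_time a' b' k' s' n'.
Proof.
move=> ha hb hk hs hn; rewrite /realfun_time.
by repeat first [assumption | exact: leqnn | apply: leq_add | apply: leq_mul | rewrite ltnS].
Qed.

Lemma pb_succ F : poly_bounded F -> poly_bounded (fun a b => (F a b).+1).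
Proof. by move=> h; apply: pb_le (pb_add h (pb_const 1)) _ => a b; rewrite addn1. Qed.

Lemma pb_scaled_time F1 F2 F3 : poly_bounded F1 -> poly_bounded F2 -> poly_bounded F3 ->
  poly_bounded (fun a b => scaled_time (F1 a b) (F2 a b) (F3 a b)).
Proof.
move=> h1 h2 h3; rewrite /scaled_time /scaled_space.
by repeat first [assumption | exact: pb_const | apply: pb_add | apply: pb_mul | apply: pb_succ].
Qed.

Lemma pb_realfun_time F1 F2 F3 F4 F5 : poly_bounded F1 -> poly_bounded F2 -> poly_bounded F3 ->
  poly_bounded F4 -> poly_bounded F5 ->
  poly_bounded (fun a b => realfun_time (F1 a b) (F2 a b) (F3 a b) (F4 a b) (F5 a b)).
Proof.
move=> h1 h2 h3 h4 h5; rewrite /realfun_time.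
by repeat first [assumption | exact: pb_const | apply: pb_add | apply: pb_mul | apply: pb_succ].
Qed.

Lemma outputs_le e d (M : machine e d) O ins T T' w :
  T <= T' -> outputs M O ins T w -> outputs M O ins T' w.
Proof.
move=> hT; rewrite /outputs -(subnK hT) iterD.
case: (iter T _ _) => s ts [hs hw].
have -> : iter (T' - T) (step O) (s, ts) = (s, ts).
  by elim: (T' - T) => //= n ->; rewrite /= hs.
by [].
Qed.

(** A step enlarges the lists of a tape by at most two cells. This bounds the length of a Lipschitz
    constant by the time needed to compute it. *)
Lemma size_outputs e (M : machine e 0) O ins T w N :
  (forall i, size (ins i) <= N) -> outputs M O ins T w -> size w <= N + 2 * T.
Proof.
move=> hN; rewrite /outputs.
have : forall t, size ((iter T (step O) (initial M ins)).2 t).1 +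
    size ((iter T (step O) (initial M ins)).2 t).2 <= N + 2 * T.
  elim: T => [|T IH] t.
    rewrite /= ffunE; case: t => [[i|i]|i]; rewrite //= ?size_map ?addn0 //; exact: hN.
  rewrite iterS; case: (iter T _ _) IH => s ts /= IH.
  case: ifP => _; first by have := IH t; rewrite /=; lia.
  case: (query s) => [[[]]//|].
  case: (delta _ _) => s' a; rewrite /= ffunE.
  have := IH t; case: (ts t) => l r /=; case: (a t) => b m; rewrite /act /=.
  by case: m => /=; rewrite !size_behead; lia.
case: (iter T _ _) => s ts /= h [_ hw].
have := h (output_tape M); have := congr1 size hw.
rewrite /word_at size_takel ?find_size // size_map => <-.
by move=> hh; apply: leq_trans (find_size _ _) (leq_trans (leq_addl _ _) hh).
Qed.

(** * The two implications *)

Section Directions.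

Local Open Scope ring_scope.

Variable R : realType.
Implicit Types (f : R -> R).

Definition quot_approx (x y : int) (m : nat) : rat :=
  let c := quot_digits `|x|%N `|y|%N m in dyadic_value (x < 0) c.1 c.2.

Lemma last_true_mval I F : last true F -> F <> [::] -> (0 < mval (I ++ F))%N.
Proof.
case: (lastP F) => // F' b; rewrite last_rcons => -> _.
by rewrite -rcons_cat mval_rcons.
Qed.

Lemma quot_approx_word x y m :
  binary_dyadic (quot_approx x y m) = quot_word (x < 0) `|x| `|y| m.
Proof.
rewrite /quot_approx binary_dyadic_value //; first exact: bits_canonb.
  by rewrite /= last_rcons.
left; apply: last_true_mval; first by rewrite /= last_rcons.
by rewrite /=; case: (frac_bits _ _).
Qed.

Lemma size_quot_frac x y m : size (quot_digits x y m).2 = m.+1.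
Proof. by rewrite /= size_rcons size_frac_bits. Qed.

Lemma quot_approx_CF (x y : int) : 1 <= y ->
  CF (x%:~R / y%:~R : R) (quot_approx x y).
Proof.
move=> y1 m; split; first exact: dyadic_dyadic_value.
have y0 : (0 < `|y|)%N by lia.
have yE : y%:~R = `|y|%N%:R :> R by rewrite -{1}[y]gez0_abs //; lia.
have xE : x%:~R = (-1) ^+ (x < 0)%R * `|x|%N%:R :> R.
  by rewrite {1}[x]intEsign rmorphM /= rmorph_sign.
rewrite ratr_dyadic_value xE yE -mulrA -mulrBr normr_signM size_quot_frac.
exact: quot_digits_error.
Qed.

(** The error is 1 for the precision multiplied by y, 1 for rounding to an odd integer, and 1/4 for
    the approximation within C; this stays below 3. *)
Lemma definable_of_polytime (C : (R -> R -> R) -> Prop) f :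
  approximates C polytime_int2 -> polytime_real1 f -> definable C f.
Proof.
move=> C_approx [M [p hM]].
pose n0 (y : int) := (size (bits `|y|) + 2)%N.
have [p' hp'] : poly_bounded (fun a b => scaled_time a b (eval2 p a (b + 2))).
  apply: pb_scaled_time; [exact: pb_fst|exact: pb_snd|].
  by apply: pb_eval2; [exact: pb_fst|apply: pb_add; [exact: pb_snd|exact: pb_const]].
have sz (z : int) : (size (bits `|z|) <= size (binary_int z))%N.
  by rewrite /binary_int size_cat size_binary leq_addl.
have ex (xy : int * int) : exists z : int,
    outputs (mach (scaled_prog M)) no_oracle
      (fun i => binary_int (if i == ord0 then xy.1 else xy.2))
      (eval2 p' (size (binary_int xy.1)) (size (binary_int xy.2))) (binary_int z) /\
    (1 <= xy.2 -> `|z%:~R - xy.2%:~R * f (xy.1%:~R / xy.2%:~R)| <= 2 :> R).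
  case: xy => x y /=.
  have time2 := hp' (size (binary_int x)) (size (binary_int y)).
  set ins := fun i : 'I_2 => binary_int (if i == ord0 then x else y).
  have [y1|y1] := leP 1 y; last first.
    exists 0; split => //.
    apply: (@outputs_le _ _ _ _ _ 2).
      by apply: leq_trans time2; rewrite /scaled_time; lia.
    rewrite [binary_int 0](binaryE 0) (bits_small false); apply: outputs_scaled_zero.
    have : (y < 0) || (y == 0) by lia.
    by rewrite /ins /binary_int /=; case: ltP => //= _ /eqP ->.
  have y0 : (0 < `|y|)%N by lia.
  pose phi := quot_approx x y.
  pose xr : 'rV[R]_1 := \row__ (x%:~R / y%:~R).
  have hphi : forall i : 'I_1, CF (xr 0 i) phi.
    by move=> i; rewrite mxE; exact: quot_approx_CF.
  have [q [dq oq eq]] := hM xr (fun=> phi) hphi (n0 y).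
  have [ng [I [F [cI wI qE]]]] := dyadic_valueP dq.
  rewrite wI in oq.
  set v := ((mval (I ++ F) * `|y|) %/ 2 ^ (size F).+1)%N.
  pose a := v.*2.+1.
  exists ((-1) ^+ ng * a%:Z).
  (* Division by y does not increase the absolute value, so the radius is bounded by the length of
     x, and the running time of M by a polynomial in the lengths of x and y. *)
  have sxy : (Defs.radius xr <= size (binary_int x))%N.
    apply: radius_le => i; rewrite mxE; apply: (@le_trans _ _ `|x%:~R|).
      rewrite normrM ler_piMr // normfV invf_le1 ?normr_gt0 ?intr_eq0; last by lia.
      by rewrite -intr_norm ler1z; lia.
    rewrite -intr_norm -abszE -[X in X <= _]/(`|x|%N%:R) -natrX ler_nat.
    by apply: leq_trans (ltnW (lt_size_bits _)) _; rewrite leq_exp2l.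
  split.
    set Tm := eval2 p (Defs.radius xr) (n0 y) in oq.
    apply: (@outputs_le _ _ _ _ _ (scaled_time (size (bits `|x|)) (size (bits `|y|)) Tm)).
      apply: leq_trans time2; apply: scaled_time_mono; rewrite ?sz //.
      by apply: eval2_mono => //; rewrite leq_add2r.
    have -> : binary_int ((-1) ^+ ng * a%:Z) =
        (if ng then [:: Minus] else [::]) ++ bit_digits (bits a).
      have := @binary_intE ng (bits a) (bits_canonb a); rewrite mval_bits; apply.
      by left.
    refine (outputs_scaled y0 _ _ cI _).
    - by rewrite /ins eqxx /binary_int binaryE.
    - by rewrite /ins /= /binary_int binaryE; case: ltP => //; lia.
    move: oq; congr (outputs _ _ _ _ _); apply/funext => i; apply/funext => m.
    by rewrite quot_approx_word.
  move=> _; rewrite intrM rmorph_sign /= -[(a : int)%:~R]/(a%:R).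
  have := @odd_trunc_error R (mval (I ++ F) * `|y|) (2 ^ size F) ltac:(by rewrite expn_gt0).
  rewrite -expnS -/v -/a natrM natrX => e1.
  have yE : y%:~R = `|y|%N%:R :> R by rewrite -{1}[y]gez0_abs //; lia.
  move: eq; rewrite qE ratr_dyadic_value mxE => eq.
  have yR : 0 < y%:~R :> R by rewrite ltr0z; lia.
  set Q := (mval (I ++ F))%:R / 2 ^+ size F in eq e1.
  have e1' : `|(-1) ^+ ng * a%:R - y%:~R * ((-1) ^+ ng * Q)| <= 1 :> R.
    rewrite mulrCA -mulrBr normr_signM; apply: le_trans e1.
    by rewrite yE /Q mulrAC [_ / _ * _]mulrC mulrA.
  have e2 : `|y%:~R * ((-1) ^+ ng * Q) - y%:~R * f (x%:~R / y%:~R)| <= 1.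
    rewrite -mulrBr normrM gtr0_norm //.
    apply: le_trans (ler_wpM2l (ltW yR) eq) _.
    rewrite ler_pdivrMr ?exprn_gt0 // mul1r yE -natrX ler_nat.
    apply: leq_trans (ltnW (lt_size_bits _)) _.
    by rewrite leq_exp2l // leq_addr.
  by apply: le_trans (ler_distD (y%:~R * ((-1) ^+ ng * Q)) _ _) _; lra.
(* The outputs for all pairs, including those with y < 1, are collected into a function on the
   integers. *)
have [h hP] := choice ex.
have [|g' Cg' hg'] := C_approx (fun x y => h (x, y)).
  by exists (mach (scaled_prog M)), p' => x y; case: (hP (x, y)).
exists g' => // x y y1.
have [_ /(_ y1) /= e1] := hP (x, y).
have e2 := hg' x y.
move: e1 e2.
set A := g' _ _; set B := (h _)%:~R; set D := _ * f _.
rewrite !ler_norml => /andP[? ?] /andP[? ?]; apply/andP; split; lra.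
Qed.

Lemma CF_const (q : rat) : dyadic q -> CF (ratr q : R) (fun=> q).
Proof. by move=> dq n; split => //; rewrite subrr normr0 invr_ge0 exprn_ge0. Qed.

Lemma arg_word_dyadic g s I F :
  arg_word g s I F = binary_dyadic (dyadic_value g (arg_bits s I F) [::]).
Proof.
have m0 : (0 < mval (arg_bits s I F))%N.
  rewrite mval_strip; apply: last_true_mval; first by rewrite last_rcons.
  by case: mkseq.
rewrite binary_dyadic_value //; last by left; rewrite cats0.
by apply: canon_strip; rewrite -mval_strip.
Qed.

Lemma den_word_dyadic s :
  den_word s = binary_dyadic (dyadic_value false (true :: nseq s.+1 false) [::]).
Proof. by rewrite binary_dyadic_value //; right. Qed.

Lemma mval_nseq_false k : mval (nseq k false) = 0%N.
Proof. by elim: k => //= k IH; rewrite mval_cons IH. Qed.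

(** The absolute value of the approximation is at most 2 ^ j + 1, hence below 2 ^ (j + 2). The time
    spent on an answer can thus be bounded by the radius of x, although the answer is arbitrary. *)
Lemma size_int_part I F j (x e : R) g : canonb I ->
  `|x - ratr (dyadic_value g I F)| <= e -> e <= 1 -> `|x| <= 2 ^+ j -> (size I <= j + 2)%N.
Proof.
move=> cI h e1 hx; rewrite -(bits_mval cI); apply: size_bits_lt; last by rewrite addn2.
rewrite ratr_dyadic_value in h.
have [h1 _] := int_part_bounds R I F.
have h2 : `|(-1) ^+ g * ((mval (I ++ F))%:R / 2 ^+ size F)| <= `|x| + 1 :> R.
  by rewrite -[X in `|X|](subKr x) (le_trans (ler_normB _ _)) // lerD2l; lra.
rewrite normr_signM ger0_norm in h2; last by rewrite divr_ge0 ?ler0n ?exprn_ge0.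
have P1 : 1 <= 2 ^+ j :> R by rewrite exprn_ege1 ?ler1n.
rewrite -(ltr_nat R) natrX exprD; lra.
Qed.

(** With w = 2 ^- s, the point X / Y is within w of the approximation to x, hence within 2 w of x,
    and f changes by at most 2 k w. The errors 1 of rounding, 1 of computing g and 3 of
    definability, divided by Y = 2 / w, contribute 5/2 w. The sum is below (4 k + 4) w. *)
Lemma approx_error f (h : R -> R -> R) (g1 g2 : bool) (N m s n k i : nat) (p q x : R) :
  (forall y z, `|y| <= 2 ^+ i -> `|z| <= 2 ^+ i -> `|f y - f z| <= k%:R * `|y - z|) ->
  N%:R <= p * 2 ^+ s -> p * 2 ^+ s < N%:R + 1 -> m%:R <= q -> q < m%:R + 1 ->
  `|x - (-1) ^+ g1 * p| <= 2 ^- s ->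
  let X : R := (-1) ^+ g1 * (N.*2.+1)%:R in let Y : R := 2 ^+ s.+1 in
  `|(-1) ^+ g2 * q - h X Y| <= 1 -> `|h X Y - Y * f (X / Y)| <= 3 ->
  `|x| + 2 <= 2 ^+ i -> (4 * k%:R + 4) * 2 ^+ n <= 2 ^+ s :> R ->
  `|(-1) ^+ g2 * ((m.*2.+1)%:R / 2 ^+ s.+2) - f x| <= 2 ^- n.
Proof.
move=> lip N1 N2 m1 m2 hx X Y e1 e2 bx hs.
have P0 := pow2_gt0 R s; set w := 2 ^- s in hx *.
have w0 : 0 < w by rewrite invr_gt0.
have Pw : 2 ^+ s * w = 1 by rewrite mulfV // gt_eqF.
have w1 : w <= 1 by rewrite invf_le1 // exprn_ege1 ?ler1n.
have Y0 : 0 < Y by exact: pow2_gt0.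
have YE : Y = 2 * 2 ^+ s by rewrite /Y exprS.
set r := (-1) ^+ g2 * _.
have rE : r * Y = (-1) ^+ g2 * (m%:R + 1 / 2).
  rewrite /r -mulrA; congr (_ * _); rewrite YE -natr1 -mul2n natrM !exprS.
  by field; rewrite gt_eqF.
have XE : X / Y = (-1) ^+ g1 * ((N%:R + 1 / 2) * w).
  rewrite /X -mulrA; congr (_ * _); rewrite YE -natr1 -mul2n natrM /w.
  by field; rewrite gt_eqF.
have e3 : `|r * Y - (-1) ^+ g2 * q| <= 1.
  rewrite rE -mulrBr normr_signM; clear - m1 m2.
  by rewrite ler_norml; apply/andP; split; lra.
have e4 : `|r - f (X / Y)| <= 5 / 2 * w.
  have -> : 5 / 2 * w = 5 / Y by rewrite YE /w; field; rewrite gt_eqF.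
  rewrite ler_pdivlMr // -[X in _ * X](gtr0_norm Y0) -normrM mulrBl [f _ * _]mulrC.
  have d1 := ler_distD ((-1) ^+ g2 * q) (r * Y) (Y * f (X / Y)).
  have d2 := ler_distD (h X Y) ((-1) ^+ g2 * q) (Y * f (X / Y)).
  by clear - d1 d2 e1 e2 e3; lra.
have e5 : `|X / Y - x| <= 2 * w.
  have d1 := ler_distD ((-1) ^+ g1 * p) (X / Y) x.
  have d2 : `|X / Y - (-1) ^+ g1 * p| <= w.
    rewrite XE -mulrBr normr_signM.
    have pE : p = p * 2 ^+ s * w by rewrite -mulrA Pw mulr1.
    have h1 : N%:R * w <= p by rewrite pE ler_pM2r.
    have h2 : p <= (N%:R + 1) * w by rewrite {1}pE ler_pM2r // ltW.
    by clear - h1 h2 w0; rewrite ler_norml; apply/andP; split; lra.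
  by rewrite distrC in hx; clear - d1 d2 hx; lra.
have e6 : `|f (X / Y) - f x| <= k%:R * (2 * w).
  (* The distance 2 w is at most 2, so the margin in the bound on x keeps X / Y in the interval
     where k is a Lipschitz constant. *)
  apply: le_trans (lip _ _ _ _) _; last by rewrite ler_wpM2l.
    have := ler_normD (X / Y - x) x; rewrite subrK => d1.
    by clear - d1 e5 w1 bx; lra.
  by clear - bx; lra.
have e7 : (4 * k%:R + 4) * w <= 2 ^- n.
  by rewrite -[2 ^- n]mul1r ler_pdivlMr ?exprn_gt0 // mulrAC ler_pdivrMr // mul1r.
have d1 := ler_distD (f (X / Y)) r (f x).
have k0 : 0 <= k%:R * w by rewrite mulr_ge0 // ltW.
by clear - e4 e6 e7 d1 k0 w0; lra.
Qed.

(** The words on the tapes depend on the oracle, but the time bound may depend only on the radius j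
    and on n. All lengths are therefore estimated in terms of these two. *)
Lemma polytime_of_definable (C : (R -> R -> R) -> Prop) f :
  (forall g, C g -> polytime_real2 g) -> locally_poly_lipschitz f ->
  definable C f -> polytime_real1 f.
Proof.
move=> C_poly [_ [kf [lip [MK [pK hK]]]]] [g Cg hg].
have [MG [pG hG]] := C_poly g Cg.
pose L (j : nat) := (j + 2)%N.
(* A bound on s: the constant is computed for an index of at most j + 4, and the length of an output
   is at most that of the input plus twice the time. *)
pose sb (j n : nat) := (j + 4 + 2 * pK.[j + 4]%R + n + 2)%N.
(* Both arguments of g are integers of at most L j + sb j n + 1 binary digits, which bounds their
   radius. *)
pose TG (j n : nat) := eval2 pG (L j + sb j n + 1) 0.
have [p hp] : poly_bounded (fun j n =>
    realfun_time (L j) (L j) pK.[j + 4]%R (sb j n) (TG j n)).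
  rewrite /TG /sb /L.
  apply: pb_realfun_time; repeat first [exact: pb_const | exact: pb_fst | exact: pb_snd
    | apply: pb_add | apply: pb_mul | apply: pb_horner | apply: pb_eval2].
exists (mach (realfun_prog MK MG)), p => x phi hphi n.
set j := Defs.radius x; have hj : `|x 0 0| <= 2 ^+ j by exact: le_radius.
have [d0 a0] := hphi ord0 0%N.
have [g0 [I0 [F0 [c0 w0 v0]]]] := dyadic_valueP d0.
have sI0 : (size I0 <= L j)%N.
  by rewrite v0 in a0; apply: (size_int_part c0 a0 _ hj); rewrite expr0 invr1.
(* As |x| is less than 2 ^ size I0 + 1, the number |x| + 2 is at most 4 * 2 ^ size I0, that is, 2 ^
   i. *)
set i := (size I0 + 2)%N; set k := kf i.
have oK := hK i; rewrite -/k in oK.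
set s := (size (bits k) + n + 2)%N.
have [d1 a1] := hphi ord0 s.
have [g1 [I1 [F1 [c1 w1 v1]]]] := dyadic_valueP d1.
have es1 : 2 ^- s <= 1 :> R by rewrite invf_le1 ?exprn_gt0 // exprn_ege1 ?ler1n.
have sI1 : (size I1 <= L j)%N.
  by rewrite v1 in a1; exact: (size_int_part c1 a1 es1 hj).
set A := arg_bits s I1 F1.
pose qX := dyadic_value g1 A [::]; pose qY := dyadic_value false (true :: nseq s.+1 false) [::].
pose psi (i : 'I_2) (m : nat) := if i == ord0 then qX else qY.
pose xy : 'rV[R]_2 := \row_i' ratr (if i' == ord0 then qX else qY).
have hpsi i' : CF (xy 0 i') (psi i').
  by rewrite mxE /psi; apply: CF_const; case: ifP => _; exact: dyadic_dyadic_value.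
(* Precision 0, that is, an error of at most 1, is enough, because the value will be divided by 2 ^
   s.+1. *)
have [q2 [d2 o2 e2]] := hG xy psi hpsi 0%N.
have [g2 [I2 [F2 [c2 w2 v2]]]] := dyadic_valueP d2.
rewrite w2 in o2; set Tg := eval2 pG _ _ in o2.
set r := dyadic_value g2 (shift_int s I2) (shift_frac s I2).
have sK : (size (bits k) <= j + 4 + 2 * pK.[j + 4]%R)%N.
  have := @size_outputs _ MK _ _ _ _ i _ oK; rewrite size_binary => hs.
  apply: leq_trans (hs _) _; first by move=> _; rewrite size_nseq.
  apply: leq_add; first by rewrite /i; move: sI0; rewrite /L; lia.
  by rewrite leq_mul2l horner_nat_mono // /i; move: sI0; rewrite /L; lia.
have ssb : (s <= sb j n)%N by rewrite /s /sb; lia.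
have mS := mval_shift s I2.
exists r; split; first exact: dyadic_dyadic_value.
  rewrite /r binary_dyadic_value; first last.
  - by left; rewrite mS.
  - by rewrite /= last_rcons.
  - exact: canonb_shift_int.
  have sTg : (Tg <= TG j n)%N.
    rewrite /Tg /TG; apply: eval2_mono => //; apply: radius_le => i'; rewrite mxE.
    have sA : (size A <= L j + sb j n + 1)%N.
      apply: leq_trans (size_strip _) _.
      by rewrite size_cat size_rcons size_mkseq; lia.
    have le2 (a : seq bool) : (size a <= L j + sb j n + 1)%N ->
        (mval a)%:R <= 2 ^+ (L j + sb j n + 1) :> R.
      move=> sa; rewrite -natrX ler_nat (leq_trans (ltnW (mval_lt a))) //.
      by rewrite leq_exp2l.
    case: ifP => _; rewrite ratr_dyadic_value normr_signM cats0 expr0 divr1 ger0_norm ?ler0n //;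
      apply: le2 => //.
    by rewrite /= size_nseq /L; lia.
  apply: (@outputs_le _ _ _ _ _ (realfun_time (size I0) (size I1) pK.[i]%R s Tg)).
    apply: leq_trans (hp j n); apply: realfun_time_mono => //.
    by apply: horner_nat_mono; rewrite /i; move: sI0; rewrite /L; lia.
  refine (outputs_realfun _ c0 w0 oK _ c1 w1 _ c2) => //.
  move: o2; congr (outputs _ _ _ _ _); apply/funext => i'; apply/funext => m.
  by rewrite /psi; case: ifP => _; rewrite ?arg_word_dyadic ?den_word_dyadic.
have [t1 t2] := trunc_bounds R I1 F1 s.
have [u1 u2] := int_part_bounds R I2 F2.
set N := mval (I1 ++ mkseq (nth false F1) s) in t1 t2.
have mA : mval A = N.*2.+1.
  by rewrite mval_strip -rcons_cat mval_rcons add1n.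
rewrite v1 ratr_dyadic_value in a1; rewrite v0 ratr_dyadic_value expr0 invr1 in a0.
have mY : (mval (true :: nseq s.+1 false))%:R = 2 ^+ s.+1 :> R.
  by rewrite mval_cons mval_nseq_false size_nseq addn0 mul1n natrX.
move: e2; rewrite v2 ratr_dyadic_value !mxE /= expr0 invr1.
rewrite !ratr_dyadic_value !cats0 !expr0 !divr1 mul1r mA mY => e2.
have hd := hg ((-1) ^+ g1 * (N.*2.+1)%:Z) (2 ^+ s.+1) ltac:(by rewrite exprn_ege1).
rewrite !rmorphM /= rmorph_sign rmorphXn /= in hd.
rewrite size_shift_frac mS.
apply: (@approx_error f g g1 g2 N (mval I2) s n k i _ _ _ _ t1 t2 u1 u2 a1 e2 hd) => //.
- move=> y z hy hz; have := lip i (y, z) => /=; apply.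
  by split; rewrite /= in_itv /= -ler_norml.
- have [_ h0] := int_part_bounds R I0 F0.
  have h1 : `|x 0 0| <= `|(-1) ^+ g0 * ((mval (I0 ++ F0))%:R / 2 ^+ size F0)| + 1.
    by rewrite -[X in `|X|](subrK ((-1) ^+ g0 * ((mval (I0 ++ F0))%:R / 2 ^+ size F0)))
      (le_trans (ler_normD _ _)) // addrC lerD2l.
  have p0 : 0 <= (mval (I0 ++ F0))%:R / 2 ^+ size F0 :> R by rewrite divr_ge0 ?exprn_ge0.
  rewrite normr_signM (ger0_norm p0) in h1.
  have h2 : (mval I0)%:R + 1 <= 2 ^+ size I0 :> R by rewrite natr1 -natrX ler_nat mval_lt.
  have h3 : 1 <= 2 ^+ size I0 :> R by rewrite exprn_ege1 ?ler1n.
  rewrite /i exprD; lra.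
(* The summand 2 in s supplies the factor 4, and the length of k the factor k + 1. *)
rewrite /s !exprD mulrAC ler_pM2r ?exprn_gt0 //.
have : k%:R + 1 <= 2 ^+ size (bits k) :> R by rewrite natr1 -natrX ler_nat lt_size_bits.
lra.
Qed.

End Directions.

Local Open Scope classical_set_scope.

Theorem theorem13 (R : realType) (C : set (R -> R -> R))
    (C_polytime : C `<=` @polytime_real2 R)
    (C_approx : approximates C polytime_int2)
    (f : R -> R) (f_lip : locally_poly_lipschitz f) :
  polytime_real1 f <-> definable C f.
Proof.
split; first exact: definable_of_polytime.
exact: polytime_of_definable.
Qed.
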